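(* Let $\lambda>0$ and let $\alpha\in\mathbb{R}$ be such that the rotation $\theta\mapsto\theta+2\alpha$ on $\mathbb{T}=\mathbb{R}/\mathbb{Z}$ is uniquely ergodic (i.e. $\alpha$ is irrational). Let $\hat n$ be the integrated density of states of the strip operators $\widehat{\mathcal{S}}_\theta$, and let $\rho(2\alpha,\hat A^E)$ (for $E\ne0$) and $\rho(T_\alpha,S_E^v)$ be the fibered rotation numbers defined in the context. Then: (1) for $E>0$, $\hat n(E)=1-\rho(2\alpha,\hat A^E)$; (2) for $E<0$, $\hat n(E)=\tfrac12-\rho(2\alpha,\hat A^E)$. Moreover, $\rho(2\alpha,\hat A^{0+})=\tfrac12+\rho(2\alpha,\hat A^{0-})$, where $\rho(2\alpha,\hat A^{0\pm})$ denote the one-sided limits as $E\to0^{\pm}$, and $$\rho(2\alpha,\hat A^E)=\begin{cases}2\rho(T_\alpha,S^v_E)&\text{if }E>0,\\ 2\rho(T_\alpha,S^v_E)-\frac12&\text{if }E<0.\end{cases}$$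
   Context: Strip operator: for $\theta\in\mathbb{T}$, $\widehat{\mathcal{S}}_\theta$ acts on $\ell^2(\mathbb{Z},\mathbb{C}^2)$ by $$[\widehat{\mathcal{S}}_{\theta}\boldsymbol{u}](n)=\widehat{C}\boldsymbol{u}(n+1)+\widehat{C}\boldsymbol{u}(n-1)+\widehat{V}(2n\alpha+\theta)\boldsymbol{u}(n),\quad \widehat{C}=\begin{pmatrix}\lambda&0\\0&0\end{pmatrix},\quad \widehat{V}(\theta)=\begin{pmatrix}0&1+e^{-2\pi i\theta}\\1+e^{2\pi i\theta}&0\end{pmatrix}.$$ Integrated density of states: let $\widehat{\mathcal{S}}_\theta|_{[1,N]}$ be the $2N\times2N$ Hermitian matrix obtained by restricting to sites $1,\dots,N$ with Dirichlet boundary conditions, with eigenvalues $E_{\theta,N}^{(1)}\le\dots\le E_{\theta,N}^{(2N)}$. For a.e. $\theta$, $\hat n_{\theta,N}(E)=\frac1{2N}\#\{j:E^{(j)}_{\theta,N}\le E\}$ converges as $N\to\infty$ to a continuous non-decreasing function $\hat n(E)$ independent of $\theta$; this is the integrated density of states. Equivalently, $\hat n$ is the distribution function of $\int_{\mathbb{T}}\frac12(d\hat\mu_{\theta,\boldsymbol\delta_0}+d\hat\mu_{\theta,\boldsymbol\gamma_0})\,d\theta$, where $\hat\mu_{\theta,\boldsymbol\delta_0},\hat\mu_{\theta,\boldsymbol\gamma_0}$ are the spectral measures of $\widehat{\mathcal{S}}_\theta$ for the vectors $\boldsymbol\delta_0=\delta_0(1,0)^\top$, $\boldsymbol\gamma_0=\delta_0(0,1)^\top$.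 Cocycles: for $E\neq0$, $$\hat A^E(\theta)=\begin{pmatrix}\frac{E^2-2-2\cos2\pi\theta}{E\lambda}&-1\\1&0\end{pmatrix}\in \mathrm{SL}(2,\mathbb{R}),$$ over the rotation $\theta\mapsto\theta+2\alpha$ on $\mathbb{T}$. On $\mathbb{T}\times\mathbb{Z}_2$ let $T_\alpha(\theta,n)=(\theta+\alpha,n+1)$, let $v(\theta,0)=2\lambda\cos2\pi\theta$, $v(\theta,1)=0$, and $S_E^v(\theta,n)=\begin{pmatrix}E-v(\theta,n)&-1\\1&0\end{pmatrix}$. Fibered rotation number: for a uniquely ergodic homeomorphism $T$ of a compact metric space $X$ and a continuous $A:X\to \mathrm{SL}(2,\mathbb{R})$ homotopic to the identity, the map $(x,\phi)\mapsto(Tx,A(x)\phi/\|A(x)\phi\|)$ on $X\times\mathbb{S}^1$ ($\mathbb{S}^1$ the unit vectors of $\mathbb{R}^2$) has a continuous lift $(x,\phi)\mapsto(Tx,\tilde f_A(x,\phi))$ to $X\times\mathbb{R}$ (via $\phi\mapsto e^{2\pi i\phi}$) with $\tilde f_A(x,\phi+1)=\tilde f_A(x,\phi)+1$ and $\tilde f_A(x,\cdot)$ strictly increasing. Writing $\tilde f^n_A$ for the second component of the $n$-th iterate of the lift, $\rho(T,A)=\lim_{n\to\infty}\frac{\tilde f_A^{n}(x,\phi)-\phi}{n} \bmod \mathbb{Z}$, independent of $(x,\phi)$ and of the lift. $\rho(2\alpha,A)$ denotes $\rho(T,A)$ with $X=\mathbb{T}$, $T\theta=\theta+2\alpha$.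 For the cocycles above the representative of the rotation number in $[0,\frac12]$ is used.
   Formalization: On the disconnected base T×Z_2 the rotation number mod Z depends on the lift (adding 1 on one circle shifts it by 1/2), so ρ(T_α,S_E^v) is computed only with lifts f whose values f(x,0) have the same integer part on both circles. *)

(* Defs.v *)
From HB Require Import structures.
From mathcomp Require Import all_boot all_order all_algebra.
From mathcomp Require Import generic_quotient ring_quotient spectral complex.
From mathcomp Require Import all_classical all_reals all_analysis.

Set Implicit Arguments.
Unset Strict Implicit.
Unset Printing Implicit Defensive.
Import Order.TTheory GRing.Theory Num.Theory.
Import numFieldNormedType.Exports.
Local Open Scope classical_set_scope.
Local Open Scope ring_scope.
Local Open Scope complex_scope.

(* exp (2 pi i theta) *)
Definition cis (R : realType) (theta : R) : R[i] :=
  cos (2 * pi * theta) +i* sin (2 * pi * theta).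

Definition Chat (R : realType) (lambda : R) : 'M[R[i]]_2 :=
  \matrix_(a, b) if (a == 0) && (b == 0) then lambda%:C else 0.

Definition Vhat (R : realType) (theta : R) : 'M[R[i]]_2 :=
  \matrix_(a, b) if a == b then 0
                 else if a == 0 then 1 + cis (- theta) else 1 + cis theta.

(* The operator is given by its formula on all sequences u : Z -> C^2. *)
Definition strip (R : realType) (lambda alpha theta : R)
    (u : int -> 'cV[R[i]]_2) : int -> 'cV[R[i]]_2 :=
  fun n => Chat lambda *m u (n + 1) + Chat lambda *m u (n - 1)
           + Vhat (2 * n%:~R * alpha + theta) *m u n.

Definition site_vec (R : realType) (n : int) (a : 'I_2) : int -> 'cV[R[i]]_2 :=
  fun m => if m == n then delta_mx a 0 else 0.

(* Compression to the sites 1..N.  The row (or column) p < 2N stands for the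
   component p %% 2 at the site p %/ 2 + 1. *)
Definition strip_box (R : realType) (lambda alpha theta : R) (N : nat)
    : 'M[R[i]]_(2 * N) :=
  \matrix_(p, q)
    strip lambda alpha theta
      (site_vec R (q %/ 2).+1%:Z (inord (q %% 2)))
      (p %/ 2).+1%:Z (inord (p %% 2)) 0.

Lemma strip_boxE (R : realType) (lambda alpha theta : R) (N : nat)
    (p q : 'I_(2 * N)) (i := (p %/ 2).+1) (j := (q %/ 2).+1)
    (a : 'I_2 := inord (p %% 2)) (b : 'I_2 := inord (q %% 2)) :
  strip_box lambda alpha theta N p q =
    if i == j then Vhat (2 * i%:R * alpha + theta) a b
    else if (j == i.+1) || (i == j.+1) then Chat lambda a b else 0.
Proof.
have ifM (M : 'M[R[i]]_2) (c : bool) :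
    (M *m (if c then delta_mx b 0 else 0) : 'cV_2) a 0 = if c then M a b else 0.
  by case: c; rewrite ?mulmx0 -?colE mxE.
rewrite /strip_box mxE /strip /site_vec -/i -/j -/a -/b.
rewrite mxE [X in X + _]mxE !ifM; move: i j => i j.
have -> : (i%:Z + 1 == j%:Z) = (j == i.+1) by rewrite addrC -intS eqz_nat eq_sym.
have -> : (i%:Z - 1 == j%:Z) = (i == j.+1) by rewrite subr_eq addrC -intS eqz_nat.
rewrite eqz_nat; have [->|ij] := eqVneq i j.
  by rewrite ltn_eqF // !add0r.
rewrite addr0; have [->|] := eqVneq j i.+1; last by rewrite add0r.
by rewrite ltn_eqF ?addr0 // leqW.
Qed.

Lemma strip_box_hermitian (R : realType) (lambda alpha theta : R) (N : nat) :
  strip_box lambda alpha theta N \is hermsymmx.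
Proof.
apply/is_hermitianmxP; rewrite expr0 scale1r; apply/matrixP => p q.
have cisN (t : R) : cis (- t) = (cis t)^*%R by rewrite /cis mulrN cosN sinN.
rewrite [RHS]mxE [X in _ = _ X]mxE !strip_boxE.
rewrite [(q %/ 2).+1 == (p %/ 2).+1]eq_sym [X in if X then _ else 0]orbC.
have [->|_] := eqVneq.
  rewrite !mxE [_ == inord (p %% 2)]eq_sym; have [|ab] := eqVneq; first by rewrite rmorph0.
  have [a0|a0] := eqVneq; have [b0|b0] := eqVneq; rewrite ?rmorphD ?rmorph1 /= ?cisN ?conjCK //.
    by rewrite a0 b0 eqxx in ab.
  by move: ab a0 b0; do 2!case: (inord _) => -[|[|]].
case: ifP => _; last by rewrite rmorph0.
rewrite !mxE andbC; case: ifP => _; rewrite ?rmorph0 //.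
by congr (_ +i* _)%C; rewrite oppr0.
Qed.

(* spectral_diag lists the eigenvalues with multiplicity because strip_box is
   Hermitian (strip_box_hermitian); on R[i], z <= E%:C means that z is real and
   at most E. *)
Definition eig_count (R : realType) (lambda alpha theta : R) (N : nat) (E : R)
    : nat :=
  #|[set j | spectral_diag (strip_box lambda alpha theta N) 0 j <= E%:C]%SET|.

Definition ids_box (R : realType) (lambda alpha theta : R) (N : nat) (E : R)
    : R :=
  (eig_count lambda alpha theta N E)%:R / (2 * N)%:R.

(* As strip is 1-periodic in theta, almost every theta in R/Z is the same as
   Lebesgue-almost every real theta. *)
Definition is_IDS (R : realType) (lambda alpha : R) (n : R -> R) : Prop :=
  [/\ continuous n,
      {homo n : E E' / E <= E'} &
      {ae lebesgue_measure, forall theta : R, forall E : R,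
        ids_box lambda alpha theta N E @[N --> \oo] --> n E}].

(* is_IDS determines n, so this is the integrated density of states. *)
Definition IDS (R : realType) (lambda alpha : R) : R -> R :=
  get [set n | is_IDS lambda alpha n].

(* (cos 2 pi phi, sin 2 pi phi), the image of phi under R -> S^1 *)
Definition circle_pt (R : realType) (phi : R) : 'cV[R]_2 :=
  \col_i if i == 0 then cos (2 * pi * phi) else sin (2 * pi * phi).

Definition enorm (R : realType) (u : 'cV[R]_2) : R :=
  Num.sqrt (\sum_i u i 0 ^+ 2).

Definition proj_act (R : realType) (M : 'M[R]_2) (u : 'cV[R]_2) : 'cV[R]_2 :=
  (enorm (M *m u))^-1 *: (M *m u).

(* Second components f of the lifts (x, phi) |-> (T x, f (x, phi)). *)
Definition lifts (R : realType) (X : topologicalType) (A : X -> 'M[R]_2)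
    : set (X * R -> R) :=
  [set f : X * R -> R | [/\ continuous f,
      forall x phi, f (x, phi + 1) = f (x, phi) + 1,
      forall x, {homo (fun phi => f (x, phi)) : s t / s < t} &
      forall x phi, circle_pt (f (x, phi)) = proj_act (A x) (circle_pt phi)]].

Definition lift_iter (R : realType) (X : Type) (T : X -> X) (f : X * R -> R)
    (n : nat) (x : X) (phi : R) : R :=
  (iter n (fun p => (T p.1, f p)) (x, phi)).2.

(* The representative in [0, 1/2] of the rotation number mod Z, computed with
   the lifts in L. *)
Definition rotation_number (R : realType) (X : Type) (T : X -> X)
    (L : set (X * R -> R)) : R :=
  get [set r : R | 0 <= r <= 1 / 2 /\
    exists f, L f /\ exists k : int, forall x phi,
      (lift_iter T f n x phi - phi) / n%:R @[n --> \oo] --> r + k%:~R].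

(* Lifts of A over a connected base differ by an integer constant.  Over a
   disconnected base they differ by a locally constant integer function, which
   can change the rotation number by a non-integer: over T x Z_2, adding 1 on
   one of the two circles adds 1/2.  A Schroedinger matrix maps (1, 0) into the
   open upper half plane, so requiring a common integer part for f (x, 0) picks
   the same branch on all components and leaves only an integer constant. *)
Definition coherent_lifts (R : realType) (X : topologicalType)
    (A : X -> 'M[R]_2) : set (X * R -> R) :=
  [set f : X * R -> R | lifts A f /\
    forall x y, Num.floor (f (x, 0)) = Num.floor (f (y, 0))].

Definition Zsub (R : realType) : zmodClosed R :=
  GRing.ZmodClosed.clone R (@Num.int_num_subdef R) _.

Definition torus (R : realType) : Type :=
  quotient_topology (Quotient.quot (Zsub R)).
HB.instance Definition _ (R : realType) :=
  Topological.copy (torus R) (quotient_topology (Quotient.quot (Zsub R))).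
HB.instance Definition _ (R : realType) :=
  Quotient.copy (torus R) (quotient_topology (Quotient.quot (Zsub R))).

Definition rot (R : realType) (a : R) (x : torus R) : torus R :=
  \pi_(torus R)%qT (repr x + a).

Definition schrodinger (R : realType) (t : R) : 'M[R]_2 :=
  \matrix_(i, j) if i == 0 then (if j == 0 then t else - 1)
                 else (if j == 0 then 1 else 0).

(* Functions on the torus are written through representatives; their formulas
   are 1-periodic. *)
Definition Ahat (R : realType) (lambda E : R) (x : torus R) : 'M[R]_2 :=
  schrodinger ((E ^+ 2 - 2 - 2 * cos (2 * pi * repr x)) / (E * lambda)).

Definition Z2 : Type := discrete_topology 'Z_2.

Definition T_skew (R : realType) (alpha : R) (p : torus R * Z2)
    : torus R * Z2 :=
  (rot alpha p.1, (p.2 : 'Z_2) + 1).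

Definition v_mosaic (R : realType) (lambda : R) (p : torus R * Z2) : R :=
  if (p.2 : 'Z_2) == 0 then 2 * lambda * cos (2 * pi * repr p.1) else 0.

Definition S_mosaic (R : realType) (lambda E : R) (p : torus R * Z2)
    : 'M[R]_2 :=
  schrodinger (E - v_mosaic lambda p).

Definition rho_strip (R : realType) (lambda alpha E : R) : R :=
  rotation_number (rot (2 * alpha)) (lifts (Ahat lambda E)).

Definition rho_mosaic (R : realType) (lambda alpha E : R) : R :=
  rotation_number (T_skew alpha) (coherent_lifts (S_mosaic lambda E)).

(* Main.v *)
(* Everything is reduced to the positive index of real Jacobi forms, that is,
   to the maximal dimension of a subspace on which the form is positive.

   The transfer cocycle of [u (n + 1) + u (n - 1) = t n * u n] has an explicit
   lift, along which the angle of [(u (n + 1), u n)] gains a half turn exactly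
   at each sign change of [u].  By Sturm oscillation the number of sign changes
   on a box is, up to a constant, the positive index of the form
   [J - diag t], so twice the rotation number is its density.  The rotation
   number exists for every starting point because iterates of the lift are
   additive up to 1, while a dense orbit makes their oscillation over the base
   sublinear; the same block comparison makes it continuous in the potential.

   Eliminating the second component of each site of the strip by a Schur
   complement turns the box [strip - E] into the Jacobi form of [Ahat], plus or
   minus the identity on the eliminated sites: this gives (1) and (2).
   Eliminating the odd sites of the mosaic model in the same way gives an almost
   Mathieu form with the dual coupling.  On a box of length [q], with [p / q]
   close to the frequency, both almost Mathieu forms are close to cyclic ones,
   which the discrete Fourier transform exchanges; the continuity of the
   rotation number absorbs the error.

   For [E] near 0 the diagonal of the strip form dominates outside a set of
   sites whose density tends to 0, hence the two one-sided limits. *)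

From HB Require Import structures.
From mathcomp Require Import all_boot all_order all_algebra.
From mathcomp Require Import generic_quotient ring_quotient spectral complex.
From mathcomp Require Import all_classical all_reals all_analysis.
From mathcomp Require Import zify ring lra.
Require Import Defs.

Set Implicit Arguments.
Unset Strict Implicit.
Unset Printing Implicit Defensive.
Import Order.TTheory GRing.Theory Num.Theory.
Import numFieldNormedType.Exports.
Local Open Scope classical_set_scope.
Local Open Scope ring_scope.

(** * The lift of a Schroedinger matrix *)

(** No eigenvalue is ever located: counts matter only up to [o(N)], and a bounded number of linear
    constraints costs a bounded change of index. The index is defined through subspaces because one
    comparison lemma then carries it along linear maps that need not be unitary or even injective,
    such as forgetting the eliminated coordinates. The spaces are complex because the strip and the
    Fourier transform are.

    The positive index counts eigenvalues above [E], hence the [1 -] in (1). For [E < 0] the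
    eliminated coordinates have positive diagonal [- E] and add [N] to the index on [2 * N]
    coordinates: this is the 1/2 in (2), and again the 1/2 in the mosaic formula.

    The obstacle in the duality is that a box is not cyclic for an irrational frequency. A fraction
    [p / q] describes a box of length [q] only up to a small shift of the diagonal, so the
    comparison is an inequality at a shifted energy, available only for special lengths. It suffices
    because the limits on both sides are already known to exist.

    Convergence is proved for every base point. At [E = 0], where the cocycle is undefined, the
    density of states is squeezed by monotonicity. *)

Section Trigonometry.
Context {R : realType}.
Implicit Types (t x phi w : R) (k : int).

Lemma cos_2pi_addz x k : cos (2 * pi * (x + k%:~R)) = cos (2 * pi * x) :> R.
Proof.
have H n y : cos (2 * pi * (y + n%:R)) = cos (2 * pi * y) :> R.
  rewrite mulrDr [X in _ + X](_ : _ = (pi *+ 2) *+ n); last first.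
    by rewrite -[RHS]mulr_natr -[pi *+ 2]mulr_natl.
  by rewrite (periodicn (@cosD2pi R)).
case: k => n; first exact: H.
by rewrite -[in RHS](subrK n.+1%:R x) H NegzE mulrNz.
Qed.

Lemma sin_2pi_addz x k : sin (2 * pi * (x + k%:~R)) = sin (2 * pi * x) :> R.
Proof.
have H n y : sin (2 * pi * (y + n%:R)) = sin (2 * pi * y) :> R.
  rewrite mulrDr [X in _ + X](_ : _ = (pi *+ 2) *+ n); last first.
    by rewrite -[RHS]mulr_natr -[pi *+ 2]mulr_natl.
  by rewrite (periodicn (@sinD2pi R)).
case: k => n; first exact: H.
by rewrite -[in RHS](subrK n.+1%:R x) H NegzE mulrNz.
Qed.

Lemma cos_2pi_half x : cos (2 * pi * (x + 1 / 2)) = - cos (2 * pi * x) :> R.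
Proof. by rewrite -cosDpi; congr cos; field. Qed.

Lemma sin_2pi_half x : sin (2 * pi * (x + 1 / 2)) = - sin (2 * pi * x) :> R.
Proof. by rewrite -sinDpi; congr sin; field. Qed.

Lemma cos_2pi_eq1 x : cos (2 * pi * x) = 1 -> exists k, x = k%:~R.
Proof.
move=> cx; exists (Num.floor x).
have lo : 0 <= x - (Num.floor x)%:~R by rewrite subr_ge0 floor_le_tmp.
have hi : x - (Num.floor x)%:~R < 1 by rewrite ltrBlDr addrC -intrD1 lt_succ_floor.
apply/eqP; rewrite -subr_eq0 eq_le lo andbT leNgt; apply/negP => pos.
have : cos (2 * pi * (x - (Num.floor x)%:~R)) = 1.
  by rewrite -(cos_2pi_addz _ (Num.floor x)) subrK.
set y := x - _ in pos lo hi *.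
have -> : 2 * pi * y = (pi * y) *+ 2 by rewrite -mulr_natl; ring.
rewrite cos_mulr2n cos2sin2 => h.
have s0 : sin (pi * y) > 0.
  apply: sin_gt0_pi; rewrite mulr_gt0 ?pi_gt0 //=.
  by rewrite -[ltRHS]mulr1 ltr_pM2l ?pi_gt0.
have : sin (pi * y) ^+ 2 = 0 by lra.
by move/eqP; rewrite sqrf_eq0 gt_eqF.
Qed.

Lemma cos_2pi_inj x y : cos (2 * pi * x) = cos (2 * pi * y) ->
  sin (2 * pi * x) = sin (2 * pi * y) -> exists k, x = y + k%:~R.
Proof.
move=> hc hs; have [k hk] : exists k, x - y = k%:~R.
  apply: cos_2pi_eq1; rewrite mulrBr cosB hc hs.
  by rewrite -!expr2 cos2Dsin2.
by exists k; rewrite -hk addrC subrK.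
Qed.

Lemma cos_2atan w : cos (2 * atan w) = (1 - w ^+ 2) / (1 + w ^+ 2).
Proof.
have h : 0 < 1 + w ^+ 2 by have := sqr_ge0 w; lra.
rewrite mulr_natl cos_mulr2n cos_atan exprVn sqr_sqrtr ?ltW //.
by field; rewrite gt_eqF.
Qed.

Lemma sin_2atan w : sin (2 * atan w) = 2 * w / (1 + w ^+ 2).
Proof.
have h : 0 < 1 + w ^+ 2 by have := sqr_ge0 w; lra.
have c0 : cos (atan w) != 0 by rewrite cos_atan invr_eq0 gt_eqF // sqrtr_gt0.
have -> : sin (2 * atan w) = 2 * tan (atan w) * cos (atan w) ^+ 2.
  by rewrite mulr_natl sin_mulr2n /tan -mulr_natl; field.
rewrite atanK cos_atan exprVn sqr_sqrtr ?ltW //.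
Qed.

End Trigonometry.

Section Lift.
Context {R : realType}.
Implicit Types (t x phi w : R) (k : int).

Definition schr_norm t phi : R :=
  Num.sqrt ((t * cos (2 * pi * phi) - sin (2 * pi * phi)) ^+ 2
            + cos (2 * pi * phi) ^+ 2).

(* [[t, -1], [1, 0]] is the quarter turn after the shear [[1, 0], [-t, 1]];
   the shear never turns a vector by pi, so the angle by which it turns a
   unit vector is 2 atan (y / (r + x)), a formula without branch cut. *)
Definition schr_slope t phi : R :=
  - t * cos (2 * pi * phi) ^+ 2
  / (schr_norm t phi + 1 - t * sin (2 * pi * phi) * cos (2 * pi * phi)).

(** Angles are measured in full turns: 1/4 is the quarter turn, and [atan / pi] is the angle
    [2 atan] of the shear divided by [2 pi]. *)
Definition schr_lift t phi : R := phi + 1 / 4 + atan (schr_slope t phi) / pi.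

Lemma schr_norm_gt0 t phi : 0 < schr_norm t phi.
Proof.
rewrite /schr_norm sqrtr_gt0; have := cos2Dsin2 (2 * pi * phi).
set c := cos _; set s := sin _ => h.
have := sqr_ge0 c; have := sqr_ge0 (t * c - s); rewrite le_eqVlt => /orP[/eqP e|h1 h2].
  rewrite -e add0r le_eqVlt => /orP[/eqP e2|//]; exfalso.
  have c0 : c = 0 by apply/eqP; rewrite -sqrf_eq0 -e2.
  move: e h; rewrite c0 mulr0 add0r sqrrN => <-; lra.
lra.
Qed.

Lemma schr_norm_sqr t phi : schr_norm t phi ^+ 2 =
  (t * cos (2 * pi * phi) - sin (2 * pi * phi)) ^+ 2 + cos (2 * pi * phi) ^+ 2.
Proof. by rewrite sqr_sqrtr // addr_ge0 ?sqr_ge0. Qed.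

(** With [c], [s] the cosine and sine, the sheared unit vector has component [x = 1 - t s c] along
    the original one and [y = - t c^2] across it, so [r^2 = x^2 + y^2]. Thus [r + x] could vanish
    only if [y = 0] and [x < 0], but [y = 0] forces [x = 1]. *)
Lemma schr_den_gt0 t phi :
  0 < schr_norm t phi + 1 - t * sin (2 * pi * phi) * cos (2 * pi * phi).
Proof.
have r0 := schr_norm_gt0 t phi; have := schr_norm_sqr t phi.
have := cos2Dsin2 (2 * pi * phi).
set r := schr_norm _ _ in r0 *; set c := cos _; set s := sin _ => h hr.
rewrite ltNge; apply/negP => le0.
have [tc0|tc0] := eqVneq (t * c) 0; first by move: le0; rewrite mulrAC tc0; lra.
have c0 : c != 0 by apply: contra_neq tc0 => ->; rewrite mulr0.
have : r ^+ 2 <= (t * s * c - 1) ^+ 2.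
  by rewrite ler_sqr ?nnegrE; lra.
have -> : (t * s * c - 1) ^+ 2 = r ^+ 2 - (t * c ^+ 2) ^+ 2.
  rewrite hr.
  have -> : (t * s * c - 1) ^+ 2 = (t*c)^+2 * s ^+2 - 2 * t * s * c + 1 by ring.
  have -> : (t * c - s) ^+ 2 + c ^+ 2 = (t*c)^+2 - 2 * t * s * c + 1.
    lra.
  have -> : s ^+ 2 = 1 - c ^+ 2 by lra.
  ring.
have : 0 < (t * c ^+ 2) ^+ 2.
  by rewrite exprn_even_gt0 //= expr2 mulrA mulf_neq0.
lra.
Qed.

Lemma schr_lift_cos_sin t phi :
  cos (2 * pi * schr_lift t phi)
    = (t * cos (2 * pi * phi) - sin (2 * pi * phi)) / schr_norm t phi /\
  sin (2 * pi * schr_lift t phi) = cos (2 * pi * phi) / schr_norm t phi.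
Proof.
have -> : 2 * pi * schr_lift t phi
    = (2 * pi * phi + 2 * atan (schr_slope t phi)) + pi / 2.
  have p0 : pi != 0 :> R by rewrite gt_eqF ?pi_gt0.
  rewrite /schr_lift; move: (atan _) => w.
  by move: (pi) p0 => p p0; field.
rewrite cosDpihalf sinDpihalf sinD cosD cos_2atan sin_2atan /schr_slope.
have := schr_den_gt0 t phi; have := schr_norm_gt0 t phi.
have := schr_norm_sqr t phi; have := cos2Dsin2 (2 * pi * phi).
set r := schr_norm _ _; set c := cos _; set s := sin _ => h hr r0 d0.
set d := r + 1 - _ in d0 *.
have hx : r ^+ 2 = (1 - t * s * c) ^+ 2 + (t * c ^+ 2) ^+ 2.
  rewrite hr.
  have -> : (1 - t * s * c) ^+ 2 = (t*c)^+2 * s ^+2 - 2 * t * s * c + 1 by ring.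
  have -> : (t * c - s) ^+ 2 + c ^+ 2 = (t*c)^+2 - 2 * t * s * c + 1.
    lra.
  have -> : s ^+ 2 = 1 - c ^+ 2 by lra.
  ring.
(* With [d = r + x] and [r^2 = x^2 + y^2], the sums [1 + (y/d)^2] and [1 - (y/d)^2] are [2 r / d]
   and [2 x / d], so [2 atan (y/d)] has cosine [x / r] and sine [y / r]. *)
have e1 : 1 + (- t * c ^+ 2 / d) ^+ 2 = 2 * r / d.
  apply: (mulIf (x := d ^+ 2)); first by rewrite expf_neq0 ?gt_eqF.
  have -> : 2 * r / d * d ^+ 2 = 2 * r * d by field; rewrite gt_eqF.
  have -> : (1 + (- t * c ^+ 2 / d) ^+ 2) * d ^+ 2 = d ^+ 2 + (t * c ^+ 2) ^+ 2.
    by field; rewrite gt_eqF.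
  have -> : (t * c ^+ 2) ^+ 2 = r ^+ 2 - (1 - t * s * c) ^+ 2 by lra.
  rewrite /d; ring.
have e2 : 1 - (- t * c ^+ 2 / d) ^+ 2 = 2 * (1 - t * s * c) / d.
  have -> : 1 - (- t * c ^+ 2 / d) ^+ 2 = 2 - 2 * r / d by rewrite -e1; ring.
  rewrite /d; field; exact: lt0r_neq0.
rewrite e1 e2.
have -> : 2 * (1 - t * s * c) / d / (2 * r / d) = (1 - t * s * c) / r.
  by field; rewrite !gt_eqF.
have -> : 2 * (- t * c ^+ 2 / d) / (2 * r / d) = - t * c ^+ 2 / r.
  by field; rewrite !gt_eqF.
split.
  transitivity ((t * c * (s ^+ 2 + c ^+ 2) - s) / r).
    by field; rewrite gt_eqF.
  by rewrite [s ^+ 2 + _]addrC h mulr1.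
by field; rewrite gt_eqF.
Qed.

Lemma schr_slope_half t phi : schr_slope t (phi + 1 / 2) = schr_slope t phi.
Proof.
rewrite /schr_slope /schr_norm cos_2pi_half sin_2pi_half sqrrN.
set c := cos _; set s := sin _.
have -> : t * - c - - s = - (t * c - s) by ring.
have -> : t * - s * - c = t * s * c by ring.
by rewrite sqrrN.
Qed.

Lemma schr_lift_half t phi : schr_lift t (phi + 1 / 2) = schr_lift t phi + 1 / 2.
Proof. by rewrite /schr_lift schr_slope_half; lra. Qed.

Lemma schr_liftDz t phi k : schr_lift t (phi + k%:~R) = schr_lift t phi + k%:~R.
Proof.
by rewrite /schr_lift /schr_slope /schr_norm cos_2pi_addz sin_2pi_addz; lra.
Qed.

(** Every Schroedinger matrix sends (0, 1) to (-1, 0). This value, independent of [t], fixes the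
    branch of the lift and confines the image of [[-1/4, 1/4)] to [[0, 1/2)]. *)
Lemma schr_lift_quarter t : schr_lift t (1 / 4) = 1 / 2.
Proof.
rewrite /schr_lift /schr_slope.
have -> : 2 * pi * (1 / 4) = pi / 2 :> R by field.
by rewrite cos_pihalf expr0n /= mulr0 mul0r atan0 mul0r; lra.
Qed.

Lemma continuous_schr_lift : continuous (fun p : R * R => schr_lift p.1 p.2).
Proof.
move=> [t phi].
have c1 : (fun p : R * R => p.1) @ (t, phi) --> t by exact: cvg_fst.
have c2 : (fun p : R * R => p.2) @ (t, phi) --> phi by exact: cvg_snd.
have c3 : (fun p : R * R => cos (2 * pi * p.2)) @ (t, phi) --> cos (2 * pi * phi).
  apply: continuous_cvg; first exact: continuous_cos.
  by apply: cvgM => //; exact: cvg_cst.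
have c4 : (fun p : R * R => sin (2 * pi * p.2)) @ (t, phi) --> sin (2 * pi * phi).
  apply: continuous_cvg; first exact: continuous_sin.
  by apply: cvgM => //; exact: cvg_cst.
have cN : (fun p : R * R => schr_norm p.1 p.2) @ (t, phi) --> schr_norm t phi.
  apply: continuous_cvg.
    exact: sqrt_continuous.
  apply: cvgD; last by apply: cvgM.
  by apply: cvgM; (apply: cvgB => //; exact: cvgM).
apply: cvgD; first by apply: cvgD => //; exact: cvg_cst.
apply: cvgMl.
apply: continuous_cvg; first exact: continuous_atan.
apply: cvgM.
  apply: cvgM; [exact: cvgN | exact: cvgM].
apply: cvgV; first by rewrite gt_eqF // schr_den_gt0.
apply: cvgB; first by apply: cvgD => //; exact: cvg_cst.
by apply: cvgM => //; apply: cvgM.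
Qed.

(** Equal images put the two unit vectors on one ray, hence they agree; the arguments then differ by
    an integer, which the lift preserves. *)
Lemma schr_lift_inj t : injective (schr_lift t).
Proof.
move=> x y e.
have [cx sx] := schr_lift_cos_sin t x; have [cy sy] := schr_lift_cos_sin t y.
have rx := schr_norm_gt0 t x; have ry := schr_norm_gt0 t y.
have [k k0 [hc hs]] : exists2 k, 0 < k & cos (2 * pi * x) = k * cos (2 * pi * y)
    /\ sin (2 * pi * x) = k * sin (2 * pi * y).
  exists (schr_norm t x / schr_norm t y); first by rewrite divr_gt0.
  have hc : cos (2 * pi * x) / schr_norm t x = cos (2 * pi * y) / schr_norm t y.
    by rewrite -sx -sy e.
  have hs : (t * cos (2 * pi * x) - sin (2 * pi * x)) / schr_norm t x
       = (t * cos (2 * pi * y) - sin (2 * pi * y)) / schr_norm t y.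
    by rewrite -cx -cy e.
  have h u v : u / schr_norm t x = v / schr_norm t y ->
      u = schr_norm t x / schr_norm t y * v.
    move=> /(congr1 ( *%R^~ (schr_norm t x))); rewrite divfK ?gt_eqF // => ->.
    by field; rewrite gt_eqF.
  move/h: hc => hc; move/h: hs => hs; split=> //; move: hs; rewrite hc.
  set k := _ / _; lra.
have k1 : k = 1.
  have := cos2Dsin2 (2 * pi * x); rewrite hc hs !exprMn -mulrDr cos2Dsin2 mulr1.
  by move=> k2; nra.
rewrite k1 !mul1r in hc hs.
have [m hm] := cos_2pi_inj hc hs.
move: e; rewrite hm schr_liftDz => /(canRL (addKr _)); rewrite addNr => ->.
by rewrite addr0.
Qed.

(** A continuous injection of a segment is monotone, and its direction is visible at the endpoints
    [x] and [x + m], where the lift gains [m]. *)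
Lemma schr_lift_lt t : {homo schr_lift t : x y / x < y}.
Proof.
move=> x y xy; have [m hm] : exists m : nat, y - x <= m%:R.
  by exists (Num.truncn (y - x)).+1; rewrite ltW // truncnS_gt.
have h : {in `[x, x + m%:R] &, {mono schr_lift t : x y / x <= y}}.
  apply: segment_continuous_inj_le; last by move=> ? ? _ _; exact: schr_lift_inj.
    by rewrite (schr_liftDz t x m) lerDl.
  apply: continuous_subspaceT => z.
  apply: (@continuous_comp _ _ _ (fun z => (t, z)) (fun p => schr_lift p.1 p.2)).
    exact: cvg_pair (cvg_cst _) cvg_id.
  exact: continuous_schr_lift.
by rewrite (leW_mono_in h) // in_itv /=; lra.
Qed.

Lemma schr_lift_le t : {homo schr_lift t : x y / x <= y}.
Proof. exact/ltW_homo/schr_lift_lt. Qed.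

(** Only [p] must lie in [K]. For periodic functions, [p] can then be translated into [[0, 1]] while
    its neighbour [q] sticks out. *)
Lemma compact_unif (U : pseudoMetricType R) (K : set U) (f : U -> R) (eps : R) :
  compact K -> continuous f -> 0 < eps -> exists2 d, 0 < d &
  forall p q, K p -> ball p d q -> `|f p - f q| < eps.
Proof.
move=> /compact_near_coveringP cK cf e0.
pose P (d : R) (p : U) := forall q, ball p d q -> `|f p - f q| < eps.
have /cK : forall p : U, K p -> \forall p' \near p & d \near (0 : R)^'+, P d p'.
  move=> p _; have /cvgrPdist_lt /(_ _ (divr_gt0 e0 (ltr0n _ 2))) := cf p.
  move=> /nbhs_ballP [r /= r0 hr].
  exists (ball p (r / 2), [set d : R | d < r / 2]); first split => /=.
  - by apply: nbhsx_ballx; rewrite divr_gt0.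
  - by apply: nbhs_right_lt; rewrite divr_gt0.
  move=> [p' d] /= [bp dr] q bq.
  have h1 : ball p r p' by apply: le_ball bp; lra.
  have h2 : ball p r q by apply: ball_split bp (le_ball (ltW dr) bq).
  have {h1}/= h1 := hr _ h1; have {h2}/= h2 := hr _ h2.
  have -> : f p' - f q = (f p - f q) - (f p - f p') by ring.
  by rewrite (splitr eps) (le_lt_trans (ler_normB _ _)) // ltrD.
move=> hK; have [d [/= d0 hd]] := filter_ex (filterI (nbhs_right_gt (0 : R)) hK).
by exists d => // p q /hd; apply.
Qed.

Lemma schr_lift_unif (B eps : R) : 0 < eps -> exists2 d, 0 < d &
  forall t t' x y, `|t| <= B -> `|t'| <= B -> `|t - t'| < d -> `|x - y| < d ->
  `|schr_lift t x - schr_lift t' y| < eps.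
Proof.
move=> e0; have cK : compact (`[- B, B]%classic `*` `[0, 1]%classic : set (R * R)).
  by apply: compact_setX; exact: segment_compact.
have [d d0 hd] := compact_unif cK (@continuous_schr_lift) e0.
exists d => // t t' x y tB t'B tt' xy.
have -> : schr_lift t x - schr_lift t' y =
    schr_lift t (x - (Num.floor x)%:~R) - schr_lift t' (y - (Num.floor x)%:~R).
  by rewrite -!mulrNz !schr_liftDz; ring.
apply: (hd (t, x - (Num.floor x)%:~R) (t', y - (Num.floor x)%:~R)).
  split => /=; first by rewrite in_itv /= -ler_norml.
  have := floor_le_tmp x; have := lt_succ_floor x; rewrite in_itv /= intrD1.
  by lra.
split => //=; rewrite /ball /= opprD addrACA subrr addr0 //.
Qed.

End Lift.

(** * Rotation numbers over an irrational rotation *)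

Section Dirichlet.
Context {R : realType}.
Variables (beta : R).

Lemma dirichlet (Q : nat) : (0 < Q)%N ->
  exists d : nat, exists p : int,
    (0 < d <= Q)%N /\ `|d%:R * beta - p%:~R| < Q%:R^-1.
Proof.
move=> Q0; have Q0R : 0 < Q%:R :> R by rewrite ltr0n.
pose fr (i : nat) : R := i%:R * beta - (Num.floor (i%:R * beta))%:~R.
have fr0 i : 0 <= fr i by rewrite subr_ge0 floor_le_tmp.
have fr1 i : fr i < 1 by rewrite ltrBlDl -intrD1 lt_succ_floor.
have bnd (i : 'I_Q.+1) : (Num.truncn (Q%:R * fr i) < Q)%N.
  rewrite truncn_lt_nat ?mulr_ge0 ?ler0n //.
  by rewrite -[ltRHS]mulr1 ltr_pM2l.
pose F (i : 'I_Q.+1) : 'I_Q := Ordinal (bnd i).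
have [i [j [ij Fij]]] : exists i j : 'I_Q.+1, (i < j)%N /\ F i = F j.
  apply/not_existsP => H.
  have : injective F.
    move=> i j Fij; apply/val_inj => /=.
    by case: (ltngtP i j) => // ij; exfalso; [apply: (H i); exists j | apply: (H j); exists i].
  by move/leq_card; rewrite !card_ord ltnn.
have close : `|fr j - fr i| < Q%:R^-1.
  have := congr1 val Fij => /= e.
  have ti := truncn_itv (mulr_ge0 (ltW Q0R) (fr0 i)).
  have tj := truncn_itv (mulr_ge0 (ltW Q0R) (fr0 j)).
  rewrite e in ti; move: (Num.truncn _) ti tj => m /andP[ti1 ti2] /andP[tj1 tj2].
  rewrite -[Q%:R^-1]mul1r ltr_pdivlMr // -[X in _ * X]gtr0_norm // -normrM.
  by rewrite ltr_norml -natr1 in ti2 tj2 *; nra.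
exists (j - i)%N, (Num.floor (j%:R * beta) - Num.floor (i%:R * beta)); split.
  by rewrite subn_gt0 ij /= (leq_trans (leq_subr _ _)) // -ltnS ltn_ord.
move: close; rewrite /fr (natrB _ (ltnW ij)) mulrBl intrB.
by congr (`|_| < _); lra.
Qed.

Hypothesis irr : forall (d : nat) (p : int), (0 < d)%N -> d%:R * beta <> p%:~R.

(** The multiples of [eta = d beta - p], nonzero and shorter than [delta], walk around the circle in
    at most [M] steps. The waiting time [J] is uniform in the target, which is what the oscillation
    bound requires. *)
Lemma rotation_dense (delta : R) : 0 < delta ->
  exists J : nat, forall y : R, exists j : nat, exists k : int,
    (j <= J)%N /\ `|j%:R * beta - y - k%:~R| < delta.
Proof.
move=> d0; set Q := (Num.truncn delta^-1).+1.
have Qd : Q%:R^-1 < delta.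
  by rewrite invf_plt ?posrE // ?truncnS_gt // ltr0n.
have [d [p [/andP[d1 dQ] hp]]] := @dirichlet Q isT.
set eta := d%:R * beta - p%:~R in hp.
have eta0 : 0 < `|eta|.
  by rewrite normr_gt0 subr_eq0; apply/eqP; exact: irr.
set M := (Num.truncn `|eta|^-1).+1.
suff H y : exists m : nat, exists k : int, (m <= M)%N /\ `|m%:R * eta - y - k%:~R| < `|eta|.
  exists (M * d)%N => y; have [m [k [mM hk]]] := H y.
  exists (m * d)%N, (k + m%:Z * p); split; first by rewrite leq_mul2r mM orbT.
  have -> : (m * d)%:R * beta - y - (k + m%:Z * p)%:~R = m%:R * eta - y - k%:~R.
    by rewrite /eta natrM intrD intrM /=; ring.
  by apply: lt_trans hk _; apply: lt_trans hp _.
(* For negative [eta] the walk runs backwards, so the target is reflected and [|eta|] is used as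
   step. *)
pose s := if 0 < eta then y else - y.
pose f := s - (Num.floor s)%:~R.
have f0 : 0 <= f by rewrite subr_ge0 floor_le_tmp.
have f1 : f < 1 by rewrite ltrBlDl -intrD1 lt_succ_floor.
have q0 : 0 <= f / `|eta| by rewrite divr_ge0 // ltW.
have /andP[m1 m2] := truncn_itv q0; set m := Num.truncn _ in m1 m2.
have mM : (m <= M)%N.
  rewrite -(ler_nat R) (le_trans m1) // (le_trans _ (ltW (truncnS_gt _))) //.
  by rewrite ler_piMl // ?invr_ge0 ?normr_ge0 // ltW.
have hm : `|m%:R * `|eta| - f| < `|eta|.
  rewrite ler_pdivlMr // in m1; rewrite ltr_pdivrMr // -natr1 in m2.
  by rewrite ltr_norml; nra.
move: hm; rewrite /f /s; case: ifPn => e0.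
  rewrite (gtr0_norm e0) => hm; exists m, (- Num.floor y); split=> //.
  by move: hm; congr (`|_| < _); rewrite mulrNz; lra.
have en : `|eta| = - eta by rewrite ler0_norm // leNgt.
move=> hm; exists m, (Num.floor (- y)); split=> //.
by move: hm; rewrite -normrN en; congr (`|_| < _); lra.
Qed.

End Dirichlet.

(** * Iterates of the lift along a sequence of potential values *)

Section Rotate.
Context {R : realType}.
Implicit Types (t : nat -> R) (phi eps B : R) (m n k : nat).

Fixpoint rotate t n phi : R :=
  if n is m.+1 then schr_lift (t m) (rotate t m phi) else phi.

Lemma rotateD t m n phi :
  rotate t (m + n) phi = rotate (fun j => t (m + j)%N) n (rotate t m phi).
Proof. by elim: n => [|n IH]; rewrite ?addn0 // addnS /= IH. Qed.

Lemma eq_rotate t t' n phi : (forall j, (j < n)%N -> t j = t' j) ->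
  rotate t n phi = rotate t' n phi.
Proof.
elim: n => //= n IH h; rewrite h // IH // => j jn; exact/h/ltnW.
Qed.

Lemma rotate_le t n : {homo rotate t n : x y / x <= y}.
Proof. by elim: n => //= n IH x y xy; apply/schr_lift_le/IH. Qed.

Lemma rotateDz t n phi (k : int) : rotate t n (phi + k%:~R) = rotate t n phi + k%:~R.
Proof. by elim: n => //= n ->; rewrite schr_liftDz. Qed.

(** A monotone map commuting with integer translations is compared with its values at the two
    integers around [phi]. The bound does not depend on [n], so iterates are additive up to 1. *)
Lemma rotate_defect t n phi : `|rotate t n phi - phi - rotate t n 0| <= 1.
Proof.
have h1 := floor_le_tmp phi; have h2 : phi <= (Num.floor phi)%:~R + 1.
  by rewrite -intrD1 ltW // lt_succ_floor.
have e (k : int) : rotate t n k%:~R = rotate t n 0 + k%:~R.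
  by rewrite -rotateDz add0r.
have := rotate_le t n h1; have := rotate_le t n h2.
by rewrite -intrD1 !e intrD1 ler_norml; lra.
Qed.

Lemma schr_lift_step (s phi : R) : `|schr_lift s phi - phi| <= 1.
Proof.
have p0 := @pi_gt0 R.
have h1 := atan_gtNpi2 (schr_slope s phi); have h2 := atan_ltpi2 (schr_slope s phi).
rewrite /schr_lift addrAC [phi + _]addrC addrK.
have : `|atan (schr_slope s phi) / pi| <= 1 / 2.
  rewrite normf_div [`|pi|]gtr0_norm // ler_pdivrMr // ler_norml.
  by move: (atan _) (pi) h1 h2 => a p; lra.
by set a := _ / pi; rewrite !ler_norml; lra.
Qed.

Lemma rotate_step t n phi : `|rotate t n phi - phi| <= n%:R.
Proof.
elim: n => [|n IH] /=; first by rewrite subrr normr0.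
rewrite -natr1; have := schr_lift_step (t n) (rotate t n phi).
by move: IH; rewrite !ler_norml; lra.
Qed.

Lemma rotate_quasi_add t m n :
  `|rotate t (m + n) 0 - rotate t m 0 - rotate (fun j => t (m + j)%N) n 0| <= 1.
Proof. by rewrite rotateD; exact: rotate_defect. Qed.

Lemma rotate_blocks t n k :
  `|rotate t (k * n) 0 - \sum_(i < k) rotate (fun j => t (i * n + j)%N) n 0| <= k%:R.
Proof.
elim: k => [|k IH]; first by rewrite mul0n big_ord0 subr0 normr0.
rewrite big_ord_recr /= mulSn addnC -natr1.
have := rotate_quasi_add t (k * n) n; move: IH; rewrite !ler_norml; lra.
Qed.

Lemma rotate_unif n B eps : 0 < eps -> exists2 d, 0 < d &
  forall t t' phi, (forall j, `|t j| <= B) -> (forall j, `|t' j| <= B) ->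
    (forall j, `|t j - t' j| < d) -> `|rotate t n phi - rotate t' n phi| < eps.
Proof.
elim: n eps => [|n IH] eps e0.
  by exists 1 => // t t' phi _ _ _; rewrite subrr normr0.
have [d d0 hd] := schr_lift_unif B e0; have [d' d'0 hd'] := IH _ d0.
exists (Num.min d d'); first by rewrite lt_min d0.
move=> t t' phi tB t'B tt' /=; apply: hd => //.
  by have := tt' n; rewrite lt_min => /andP[].
by apply: hd' => // j; have := tt' j; rewrite lt_min => /andP[].
Qed.

(* Comparing blocks of a fixed length [n] costs 3 per block: one unit for each
   of the two defects, one for the uniform continuity. *)
Lemma rotate_close B eps : 0 < eps -> exists2 d, 0 < d & exists C : R,
  forall t t', (forall j, `|t j| <= B) -> (forall j, `|t' j| <= B) ->
    (forall j, `|t j - t' j| < d) ->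
    forall N, `|rotate t N 0 - rotate t' N 0| <= eps * N%:R + C.
Proof.
move=> e0; set n := (Num.truncn (3 / eps)).+1.
have n3 : 3 <= eps * n%:R.
  by rewrite mulrC -ler_pdivrMr // ltW // truncnS_gt.
have [d d0 hd] := @rotate_unif n B 1 ltr01.
exists d => //; exists (2 + 2 * n%:R) => t t' tB t'B tt' N.
rewrite (divn_eq N n); set k := (N %/ n)%N; set r := (N %% n)%N.
have rn : r%:R <= n%:R :> R by rewrite ler_nat ltnW // ltn_pmod.
have sb : `|\sum_(i < k) rotate (fun j => t (i * n + j)%N) n 0
    - \sum_(i < k) rotate (fun j => t' (i * n + j)%N) n 0| <= k%:R.
  rewrite -sumrB (le_trans (ler_norm_sum _ _ _)) //.
  rewrite -[X in _ <= X%:R]card_ord -sum1_card natr_sum ler_sum // => i _.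
  by rewrite ltW // hd.
have h1 := rotate_blocks t n k; have h2 := rotate_blocks t' n k.
have h3 := rotate_quasi_add t (k * n) r; have h4 := rotate_quasi_add t' (k * n) r.
have := rotate_step (fun j => t (k * n + j)%N) r 0.
have := rotate_step (fun j => t' (k * n + j)%N) r 0.
rewrite !subr0 => h5 h6.
have k3 : 3 * k%:R <= eps * (k * n)%:R.
  by rewrite natrM mulrCA [leLHS]mulrC ler_wpM2l.
have er : 0 <= eps * r%:R by rewrite mulr_ge0 // ltW.
rewrite natrD mulrDr.
move: sb h1 h2 h3 h4 h5 h6; rewrite !ler_norml.
move: (\sum_(i < k) _) (\sum_(i < k) _) => s1 s2; lra.
Qed.

End Rotate.

(** * Existence and continuity of the rotation number *)

Section RotationNumber.
Context {R : realType}.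
Implicit Types (tau : R -> R) (theta phi eps B : R) (m n k : nat).

Definition orbit_val (beta : R) tau theta (j : nat) : R := tau (theta + j%:R * beta).

Variable beta : R.
Hypothesis irr : forall (d : nat) (p : int), (0 < d)%N -> d%:R * beta <> p%:~R.

Local Notation G tau theta n := (rotate (orbit_val beta tau theta) n 0).

Lemma orbit_valD tau theta m :
  (fun j => orbit_val beta tau theta (m + j)%N) =1
  orbit_val beta tau (theta + m%:R * beta).
Proof. by move=> j; rewrite /orbit_val natrD; congr tau; ring. Qed.

Lemma periodic_addz tau : (forall x, tau (x + 1) = tau x) ->
  forall x (k : int), tau (x + k%:~R) = tau x.
Proof.
move=> per; have H n x : tau (x + n%:R) = tau x.
  by elim: n => [|n IH]; rewrite ?addr0 // -natr1 addrA per.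
move=> x [n|n]; first exact: H.
by rewrite -[in RHS](subrK n.+1%:R x) H NegzE mulrNz.
Qed.

Lemma periodic_bounded tau : (forall x, tau (x + 1) = tau x) -> continuous tau ->
  exists B, forall x, `|tau x| <= B.
Proof.
move=> per ct; have := @segment_compact R 0 1.
move=> /(continuous_compact (continuous_subspaceT ct)) /compact_bounded [M [_ hM]].
exists (M + 1) => x; have /= := hM (M + 1) _ (tau x); apply; first by rewrite ltrDl.
exists (x - (Num.floor x)%:~R); last by rewrite -mulrNz periodic_addz.
rewrite /= in_itv /= subr_ge0 floor_le_tmp /= lerBlDl -intrD1 ltW //.
exact: lt_succ_floor.
Qed.

Lemma periodic_unif tau eps : (forall x, tau (x + 1) = tau x) -> continuous tau ->
  0 < eps -> exists2 d, 0 < d &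
  forall x y (k : int), `|x - y - k%:~R| < d -> `|tau x - tau y| < eps.
Proof.
move=> per ct e0; have [d d0 hd] := compact_unif (@segment_compact R 0 1) ct e0.
exists d => // x y k xy.
have -> : tau x - tau y = tau (x - (Num.floor x)%:~R)
     - tau (y + k%:~R - (Num.floor x)%:~R).
  by rewrite -!mulrNz !periodic_addz.
apply: hd; last by rewrite /ball /=; move: xy; congr (`|_| < _); ring.
have := floor_le_tmp x; have := lt_succ_floor x; rewrite /= in_itv /= intrD1.
by lra.
Qed.

(** A run of [j + N] steps is cut once after [j] and once after [N] steps: two defects and two runs
    of length [j] make up the difference. *)
Lemma rotate_shift tau theta j N :
  `|G tau (theta + j%:R * beta) N - G tau theta N| <= 2 * j%:R + 2.
Proof.
have h1 := rotate_quasi_add (orbit_val beta tau theta) j N.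
have h2 := rotate_quasi_add (orbit_val beta tau theta) N j.
rewrite (eq_rotate _ (fun i _ => orbit_valD tau theta j i)) in h1.
rewrite (eq_rotate _ (fun i _ => orbit_valD tau theta N i)) addnC in h2.
have := rotate_step (orbit_val beta tau theta) j 0.
have := rotate_step (orbit_val beta tau (theta + N%:R * beta)) j 0.
by move: h1 h2; rewrite !subr0 !ler_norml; lra.
Qed.

Lemma rotate_osc tau eps : (forall x, tau (x + 1) = tau x) -> continuous tau ->
  0 < eps -> exists2 C : R, 0 <= C &
  forall theta theta' N, `|G tau theta N - G tau theta' N| <= eps * N%:R + C.
Proof.
move=> per ct e0; have [B hB] := periodic_bounded per ct.
have [d d0 [C hC]] := rotate_close B e0.
have [d' d'0 hd'] := periodic_unif per ct d0.
have [J hJ] := rotation_dense irr d'0.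
exists (`|C| + 2 * J%:R + 2) => [|theta theta' N].
  by have := ler0n R J; have := normr_ge0 C; lra.
have [j [k [jJ hj]]] := hJ (theta - theta').
have close i : `|orbit_val beta tau (theta' + j%:R * beta) i
                 - orbit_val beta tau theta i| < d.
  by apply: (hd' _ _ k); move: hj; congr (`|_| < _); ring.
have := hC _ _ (fun _ => hB _) (fun _ => hB _) close N.
have := rotate_shift tau theta' j N.
have : j%:R <= J%:R :> R by rewrite ler_nat.
have := ler_norm C; move: (`|C|) => c; rewrite !ler_norml; lra.
Qed.

Lemma rotate_mul_close tau eps : (forall x, tau (x + 1) = tau x) -> continuous tau ->
  0 < eps -> exists2 C : R, 0 <= C &
  forall theta m N, `|G tau theta (m * N) - m%:R * G tau theta N|
    <= m%:R * (eps * N%:R + C).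
Proof.
move=> per ct e0; have [C C0 hC] := rotate_osc per ct e0.
exists (C + 1) => [|theta m N]; first by rewrite addr_ge0.
have h1 := rotate_blocks (orbit_val beta tau theta) N m.
set s := \sum_(i < m) _ in h1.
have h2 : `|s - m%:R * G tau theta N| <= m%:R * (eps * N%:R + C).
  rewrite -[m in m%:R * G _ _ _]card_ord -sum1_card natr_sum mulr_suml -sumrB.
  rewrite (le_trans (ler_norm_sum _ _ _)) //.
  rewrite -[m in X in _ <= X]card_ord -sum1_card natr_sum mulr_suml ler_sum // => i _.
  by rewrite !mul1r (eq_rotate _ (fun j _ => orbit_valD tau theta (i * N) j)).
have -> : m%:R * (eps * N%:R + (C + 1)) = m%:R * (eps * N%:R + C) + m%:R by ring.
by move: h1 h2; rewrite !ler_norml; move: (_ * (_ + _)) => u; lra.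
Qed.

(** The ratios at [n] and at a fixed large [K] are both compared with the ratio at [n * K], which
    gives a Cauchy sequence. *)
Lemma ratio_cvg (u : nat -> R) :
  (forall eps, 0 < eps -> exists2 C, 0 <= C &
    forall m N, `|u (m * N)%N - m%:R * u N| <= m%:R * (eps * N%:R + C)) ->
  cvgn (fun n => u n / n%:R).
Proof.
move=> hu; apply: cauchy_cvg; apply: cauchy_exP => e e0.
have [C C0 hC] := hu (e / 8) (divr_gt0 e0 (ltr0n _ 8)).
set K := (Num.truncn (C / (e / 8))).+1.
have hK n : (K <= n)%N -> C <= e / 8 * n%:R.
  move=> Kn; rewrite mulrC -ler_pdivrMr ?divr_gt0 //.
  by rewrite (le_trans (ltW (truncnS_gt _))) // ler_nat.
have hr m n : (0 < m)%N -> (K <= n)%N ->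
    `|u (m * n)%N / (m * n)%:R - u n / n%:R| <= e / 4.
  move=> m0 Kn; have n0 : (0 < n)%N by apply: leq_trans Kn.
  have n0R : 0 < n%:R :> R by rewrite ltr0n.
  have m0R : 0 < m%:R :> R by rewrite ltr0n.
  have -> : u (m * n)%N / (m * n)%:R - u n / n%:R
     = (u (m * n)%N - m%:R * u n) / (m%:R * n%:R).
    by rewrite natrM; field; rewrite !gt_eqF.
  rewrite normf_div [`|_ * n%:R|]gtr0_norm ?mulr_gt0 // ler_pdivrMr ?mulr_gt0 //.
  apply: le_trans (hC _ _) _; rewrite mulrCA ler_pM2l //.
  by have := hK _ Kn; lra.
exists (u K / K%:R); exists K => // n /= Kn.
have n0 : (0 < n)%N by apply: leq_trans Kn.
have h1 := hr n K n0 (leqnn _); have h2 := hr K n isT Kn.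
rewrite mulnC in h2; rewrite /ball /=; move: h1 h2; rewrite ltr_norml !ler_norml; lra.
Qed.

Lemma rotation_cvg0 tau : (forall x, tau (x + 1) = tau x) -> continuous tau ->
  cvgn (fun n => G tau 0 n / n%:R).
Proof.
move=> per ct; apply: ratio_cvg => eps e0.
by have [C C0 hC] := rotate_mul_close per ct e0; exists C.
Qed.

Definition rho tau : R := limn (fun n => G tau 0 n / n%:R).

Lemma cvg_le_linear (u : nat -> R) (l : R) (v : nat -> R) :
  (fun n => u n / n%:R) @ \oo --> l ->
  (forall eps, 0 < eps -> exists C, forall n, `|v n - u n| <= eps * n%:R + C) ->
  (fun n => v n / n%:R) @ \oo --> l.
Proof.
move=> hu hv; apply/cvgrPdist_lt => e e0.
have e30 : 0 < e / 3 by rewrite divr_gt0.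
have [C hC] := hv _ e30; near=> n.
have n0 : 0 < n%:R :> R by rewrite ltr0n; near: n; exists 1%N.
have h1 : `|l - u n / n%:R| < e / 3 by near: n; move/cvgrPdist_lt: hu; apply.
have h2 : C <= e / 3 * n%:R.
  rewrite mulrC -ler_pdivrMr //; near: n; exists (Num.truncn (C / (e / 3))).+1 => // n /= hn.
  by rewrite (le_trans (ltW (truncnS_gt _))) // ler_nat.
have h3 : `|v n / n%:R - u n / n%:R| <= e / 3 + e / 3.
  rewrite -mulrBl normf_div [`|n%:R|]gtr0_norm // ler_pdivrMr // mulrDl.
  by apply: le_trans (hC n) _; rewrite lerD2l.
by move: h1 h3; rewrite !ltr_norml !ler_norml; lra.
Unshelve. all: by end_near. Qed.

Lemma rotation_cvg tau : (forall x, tau (x + 1) = tau x) -> continuous tau ->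
  forall theta phi,
  (fun n => (rotate (orbit_val beta tau theta) n phi - phi) / n%:R) @ \oo --> rho tau.
Proof.
move=> per ct theta phi; apply: (cvg_le_linear (rotation_cvg0 per ct)) => eps e0.
have [C C0 hC] := rotate_osc per ct e0; exists (C + 1) => n.
have := hC theta 0 n; have := rotate_defect (orbit_val beta tau theta) n phi.
by rewrite !ler_norml; lra.
Qed.

Lemma limit_linear_le (u v : nat -> R) (l l' eps C : R) :
  (fun n => u n / n%:R) @ \oo --> l -> (fun n => v n / n%:R) @ \oo --> l' ->
  (forall n, u n <= v n + eps * n%:R + C) -> l <= l' + eps.
Proof.
move=> hu hv h.
have hC : (fun n => C / n%:R) @ \oo --> (0 : R).
  apply: (@cvg_le_linear (fun=> 0)) => [|e e0].
    by under eq_fun do rewrite mul0r; exact: cvg_cst.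
  by exists (`|C|) => n; rewrite subr0 lerDr mulr_ge0 // ltW.
have hr : (fun n => v n / n%:R + eps + C / n%:R) @ \oo --> l' + eps + 0.
  by apply: cvgD => //; apply: cvgD => //; exact: cvg_cst.
rewrite -[l' + eps]addr0; apply: ler_cvg_to hu hr _.
exists 1%N => // n /= n1; have n0 : 0 < n%:R :> R by rewrite ltr0n.
rewrite ler_pdivrMr // !mulrDl !divfK ?gt_eqF //.
Qed.

Lemma rho_close B eps : 0 < eps -> exists2 d, 0 < d & forall tau tau',
  (forall x, tau (x + 1) = tau x) -> continuous tau ->
  (forall x, tau' (x + 1) = tau' x) -> continuous tau' ->
  (forall x, `|tau x| <= B) -> (forall x, `|tau' x| <= B) ->
  (forall x, `|tau x - tau' x| < d) -> `|rho tau - rho tau'| <= eps.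
Proof.
move=> e0; have [d d0 [C hC]] := rotate_close B e0.
exists d => // tau tau' per ct per' ct' tB tB' tt'.
have h := hC _ _ (fun j => tB (0 + j%:R * beta)) (fun j => tB' (0 + j%:R * beta)) (fun j => tt' _).
have h1 : rho tau <= rho tau' + eps.
  apply: (limit_linear_le (rotation_cvg0 per ct) (rotation_cvg0 per' ct') (C := C)) => n.
  by have := h n; rewrite ler_norml /orbit_val; lra.
have h2 : rho tau' <= rho tau + eps.
  apply: (limit_linear_le (rotation_cvg0 per' ct') (rotation_cvg0 per ct) (C := C)) => n.
  by have := h n; rewrite ler_norml /orbit_val; lra.
by rewrite ler_norml; lra.
Qed.

End RotationNumber.

(** * Positive index of a form and Sturm oscillation *)

Section PositiveIndex.
Local Open Scope complex_scope.
Context {R : realType}.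
Local Notation C := R[i].

Definition linear_map (V W : lmodType C) (f : V -> W) :=
  forall (a : C) u v, f (a *: u + v) = a *: f u + f v.

(** The subspace is the row space of [U]. [Q] is an arbitrary function, so that Jacobi, cyclic and
    Hermitian forms are compared without a common matrix representation. *)
Definition has_pos_space n (Q : 'rV[C]_n -> R) (k : nat) : Prop :=
  exists2 U : 'M[C]_n, \rank U = k &
    forall x : 'rV_n, (x <= U)%MS -> x != 0 -> 0 < Q x.

Definition pos_index n (Q : 'rV[C]_n -> R) : nat :=
  \max_(k < n.+1 | `[< has_pos_space Q k >]) k.

Lemma pos_index_ge n (Q : 'rV[C]_n -> R) k : has_pos_space Q k ->
  (k <= pos_index Q)%N.
Proof.
move=> h; have kn : (k < n.+1)%N by case: h => U <- _; rewrite ltnS rank_leq_row.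
apply: (@leq_bigmax_cond _ (fun k : 'I_n.+1 => `[< has_pos_space Q k >]) _ (Ordinal kn)).
exact/asboolP.
Qed.

Lemma pos_index_space n (Q : 'rV[C]_n -> R) : has_pos_space Q (pos_index Q).
Proof.
have h0 : has_pos_space Q 0.
  by exists 0 => [|x]; rewrite ?mxrank0 // submx0 => ->.
have [|k /asboolP hk e] :=
    @eq_bigmax_cond _ (fun k : 'I_n.+1 => `[< has_pos_space Q k >]) (@nat_of_ord _).
  by apply/card_gt0P; exists ord0; apply/asboolP.
by suff -> : pos_index Q = k by []; rewrite -e; apply: eq_bigl.
Qed.

Lemma pos_index_le_dim n (Q : 'rV[C]_n -> R) : (pos_index Q <= n)%N.
Proof. by have [U <- _] := pos_index_space Q; rewrite rank_leq_row. Qed.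

Lemma linear_map_mx m n (f : 'rV[C]_m -> 'rV[C]_n) : linear_map f ->
  exists M, forall x, f x = x *m M.
Proof.
move=> lf; pose h := HB.pack_for {linear 'rV[C]_m -> 'rV[C]_n} f
  (GRing.isLinear.Build C 'rV[C]_m 'rV[C]_n _ f lf).
by exists (lin1_mx h) => x; rewrite mul_rV_lin1.
Qed.

(* A positive subspace of [Q] is cut down by the constraints and then carried
   to a positive subspace of [Q'] by the map [f]. *)
Lemma pos_index_le m n (I : finType) (A : {set I})
    (l : I -> 'rV[C]_m -> C) (f : 'rV[C]_m -> 'rV[C]_n)
    (Q : 'rV[C]_m -> R) (Q' : 'rV[C]_n -> R) :
  (forall i, linear_map (l i : 'rV[C]_m -> C^o)) -> linear_map f -> Q' 0 <= 0 ->
  (forall x, (forall i, i \in A -> l i x = 0) -> 0 < Q x -> 0 < Q' (f x)) ->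
  (pos_index Q <= pos_index Q' + #|A|)%N.
Proof.
move=> ll /linear_map_mx[M hM] Q'0 hQ; have [U rU hU] := pos_index_space Q.
have lK : linear_map (fun x : 'rV[C]_m => \row_(j < #|A|) l (enum_val j) x).
  by move=> a u v; apply/rowP => j; rewrite !mxE ll.
have [K hK] := linear_map_mx lK.
have inK (x : 'rV_m) : (x <= kermx K)%MS -> forall i, i \in A -> l i x = 0.
  move=> /sub_kermxP; rewrite -hK => /rowP h i iA.
  by have := h (enum_rank_in iA i); rewrite !mxE enum_rankK_in.
set W := (U :&: kermx K)%MS.
have rW : (pos_index Q <= \rank W + #|A|)%N.
  have := mxrank_sum_cap U (kermx K).
  have := rank_leq_col (U + kermx K)%MS; have := mxrank_ker K.
  have := rank_leq_col K; rewrite -/W rU; have := rank_leq_row K; lia.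
apply: leq_trans rW _; rewrite leq_add2r; apply: pos_index_ge.
have Qpos (x : 'rV_m) : (x <= W)%MS -> x != 0 -> 0 < Q' (x *m M).
  rewrite sub_capmx => /andP[xU xK] x0; rewrite -hM; apply: hQ; first exact: inK.
  exact: hU.
have ker0 : (W :&: kermx M)%MS = 0.
  apply/eqP; rewrite -submx0; apply/row_subP => i.
  have := row_sub i (W :&: kermx M)%MS; rewrite sub_capmx => /andP[rW /sub_kermxP rM].
  rewrite submx0; apply/negP => /negP r0.
  by have := Qpos _ rW r0; rewrite rM ltNge Q'0.
exists <<W *m M>>%MS; first by rewrite mxrank_gen -(mxrank_mul_ker W M) ker0 mxrank0 addn0.
move=> y; rewrite genmxE => /submxP[D ->] y0; rewrite mulmxA; apply: Qpos.
  exact: submxMl.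
by apply: contra_neq y0 => e; rewrite mulmxA e mul0mx.
Qed.

Lemma pos_index_le0 m n (f : 'rV[C]_m -> 'rV[C]_n)
    (Q : 'rV[C]_m -> R) (Q' : 'rV[C]_n -> R) :
  linear_map f -> Q' 0 <= 0 -> (forall x, 0 < Q x -> 0 < Q' (f x)) ->
  (pos_index Q <= pos_index Q')%N.
Proof.
move=> lf Q0 h; rewrite -[leqRHS]addn0 -(@cards0 'I_0).
by apply: (@pos_index_le _ _ _ _ (fun _ _ => 0) f) => // [_ a u v|x _]; [rewrite scaler0 addr0 | exact: h].
Qed.

Lemma pos_index_le_id n (I : finType) (A : {set I})
    (l : I -> 'rV[C]_n -> C) (Q Q' : 'rV[C]_n -> R) :
  (forall i, linear_map (l i : 'rV[C]_n -> C^o)) -> Q' 0 <= 0 ->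
  (forall x, (forall i, i \in A -> l i x = 0) -> 0 < Q x -> 0 < Q' x) ->
  (pos_index Q <= pos_index Q' + #|A|)%N.
Proof. by move=> ll Q0 h; apply: (@pos_index_le _ _ _ _ l id). Qed.

Lemma pos_index_mono n (Q Q' : 'rV[C]_n -> R) : Q' 0 <= 0 ->
  (forall x, 0 < Q x -> 0 < Q' x) -> (pos_index Q <= pos_index Q')%N.
Proof. by move=> Q0 h; apply: (@pos_index_le0 _ _ id). Qed.

Lemma pos_index_full n (Q : 'rV[C]_n -> R) : (forall x, x != 0 -> 0 < Q x) ->
  pos_index Q = n.
Proof.
move=> h; apply/eqP; rewrite eqn_leq pos_index_le_dim pos_index_ge //.
by exists 1%:M => [|x _]; [exact: mxrank1 | exact: h].
Qed.

Lemma pos_index_le_constr n (I : finType) (A : {set I})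
    (l : I -> 'rV[C]_n -> C) (Q : 'rV[C]_n -> R) :
  (forall i, linear_map (l i : 'rV[C]_n -> C^o)) ->
  (forall x, (forall i, i \in A -> l i x = 0) -> Q x <= 0) ->
  (pos_index Q <= #|A|)%N.
Proof.
(* The comparison form lives on the zero space, where the index is 0: the constraints alone pay for
   the whole index. *)
move=> ll h; have := pos_index_le (Q := Q) (Q' := fun _ : 'rV[C]_0 => 0) ll (f := fun=> 0).
have := pos_index_le_dim (fun _ : 'rV[C]_0 => 0 : R); rewrite leqn0 => /eqP -> /=.
move=> H; rewrite -[leqRHS]add0n; apply: H => //; first by move=> a u v; rewrite scaler0 addr0.
by move=> x hx; rewrite ltNge h.
Qed.

Lemma pos_index_ge_constr n (I : finType) (A : {set I})
    (l : I -> 'rV[C]_n -> C) (Q : 'rV[C]_n -> R) :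
  (forall i, linear_map (l i : 'rV[C]_n -> C^o)) -> Q 0 <= 0 ->
  (forall x, (forall i, i \in A -> l i x = 0) -> x != 0 -> 0 < Q x) ->
  (n <= pos_index Q + #|A|)%N.
Proof.
(* The indicator of the nonzero vectors counts as a form of full index, to be compared with [Q]. *)
move=> ll Q0 h; pose D (x : 'rV[C]_n) : R := (x != 0)%:R.
have Dn : pos_index D = n by apply: pos_index_full => x x0; rewrite /D x0 ltr01.
rewrite -[X in (X <= _)%N]Dn; apply: (pos_index_le_id ll) => // x hx; rewrite /D; have [->|x0 _] := eqVneq x 0.
  by rewrite ltxx.
exact: h.
Qed.

(** A positive space of [Q1] and the whole second space form a direct sum, on which positivity at
    nonzero pairs makes the map [f + g] injective. The alternative [x = 0] covers the zero vector of
    the first summand. *)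
Lemma pos_index_add m n p (Q1 : 'rV[C]_m -> R) (Q : 'rV[C]_p -> R)
    (f : 'rV[C]_m -> 'rV[C]_p) (g : 'rV[C]_n -> 'rV[C]_p) :
  linear_map f -> linear_map g -> Q 0 <= 0 ->
  (forall x y, (x = 0 \/ 0 < Q1 x) -> (x != 0) || (y != 0) -> 0 < Q (f x + g y)) ->
  (pos_index Q1 + n <= pos_index Q)%N.
Proof.
move=> /linear_map_mx[M hM] /linear_map_mx[N hN] Q0 h.
have [U rU hU] := pos_index_space Q1.
pose W : 'M[C]_(m + n) := block_mx U 0 0 1%:M.
have rW : \rank W = (pos_index Q1 + n)%N by rewrite rank_diag_block_mx mxrank1 rU.
have hW (z : 'rV_(m + n)) : (z <= W)%MS -> z != 0 -> 0 < Q (z *m col_mx M N).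
  move=> /submxP[D hD] z0; rewrite -[z]hsubmxK mul_row_col -hM -hN; apply: h.
    have -> : lsubmx z = lsubmx D *m U.
      by rewrite hD -[D in LHS]hsubmxK mul_row_block row_mxKl mulmx0 addr0.
    have [->|x0] := eqVneq (lsubmx D *m U) 0; [by left | right].
    by apply: hU => //; exact: submxMl.
  rewrite -negb_and; apply: contra_neqN z0 => /andP[/eqP l0 /eqP r0].
  by rewrite -[z]hsubmxK l0 r0 row_mx0.
rewrite -rW; apply: pos_index_ge.
have ker0 : (W :&: kermx (col_mx M N))%MS = 0.
  apply/eqP; rewrite -submx0; apply/row_subP => i.
  have := row_sub i (W :&: kermx (col_mx M N))%MS.
  rewrite sub_capmx => /andP[sW /sub_kermxP rM].
  rewrite submx0; apply/negP => /negP r0.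
  by have := hW _ sW r0; rewrite rM ltNge Q0.
exists <<W *m col_mx M N>>%MS.
  by rewrite mxrank_gen -(mxrank_mul_ker W (col_mx M N)) ker0 mxrank0 addn0.
move=> y; rewrite genmxE => /submxP[D ->] y0; rewrite mulmxA; apply: hW.
  exact: submxMl.
by apply: contra_neq y0 => e; rewrite mulmxA e mul0mx.
Qed.

End PositiveIndex.

(** * Jacobi forms on a box *)

Section Forms.
Local Open Scope complex_scope.
Context {R : realType}.
Local Notation C := R[i].
Implicit Types (z w : C).

Definition cdot z w : R := complex.Re z * complex.Re w + complex.Im z * complex.Im w.
Definition csqr z : R := cdot z z.

Lemma csqr_ge0 z : 0 <= csqr z.
Proof. by rewrite addr_ge0 // -expr2 sqr_ge0. Qed.

Lemma csqr_eq0 z : (csqr z == 0) = (z == 0).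
Proof.
case: z => a b; rewrite /csqr /cdot /= paddr_eq0 -?expr2 ?sqr_ge0 // !sqrf_eq0.
by rewrite eq_complex.
Qed.

Lemma csqr0 : csqr 0 = 0. Proof. by rewrite /csqr /cdot /= mulr0 addr0. Qed.

Lemma cdot0l z : cdot 0 z = 0. Proof. by rewrite /cdot /= !mul0r addr0. Qed.
(** Coordinates beyond the end read 0. This is the Dirichlet condition on the right, and sums over
    [j < n] may mention [j.+1]. *)
Definition comp n (x : 'rV[C]_n) (j : nat) : C :=
  if insub j is Some i then x 0 i else 0.

Lemma comp_ord n (x : 'rV[C]_n) (i : 'I_n) : comp x i = x 0 i.
Proof. by rewrite /comp valK. Qed.

Lemma comp_out n (x : 'rV[C]_n) j : (n <= j)%N -> comp x j = 0.
Proof. by move=> h; rewrite /comp insubN // -leqNgt. Qed.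

Lemma comp_lin n (a : C) (x y : 'rV[C]_n) j :
  comp (a *: x + y) j = a * comp x j + comp y j.
Proof.
rewrite /comp; case: insub => [i|]; first by rewrite !mxE.
by rewrite mulr0 addr0.
Qed.

Lemma comp0 n j : comp (0 : 'rV[C]_n) j = 0.
Proof. by rewrite /comp; case: insub => // i; rewrite mxE. Qed.

Lemma comp_row n (f : nat -> C) j : (j < n)%N -> comp (\row_(i < n) f i) j = f j.
Proof. by move=> jn; rewrite -[j]/(val (Ordinal jn)) comp_ord mxE. Qed.

Lemma comp_eq0 n (x : 'rV[C]_n) : (forall j, (j < n)%N -> comp x j = 0) -> x = 0.
Proof. by move=> h; apply/rowP => i; rewrite mxE -comp_ord h. Qed.

Lemma linear_row n m (f : 'rV[C]_n -> nat -> C) :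
  (forall j (a : C) u v, f (a *: u + v) j = a * f u j + f v j) ->
  linear_map (fun x => \row_(i < m) f x i).
Proof. by move=> h a u v; apply/rowP => i; rewrite !mxE h. Qed.

(** Quadratic form of the tridiagonal matrix with off-diagonal entries [c] and diagonal [d]; the
    last coupling vanishes because [comp x N] is 0. *)
Definition jacobi N (c : R) (d : nat -> R) (x : 'rV[C]_N) : R :=
  \sum_(j < N) (2 * c * cdot (comp x j) (comp x j.+1) + d j * csqr (comp x j)).

Lemma jacobi0 N c d : jacobi c d (0 : 'rV_N) = 0.
Proof. by rewrite /jacobi big1 // => j _; rewrite !comp0 cdot0l csqr0 !mulr0 addr0. Qed.

End Forms.

(** * Sturm oscillation: positive index against sign changes *)

Section Sturm.
Local Open Scope complex_scope.
Context {R : realType}.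
Local Notation C := R[i].
Variables (t w : nat -> R).
Hypothesis wS : forall j, w j.+2 = t j * w j.+1 - w j.

(* In the variables [a j = x j / w j.+1] the form is diagonal in the
   differences of [a], with coefficients of the sign of [- w j.+1 * w j.+2]. *)
Lemma jacobi_diag (a : nat -> C) n :
  \sum_(j < n) (2 * cdot ((w j.+1)%:C * a j) ((w j.+2)%:C * a j.+1)
                - t j * csqr ((w j.+1)%:C * a j)) =
  - (\sum_(j < n) w j.+1 * w j.+2 * csqr (a j - a j.+1))
  - w 0%N * w 1%N * csqr (a 0%N) + w n * w n.+1 * csqr (a n).
Proof.
elim: n => [|n IH]; first by rewrite !big_ord0; ring.
rewrite !big_ord_recr /= IH wS; move: (\sum_(i < n) _) => S.
case: (a n) => p q; case: (a n.+1) => u v; rewrite /csqr /cdot /=; ring.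
Qed.

Variable N : nat.
Hypothesis w0 : forall j, (j <= N.+1)%N -> w j != 0.
Hypothesis w01 : 0 < w 0%N * w 1%N.

Definition sign_changes : {set 'I_N} := [set j : 'I_N | w j.+1 * w j.+2 < 0].

Let amp (x : 'rV[C]_N) (j : nat) : C := (w j.+1)^-1%:C * comp x j.

Let amp_lin (j : nat) (c : C) x y : amp (c *: x + y) j = c * amp x j + amp y j.
Proof. by rewrite /amp comp_lin; ring. Qed.

Let jacobi_amp (x : 'rV[C]_N) : jacobi 1 (fun j => - t j) x =
  - (\sum_(j < N) w j.+1 * w j.+2 * csqr (amp x j - amp x j.+1))
  - w 0%N * w 1%N * csqr (amp x 0%N).
Proof.
have h : amp x N = 0 by rewrite /amp comp_out ?mulr0.
have := jacobi_diag (amp x) N; rewrite h csqr0 mulr0 addr0 => <-.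
have wa j : (j <= N)%N -> (w j.+1)%:C * amp x j = comp x j.
  move=> jN; rewrite /amp mulrA -rmorphM /= mulfV ?rmorph1 ?mul1r //.
  by apply: w0.
rewrite /jacobi; apply: eq_bigr => j _; rewrite !wa ?mulr1 ?mulNr //.
exact: ltnW.
Qed.

Let constr (j : 'I_N) (x : 'rV[C]_N) := amp x j - amp x j.+1.
Let constr_lin j : linear_map (constr j : 'rV[C]_N -> C^o).
Proof.
by move=> c x y; rewrite /constr !amp_lin /GRing.scale /=; ring.
Qed.

(** One constraint per sign change, the equality of neighbouring amplitudes, removes every positive
    term of the diagonalised form. *)
Lemma sturm_le : (pos_index (jacobi 1 (fun j => - t j) (N := N)) <= #|sign_changes|)%N.
Proof.
apply: (pos_index_le_constr constr_lin) => x hx; rewrite jacobi_amp.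
have h1 : 0 <= \sum_(j < N) w j.+1 * w j.+2 * csqr (amp x j - amp x j.+1).
  apply: sumr_ge0 => j _; have [jS|] := boolP (j \in sign_changes).
    by have := hx _ jS; rewrite /constr => ->; rewrite csqr0 mulr0.
  by rewrite inE -leNgt => h; rewrite mulr_ge0 ?csqr_ge0.
by have := mulr_ge0 (ltW w01) (csqr_ge0 (amp x 0)); lra.
Qed.

(** The complementary constraints remove the negative terms; [None] stands for the additional
    constraint [a 0 = 0], which removes the boundary term and accounts for the [+ 1]. A vanishing
    form then makes all amplitudes equal to [a 0], hence zero. *)
Lemma sturm_ge : (#|sign_changes| <= pos_index (jacobi 1 (fun j => - t j) (N := N)) + 1)%N.
Proof.
pose l (o : option 'I_N) (x : 'rV[C]_N) : C := if o is Some j then constr j x else amp x 0%N.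
pose A : {set option 'I_N} := None |: [set Some j | j in ~: sign_changes].
have ll o : linear_map (l o : 'rV[C]_N -> C^o).
  by case: o => [j|]; [exact: constr_lin | move=> c x y; rewrite /l amp_lin].
have cA : #|A| = (N - #|sign_changes|).+1.
  rewrite /A cardsU1 card_imset; last by move=> ? ? [].
  rewrite (_ : None \in _ = false) /=; last by apply/negP => /imsetP[].
  by rewrite cardsCs finset.setCK card_ord.
have sN : (#|sign_changes| <= N)%N by have := max_card (mem sign_changes); rewrite card_ord.
suff : (N <= pos_index (jacobi 1 (fun j => - t j) (N := N)) + #|A|)%N by rewrite cA; lia.
apply: (pos_index_ge_constr ll) => [|x hx x0]; first by rewrite jacobi0.
have a0 : amp x 0%N = 0 by apply: (hx None); rewrite !inE.
have hj (j : 'I_N) : j \notin sign_changes -> amp x j - amp x j.+1 = 0.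
  move=> jS; apply: (hx (Some j)); rewrite /A in_setU1 /=; apply/imsetP; exists j => //.
  by rewrite inE.
rewrite jacobi_amp a0 csqr0 mulr0 subr0 oppr_gt0 ltNge; apply/negP => hs.
have hneg (j : 'I_N) : w j.+1 * w j.+2 * csqr (amp x j - amp x j.+1) <= 0.
  have [|jS] := boolP (j \in sign_changes); last by rewrite hj // csqr0 mulr0.
  by rewrite inE => h; rewrite mulr_le0_ge0 ?csqr_ge0 // ltW.
have : \sum_(j < N) - (w j.+1 * w j.+2 * csqr (amp x j - amp x j.+1)) == 0.
  rewrite eq_le sumrN oppr_le0 hs /= oppr_ge0.
  by apply: sumr_le0 => j _; exact: hneg.
rewrite psumr_eq0 => [|j _]; last by rewrite oppr_ge0.
move=> /allP hz; case/eqP: x0; apply: comp_eq0 => j jN.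
have az : forall k, (k < N)%N -> amp x k = 0.
  elim=> // k IH kN; have kN' := ltnW kN.
  have := hz (Ordinal kN') (mem_index_enum _); rewrite oppr_eq0 !mulf_eq0 /=.
  rewrite (negbTE (w0 _)) ?(negbTE (w0 _)) //= ?csqr_eq0 ?subr_eq0; last first.
    exact: ltnW.
  by rewrite IH // => /eqP <-.
have /eqP := az j jN; rewrite /amp mulf_eq0 => /orP[|/eqP //].
have := w0 (leqW jN); rewrite -[_ == 0](inj_eq (@complexI R)) rmorph0 fmorphV invr_eq0.
by rewrite -[X in _ == X](rmorph0 (real_complex R)) (inj_eq (@complexI R)) => /negbTE ->.
Qed.

End Sturm.

Section SignCount.
Local Open Scope complex_scope.
Context {R : realType}.
Implicit Types (phi : R) (t : nat -> R).

(* The parity of [half_turns] is the sign of the cosine, and one step of the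
   lift increases it by 0 or 1: it counts the sign changes of a solution. *)
Definition half_turns phi : int := Num.floor (2 * phi + 1 / 2).

Lemma half_periodic (h : R -> R) : (forall x, h (x + 1 / 2) = h x) ->
  forall x (k : int), h (x + k%:~R / 2) = h x.
Proof.
move=> hh x k; have := @periodic_addz _ (fun y => h (y / 2)) _ (2 * x) k.
have -> : (2 * x + k%:~R) / 2 = x + k%:~R / 2 by field.
have -> : 2 * x / 2 = x by field.
by apply=> y; rewrite -(hh (y / 2)) mulrDl.
Qed.

(** On this fundamental domain the cosine starts positive and the lift lands in [[0, 1/2)], so the
    sign changes exactly when 1/4 is passed. Half-turn equivariance transports this to all [phi]. *)
Lemma half_turns_step0 (s phi : R) : - (1 / 4) <= phi < 1 / 4 ->
  cos (2 * pi * phi) != 0 -> cos (2 * pi * schr_lift s phi) != 0 ->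
  half_turns (schr_lift s phi) =
    (cos (2 * pi * phi) * cos (2 * pi * schr_lift s phi) < 0)%R.
Proof.
move=> /andP[p1 p2] c1 c2.
have pi0 := @pi_gt0 R.
have cpos (x : R) : - (1 / 4) <= x <= 1 / 4 -> 0 <= cos (2 * pi * x).
  by move=> /andP[x1 x2]; apply: cos_ge0_pihalf; move: (pi) pi0 => p p0; nra.
have c1p : 0 < cos (2 * pi * phi) by rewrite lt_neqAle eq_sym c1 cpos // p1 ltW.
have g1 : schr_lift s phi < 1 / 2 by rewrite -(schr_lift_quarter s) schr_lift_lt.
have g0 : 0 <= schr_lift s phi.
  have := schr_lift_le s p1; have := schr_lift_half s (- (1 / 4)).
  have -> : - (1 / 4) + 1 / 2 = 1 / 4 :> R by lra.
  by rewrite schr_lift_quarter; lra.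
move: (schr_lift s phi) c2 g0 g1 => g c2 g0 g1; rewrite (pmulr_rlt0 _ c1p) /half_turns.
have [gq|gq] := ltP g (1 / 4).
  have -> : cos (2 * pi * g) < 0 = false.
    by apply/negbTE; rewrite -leNgt cpos //; lra.
  by apply/floor_def; rewrite /= ; lra.
have -> : cos (2 * pi * g) < 0.
  rewrite lt_neqAle c2 /= -[g](subrK (1 / 2)) cos_2pi_half oppr_le0 cpos //; lra.
by apply/floor_def; rewrite /=; lra.
Qed.

Lemma half_turns_step (s phi : R) :
  cos (2 * pi * phi) != 0 -> cos (2 * pi * schr_lift s phi) != 0 ->
  half_turns (schr_lift s phi) = half_turns phi +
    (cos (2 * pi * phi) * cos (2 * pi * schr_lift s phi) < 0)%R.
Proof.
set k := half_turns phi => c1 c2.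
have e1 : schr_lift s (phi - k%:~R / 2) = schr_lift s phi - k%:~R / 2.
  have := @half_periodic (fun x => schr_lift s x - x) _ phi (- k).
  rewrite mulrNz mulNr => h; have {}h := h (fun x => _).
  have /h : forall x, schr_lift s (x + 1 / 2) - (x + 1 / 2) = schr_lift s x - x.
    by move=> x; rewrite schr_lift_half; ring.
  by lra.
have cc (x y : R) : cos (2 * pi * (x - k%:~R / 2)) * cos (2 * pi * (y - k%:~R / 2))
    = cos (2 * pi * x) * cos (2 * pi * y).
  have := @half_periodic (fun d => cos (2 * pi * (x + d)) * cos (2 * pi * (y + d))) _ 0 (- k).
  rewrite add0r mulrNz mulNr !addr0; apply=> d.
  by rewrite !addrA !cos_2pi_half mulrNN.
have h1 := floor_le_tmp (2 * phi + 1 / 2); have h2 := lt_succ_floor (2 * phi + 1 / 2).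
rewrite intrD1 in h2.
rewrite -/(half_turns phi) -/k in h1 h2.
have := @half_turns_step0 s (phi - k%:~R / 2).
rewrite e1 cc => H; have {H} := H _ _ _.
have -> : half_turns (schr_lift s phi - k%:~R / 2) = half_turns (schr_lift s phi) - k.
  rewrite /half_turns; have -> : 2 * (schr_lift s phi - k%:~R / 2) + 1 / 2 =
    2 * schr_lift s phi + 1 / 2 + (- k)%:~R by rewrite mulrNz; field.
  by rewrite floorDrz ?intr_int // intrKfloor.
move=> H; rewrite -H ?subrKC //.
- by lra.
- by apply: contra_neq c1 => e; apply/eqP; rewrite -sqrf_eq0 expr2 -cc e mul0r.
- by apply: contra_neq c2 => e; apply/eqP; rewrite -sqrf_eq0 expr2 -cc e mul0r.
Qed.

End SignCount.

(** * From sign changes to the rotation of the lift *)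

Section JacobiRotation.
Local Open Scope complex_scope.
Context {R : realType}.
Implicit Types (t w : nat -> R) (phi : R).

Fixpoint recur t (a b : R) (n : nat) : R * R :=
  if n is m.+1 then let: (x, y) := recur t a b m in (y, t m * y - x) else (a, b).

Definition solution t a b n := (recur t a b n).1.

Lemma solutionS t a b n :
  solution t a b n.+2 = t n * solution t a b n.+1 - solution t a b n.
Proof. by rewrite /solution /=; case: (recur t a b n). Qed.

Lemma solution_lin t s n :
  solution t s 1 n = s * solution t 1 0 n + solution t 0 1 n.
Proof.
suff [] : solution t s 1 n = s * solution t 1 0 n + solution t 0 1 n /\
  solution t s 1 n.+1 = s * solution t 1 0 n.+1 + solution t 0 1 n.+1 by [].
elim: n => [|n [IH1 IH2]]; last by split=> //; rewrite !solutionS IH1 IH2; ring.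
by rewrite /solution /=; split; ring.
Qed.

Lemma solution_wronskian t n :
  solution t 1 0 n * solution t 0 1 n.+1 - solution t 1 0 n.+1 * solution t 0 1 n = 1.
Proof.
elim: n => [|n IH]; first by rewrite /solution /=; ring.
by rewrite !solutionS -[RHS]IH; ring.
Qed.

(** The Sturm argument divides by the solution. Each index excludes at most one initial value [s],
    because the Wronskian prevents a common zero of the two fundamental solutions. *)
Lemma solution_neq0 t N : exists2 s, 0 < s &
  forall j, (j < N)%N -> solution t s 1 j != 0.
Proof.
set S := \sum_(j < N) `|solution t 0 1 j / solution t 1 0 j|.
have S0 : 0 <= S by apply: sumr_ge0.
(* S + 1 exceeds all the ratios of the two fundamental solutions. *)
exists (S + 1) => [|j jN]; first by rewrite ltr_pwDr.
rewrite solution_lin; have [p0|p0] := eqVneq (solution t 1 0 j) 0.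
  rewrite p0 mulr0 add0r; apply/eqP => r0.
  have := solution_wronskian t j; rewrite p0 r0 mul0r mulr0 subr0 => /eqP.
  by rewrite eq_sym oner_eq0.
have hS : `|solution t 0 1 j / solution t 1 0 j| <= S.
  rewrite /S (bigD1 (Ordinal jN)) //= lerDl; exact: sumr_ge0.
apply/negP => /eqP e.
have : solution t 0 1 j / solution t 1 0 j = - (S + 1).
  by apply: (mulIf p0); rewrite divfK // mulNr; lra.
by move: hS => /[swap] ->; rewrite normrN ger0_norm; lra.
Qed.

Lemma solution_polar t phi w :
  (forall j, w j.+2 = t j * w j.+1 - w j) ->
  (exists2 r, 0 < r & w 0%N = r * sin (2 * pi * phi) /\ w 1%N = r * cos (2 * pi * phi)) ->
  forall n, exists2 r, 0 < r &
    w n = r * sin (2 * pi * rotate t n phi) /\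
    w n.+1 = r * cos (2 * pi * rotate t n phi).
Proof.
move=> wS h0; elim=> [|n [r r0 [h1 h2]]] //=.
have [e1 e2] := schr_lift_cos_sin (t n) (rotate t n phi).
have nr := schr_norm_gt0 (t n) (rotate t n phi).
exists (r * schr_norm (t n) (rotate t n phi)); first by rewrite mulr_gt0.
rewrite wS e1 e2 h1 h2; split; field; rewrite gt_eqF //.
Qed.

(** The constant 4 consists of 1 for Sturm oscillation, 1 for the two floors in [half_turns], and 2
    for twice the defect of starting at [phi] instead of 0. *)
Lemma jacobi_rotation t N :
  `|(pos_index (jacobi 1 (fun j => - t j) (N := N)))%:R - 2 * rotate t N 0| <= 4.
Proof.
have [s s0 hs] := solution_neq0 t N.+2.
set w := solution t s 1 in hs; have wS : forall j, w j.+2 = _ := solutionS t s 1.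
(* The initial vector [(w 1, w 0) = (1, s)] has slope [s]. *)
pose phi := atan s / (2 * pi).
have pi0 := @pi_gt0 R.
have ephi : 2 * pi * phi = atan s by rewrite /phi mulrC divfK // gt_eqF // mulr_gt0.
have cs0 : 0 < cos (atan s) by apply: cos_gt0_pihalf; rewrite atan_gtNpi2 atan_ltpi2.
have pol0 : exists2 r, 0 < r &
    w 0%N = r * sin (2 * pi * phi) /\ w 1%N = r * cos (2 * pi * phi).
  exists (cos (atan s))^-1; first by rewrite invr_gt0.
  rewrite ephi mulVf ?gt_eqF //; split=> //.
  by rewrite mulrC -/(tan _) atanK.
have pol := solution_polar wS pol0.
have w01 : 0 < w 0%N * w 1%N by rewrite /w /solution /= mulr1.
have hw j : (j <= N.+1)%N -> w j != 0 by move=> h; apply: hs.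
have turns n : (n <= N)%N -> half_turns (rotate t n phi) - half_turns phi =
    (\sum_(j < n) (w j.+1 * w j.+2 < 0)%R)%N.
  elim: n => [|n IH] nN /=; first by rewrite big_ord0 subrr.
  rewrite big_ord_recr /= PoszD -IH; last exact: ltnW.
  have [r r0 [_ h1]] := pol n; have [r' r'0 [_ h2]] := pol n.+1.
  have c1 : cos (2 * pi * rotate t n phi) != 0.
    by have := hw n.+1 (ltnW nN); rewrite h1 mulf_eq0 negb_or => /andP[].
  have c2 : cos (2 * pi * schr_lift (t n) (rotate t n phi)) != 0.
    by have := hw n.+2 nN; rewrite h2 mulf_eq0 negb_or => /andP[].
  have sgn : (w n.+1 * w n.+2 < 0) =
      (cos (2 * pi * rotate t n phi) * cos (2 * pi * schr_lift (t n) (rotate t n phi)) < 0).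
    by rewrite h1 h2 mulrACA pmulr_rlt0 // mulr_gt0.
  by rewrite half_turns_step // sgn addrAC.
have cardE : (\sum_(j < N) (w j.+1 * w j.+2 < 0)%R)%N = #|sign_changes w N|.
  by rewrite -sum1_card [RHS]big_mkcond /=; apply: eq_bigr => j _; rewrite inE; case: (_ < _).
have up := sturm_le wS hw w01; have lo := sturm_ge wS hw w01.
have := turns N (leqnn N); rewrite cardE /half_turns.
have f1 := floor_le_tmp (2 * phi + 1 / 2); have f2 := lt_succ_floor (2 * phi + 1 / 2).
have g1 := floor_le_tmp (2 * rotate t N phi + 1 / 2).
have g2 := lt_succ_floor (2 * rotate t N phi + 1 / 2).
move=> /(congr1 (fun k : int => k%:~R : R)); rewrite intrB.
rewrite !intrD1 in f2 g2.
have := rotate_defect t N phi.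
move: up lo; rewrite -!(ler_nat R) natrD => up lo.
rewrite -[(Posz _)%:~R]/(#|sign_changes w N|%:R : R) !ler_norml; lra.
Qed.

End JacobiRotation.

(** * Eigenvalue counting for the strip and the mosaic *)

Section Schur.
Local Open Scope complex_scope.
Context {R : realType}.
Local Notation C := R[i].

Lemma big_ord_double (V : nmodType) N (F : nat -> V) :
  \sum_(p < 2 * N) F p = \sum_(k < N) (F (2 * k)%N + F (2 * k).+1).
Proof.
rewrite -(big_mkord xpredT F); elim: N => [|N IH].
  by rewrite muln0 big_ord0 big_geq.
by rewrite mulnS !big_nat_recr //= IH big_ord_recr /= addrA.
Qed.

Definition evens N (x : 'rV[C]_(2 * N)) : 'rV[C]_N := \row_(k < N) comp x (2 * k).

Definition interleave N (y : 'rV[C]_N) (z : nat -> C) : 'rV[C]_(2 * N) :=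
  \row_(p < 2 * N) if odd p then z p./2 else comp y p./2.

Lemma comp_evens N (x : 'rV[C]_(2 * N)) k : comp (evens x) k = comp x (2 * k).
Proof.
have [kN|kN] := ltnP k N; first by rewrite (comp_row (fun k => comp x (2 * k))).
by rewrite !comp_out // leq_mul2l.
Qed.

Lemma comp_interleave_even N (y : 'rV[C]_N) z k :
  comp (interleave y z) (2 * k) = comp y k.
Proof.
have [kN|kN] := ltnP k N.
  rewrite (comp_row (fun p => if odd p then z p./2 else comp y p./2)) ?ltn_mul2l //.
  by rewrite mul2n odd_double doubleK.
by rewrite !comp_out // leq_mul2l.
Qed.

Lemma comp_interleave_odd N (y : 'rV[C]_N) z k : (k < N)%N ->
  comp (interleave y z) (2 * k).+1 = z k.
Proof.
move=> kN; rewrite (comp_row (fun p => if odd p then z p./2 else comp y p./2)).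
  by rewrite mul2n /= odd_double /= uphalf_double.
by lia.
Qed.

Lemma evens_interleave N (y : 'rV[C]_N) z : evens (interleave y z) = y.
Proof. by apply/rowP => i; rewrite mxE comp_interleave_even comp_ord. Qed.

Lemma evens_linear N : linear_map (@evens N).
Proof.
apply: (@linear_row _ _ _ (fun x k => comp x (2 * k))) => j a u v.
exact: comp_lin.
Qed.

Lemma interleave_linear N M (f : 'rV[C]_M -> 'rV[C]_N) (L : 'rV[C]_M -> nat -> C) :
  linear_map f ->
  (forall k (a : C) u v, L (a *: u + v) k = a * L u k + L v k) ->
  linear_map (fun y => interleave (f y) (L y)).
Proof.
move=> lf lL.
apply: (@linear_row _ _ _ (fun y p => if odd p then L y p./2 else comp (f y) p./2)).
by move=> p a u v; case: ifP; rewrite ?lL // lf comp_lin.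
Qed.

Variables (N : nat) (Q : 'rV[C]_(2 * N) -> R) (S : 'rV[C]_N -> R)
  (L : 'rV[C]_N -> nat -> C) (e : R).
Hypothesis lL : forall k (a : C) u v, L (a *: u + v) k = a * L u k + L v k.
Hypothesis S0 : S 0 = 0.
Hypothesis QS : forall x, Q x = S (evens x)
  - e * \sum_(k < N) csqr (comp x (2 * k).+1 - L (evens x) k).

Let Qf y (z : nat -> C) : Q (interleave y (fun k => L y k + z k)) =
  S y - e * \sum_(k < N) csqr (z k).
Proof.
rewrite QS evens_interleave; congr (_ - _ * _); apply: eq_bigr => k _.
by rewrite comp_interleave_odd // addrC addKr.
Qed.

Let L0 k : L 0 k = 0.
Proof. by have := lL k 1 0 0; rewrite scaler0 addr0 mul1r -[X in X = _]addr0 => /addrI. Qed.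

Let Q0 : Q 0 = 0.
Proof.
rewrite QS (_ : evens 0 = 0) ?S0; last by apply/rowP => i; rewrite !mxE comp0.
rewrite big1 ?mulr0 ?subr0 // => k _; by rewrite comp0 L0 subr0 csqr0.
Qed.

(** The square is subtracted, so [evens] maps positive spaces of [Q] to positive spaces of [S];
    filling the odd coordinates with [L] makes the square vanish and leads back. *)
Lemma schur_pos : 0 < e -> pos_index Q = pos_index S.
Proof.
move=> e0; apply/eqP; rewrite eqn_leq; apply/andP; split.
  apply: (pos_index_le0 (@evens_linear N)); rewrite ?S0 // => x.
  rewrite QS; have : 0 <= e * \sum_(k < N) csqr (comp x (2 * k).+1 - L (evens x) k).
    by rewrite mulr_ge0 ?sumr_ge0 // ?ltW // => k _; exact: csqr_ge0.
  lra.
apply: (pos_index_le0 (f := fun y => interleave y (L y))); rewrite ?Q0 //.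
  exact: interleave_linear.
move=> y; have := Qf y (fun=> 0); rewrite big1 => [|k _]; last exact: csqr0.
rewrite mulr0 subr0 => <-; congr (0 < Q (interleave y _)).
by apply/funext => k; rewrite addr0.
Qed.

(** Now the squares are [N] further positive directions. Forcing them to vanish costs [N]
    constraints; conversely the graph of [L] over a positive space is joined with all vectors
    supported on the odd coordinates. *)
Lemma schur_neg : e < 0 -> pos_index Q = (N + pos_index S)%N.
Proof.
move=> e0; apply/eqP; rewrite eqn_leq; apply/andP; split.
  pose l (k : 'I_N) (x : 'rV[C]_(2 * N)) := comp x (2 * k).+1 - L (evens x) k.
  have ll k : linear_map (l k : 'rV[C]_(2 * N) -> C^o).
    by move=> a u v; rewrite /l evens_linear lL comp_lin /GRing.scale /=; ring.
  have := pos_index_le (A := [set: 'I_N]%SET) ll (@evens_linear N) (Q := Q) (Q' := S).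
  rewrite cardsT card_ord addnC S0; apply=> // x hx.
  rewrite QS big1 ?mulr0 ?subr0 // => k _.
  by rewrite -/(l k x) hx ?csqr0 // inE.
rewrite addnC.
apply: (pos_index_add (f := fun y => interleave y (L y))
  (g := fun z : 'rV[C]_N => interleave 0 (comp z))); rewrite ?Q0 //.
- exact: interleave_linear.
- apply: (@interleave_linear N N (fun=> 0)) => [a u v|]; first by rewrite scaler0 addr0.
  by move=> k a u v; rewrite comp_lin.
move=> y z hy hyz.
have -> : interleave y (L y) + interleave 0 (comp z) =
    interleave y (fun k => L y k + comp z k).
  by apply/rowP => p; rewrite !mxE; case: ifP => // _; rewrite comp0 addr0.
rewrite Qf.
have s0 : 0 <= \sum_(k < N) csqr (comp z k) by apply: sumr_ge0 => k _; exact: csqr_ge0.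
have [z0|z0] := eqVneq z 0.
  move: hyz; rewrite z0 eqxx orbF => y0; case: hy => [/eqP|hy]; first by rewrite (negbTE y0).
  by rewrite big1 ?mulr0 ?subr0 // => k _; rewrite comp0 csqr0.
have sp : 0 < \sum_(k < N) csqr (comp z k).
  rewrite lt_neqAle s0 andbT eq_sym; apply: contraNneq z0 => h; apply/eqP.
  apply: comp_eq0 => j jN; have /eqP : \sum_(k < N) csqr (comp z k) = 0 by [].
  rewrite psumr_eq0 => [/allP/(_ (Ordinal jN) (mem_index_enum _))|k _]; last exact: csqr_ge0.
  by rewrite csqr_eq0 => /eqP.
have S1 : 0 <= S y by case: hy => [->|/ltW //]; rewrite S0.
have : e * \sum_(k < N) csqr (comp z k) < 0 by rewrite nmulr_rlt0.
by lra.
Qed.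

End Schur.

(** * Eigenvalue counts as positive indices *)

Section Spectral.
Local Open Scope complex_scope.
Local Open Scope sesquilinear_scope.
Context {R : realType}.
Local Notation C := R[i].

Definition herm_form n (A : 'M[C]_n) (E : R) (x : 'rV[C]_n) : R :=
  complex.Re (\sum_(p < n) \sum_(q < n) x 0 p * A p q * ((x 0 q)^*)%R)
  - E * \sum_(p < n) csqr (x 0 p).

Lemma csqrE (z : C) : z * (z^*)%R = (csqr z)%:C.
Proof.
case: z => a b; apply/eqP; rewrite eq_complex /csqr /cdot /=; apply/andP; split; apply/eqP; ring.
Qed.

Lemma Re_sum (I : finType) (F : I -> C) :
  complex.Re (\sum_i F i) = \sum_i complex.Re (F i).
Proof. by apply: (big_morph (@complex.Re R)) => // -[a b] [c d]. Qed.

(** In the coordinates [y] of an orthonormal eigenbasis the form is diagonal with entries [d j - E].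
    Killing the coordinates outside [T] makes it nonpositive, killing those in [T] makes it
    positive: one inequality each. *)
Lemma spectral_count n (A : 'M[C]_n) (E : R) : A \is hermsymmx ->
  (pos_index (herm_form A E) +
   #|[set j | (spectral_diag A 0 j <= E%:C)%R]%SET| = n)%N.
Proof.
move=> hA; have nA := hermitian_normalmx hA; have /mxOverP dR := hermitian_spectral_diag_real hA.
set d := spectral_diag A in dR *; set P := spectralmx A.
have PU : P \is unitarymx := spectral_unitarymx A.
pose y (x : 'rV[C]_n) := x *m P^t*.
have dim j : complex.Im (d 0 j) = 0.
  by have := dR 0 j; case: (d 0 j) => a b; rewrite complex_real => /eqP.
have hQ x : herm_form A E x = \sum_j (complex.Re (d 0 j) - E) * csqr (y x 0 j).
  have e1 : \sum_p \sum_q x 0 p * A p q * ((x 0 q)^*)%R = (x *m A *m x^t*) 0 0.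
    rewrite mxE exchange_big /=; apply: eq_bigr => q _.
    by rewrite !mxE mulr_suml; apply: eq_bigr => p _.
  have e2 : (x *m A *m x^t*) 0 0 = \sum_j d 0 j * (csqr (y x 0 j))%:C.
    have -> : A = P^t* *m diag_mx d *m P.
      by rewrite {1}(orthomx_spectralP nA) invmx_unitary.
    have -> : x *m (P^t* *m diag_mx d *m P) *m x^t* = y x *m diag_mx d *m (y x)^t*.
      by rewrite /y trmx_mul map_mxM trmxCK !mulmxA.
    rewrite mul_mx_diag mxE; apply: eq_bigr => j _; rewrite !mxE.
    by rewrite -csqrE; ring.
  have e3 : \sum_p csqr (x 0 p) = \sum_j csqr (y x 0 j).
    have cs (z : 'rV[C]_n) : (\sum_p csqr (z 0 p))%:C = (z *m z^t*) 0 0.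
      rewrite rmorph_sum mxE; apply: eq_bigr => p _; rewrite !mxE; exact/esym/csqrE.
    apply: (@complexI R); rewrite !cs /y trmx_mul map_mxM trmxCK mulmxA.
    by rewrite -[x *m _ *m P]mulmxA -(invmx_unitary PU) (mulVmx (unitarymx_unit PU)) mulmx1.
  rewrite /herm_form e1 e2 e3 Re_sum mulr_sumr -sumrB; apply: eq_bigr => j _.
  by case: (d 0 j) (dim j) => a b /= ->; rewrite mul0r subr0 mulrBl.
have hd j : (d 0 j <= E%:C)%R = (complex.Re (d 0 j) <= E).
  by rewrite lecE /= dim eqxx.
pose l (j : 'I_n) (x : 'rV[C]_n) := y x 0 j.
have ll j : linear_map (l j : 'rV[C]_n -> C^o).
  by move=> a u v; rewrite /l /y mulmxDl -scalemxAl !mxE.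
set T := [set j | _]%SET.
have up : (pos_index (herm_form A E) <= #|~: T|)%N.
  apply: (pos_index_le_constr ll) => x hx; rewrite hQ; apply: sumr_le0 => j _.
  have [jT|jT] := boolP (j \in T).
    by move: jT; rewrite inE hd => h; rewrite mulr_le0_ge0 ?csqr_ge0 // subr_le0.
  by rewrite -/(l j x) hx ?csqr0 ?mulr0 // finset.in_setC.
have lo : (n <= pos_index (herm_form A E) + #|T|)%N.
  have h0 j : j \notin T -> 0 < complex.Re (d 0 j) - E.
    by rewrite inE hd -ltNge subr_gt0.
  apply: (pos_index_ge_constr ll) => [|x hx x0].
    rewrite hQ big1 // => j _; rewrite /y mul0mx mxE csqr0 mulr0 //.
  have y0 : y x != 0.
    apply: contra_neq x0 => e; rewrite -[x]mulmx1 -(mulVmx (unitarymx_unit PU)) invmx_unitary //.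
    by rewrite mulmxA -/(y x) e mul0mx.
  have nn j : 0 <= (complex.Re (d 0 j) - E) * csqr (y x 0 j).
    have [jT|jT] := boolP (j \in T); first by rewrite -/(l j x) hx // csqr0 mulr0.
    by rewrite mulr_ge0 ?csqr_ge0 // ltW // h0.
  rewrite hQ lt_neqAle sumr_ge0 // andbT eq_sym psumr_eq0 //.
  apply: contra y0 => /allP h; apply/eqP/rowP => j; rewrite [RHS]mxE.
  have [jT|jT] := boolP (j \in T); first exact: hx.
  have := h j (mem_index_enum _); rewrite mulf_eq0 csqr_eq0 => /orP[/eqP e|/eqP //].
  by have := h0 j jT; rewrite e ltxx.
have := cardsC T; rewrite card_ord => cT.
by apply/eqP; rewrite eqn_leq lo andbT -[leqRHS]cT addnC leq_add2l.
Qed.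

End Spectral.

(** * The quadratic form of the strip *)

Section StripForm.
Local Open Scope complex_scope.
Context {R : realType}.
Local Notation C := R[i].
Variables (lambda alpha theta : R).

Lemma sum_pick (V : nmodType) N m (F : nat -> V) :
  \sum_(l < N) (if (l : nat) == m then F l else 0) = if (m < N)%N then F m else 0.
Proof.
elim: N => [|N IH]; first by rewrite big_ord0.
rewrite big_ord_recr /= IH ltnS; case: (ltngtP N m) => h; rewrite ?addr0 ?add0r //.
by rewrite h.
Qed.

(** Blocks are numbered from 0 but sites from 1, hence [k.+1]; this is why the base point
    [theta + 2 * alpha] appears later. *)
Definition site_arg (k : nat) : R := 2 * k.+1%:R * alpha + theta.
Definition hop (k : nat) : C := ((1 + cis (site_arg k))^*)%R.

Lemma cisN (x : R) : cis (- x) = ((cis x)^*)%R.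
Proof. by rewrite /cis mulrN cosN sinN. Qed.

Lemma csqr_hop k : csqr (hop k) = 2 + 2 * cos (2 * pi * site_arg k).
Proof.
rewrite /hop /cis /csqr /cdot /=; have := cos2Dsin2 (2 * pi * site_arg k).
by move: (cos _) (sin _) => c s h; rewrite !add0r; lra.
Qed.

Definition strip_entry (p q : nat) : C :=
  let k := (p %/ 2)%N in let l := (q %/ 2)%N in
  let a : 'I_2 := inord (p %% 2) in let b : 'I_2 := inord (q %% 2) in
  if k == l then Vhat (site_arg k) a b
  else if (l == k.+1) || (k == l.+1) then Chat lambda a b else 0.

(** The two conjugate entries of a diagonal 2 x 2 block combine to a real term, and a neighbouring
    block has only its upper left entry. *)
Lemma strip_block (X : nat -> C) (k l : nat) (F := fun p q => X p * strip_entry p q * ((X q)^*)%R) :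
  F (2 * k)%N (2 * l)%N + F (2 * k)%N (2 * l).+1
  + (F (2 * k).+1 (2 * l)%N + F (2 * k).+1 (2 * l).+1) =
  (if l == k then (2 * cdot (hop k * X (2 * k)%N) (X (2 * k).+1))%:C else 0)
  + (if l == k.+1 then lambda%:C * X (2 * k)%N * ((X (2 * l)%N)^*)%R else 0)
  + (if k == l.+1 then lambda%:C * X (2 * k)%N * ((X (2 * l)%N)^*)%R else 0).
Proof.
have d0 m : ((2 * m) %/ 2 = m)%N by rewrite mulKn.
have d1 m : ((2 * m).+1 %/ 2 = m)%N by lia.
have m0 m : ((2 * m) %% 2 = 0)%N by lia.
have m1 m : ((2 * m).+1 %% 2 = 1)%N by lia.
have i0 : inord 0 = 0 :> 'I_2 by apply/val_inj; rewrite /= inordK.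
have i1 : inord 1 = 1 :> 'I_2 by apply/val_inj; rewrite /= inordK.
rewrite /F /strip_entry !d0 !d1 !m0 !m1 i0 i1 ![k == l]eq_sym.
have [->|lk] := eqVneq l k.
  rewrite !mxE /= !ltn_eqF // addr0 addr0 !mulr0 !mul0r add0r addr0 cisN.
  rewrite /hop; case: (cis (site_arg k)) (X (2 * k)%N) (X (2 * k).+1) => a b [c d] [e f].
  by apply/eqP; rewrite eq_complex /cdot /=; apply/andP; split; apply/eqP; ring.
rewrite !mxE /= add0r.
case: (eqVneq l k.+1) => [e1|n1]; case: (eqVneq k l.+1) => [e2|n2] /=.
- by exfalso; lia.
- by rewrite !mulr0 !mul0r !addr0; ring.
- by rewrite !mulr0 !mul0r !addr0; ring.
- by rewrite !mulr0 !mul0r !addr0.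
Qed.

Lemma strip_form N E (x : 'rV[C]_(2 * N)) (X := comp x) :
  herm_form (strip_box lambda alpha theta N) E x =
  \sum_(k < N) (2 * lambda * cdot (X (2 * k)%N) (X (2 * k.+1)%N)
     + 2 * cdot (hop k * X (2 * k)%N) (X (2 * k).+1)
     - E * (csqr (X (2 * k)%N) + csqr (X (2 * k).+1))).
Proof.
rewrite /herm_form.
have -> : \sum_(p < 2 * N) csqr (x 0 p) =
    \sum_(k < N) (csqr (X (2 * k)%N) + csqr (X (2 * k).+1)).
  by rewrite -(big_ord_double N (fun p => csqr (X p))); apply: eq_bigr => p _; rewrite -comp_ord.
have -> : \sum_(p < 2 * N) \sum_(q < 2 * N)
    x 0 p * strip_box lambda alpha theta N p q * ((x 0 q)^*)%R =
    \sum_(k < N) \sum_(l < N)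
  ((if (l : nat) == k then (2 * cdot (hop k * X (2 * k)%N) (X (2 * k).+1))%:C else 0)
  + (if (l : nat) == k.+1 then lambda%:C * X (2 * k)%N * ((X (2 * l)%N)^*)%R else 0)
  + (if (k : nat) == l.+1 then lambda%:C * X (2 * k)%N * ((X (2 * l)%N)^*)%R else 0)).
  pose F p q := X p * strip_entry p q * ((X q)^*)%R.
  transitivity (\sum_(p < 2 * N) \sum_(q < 2 * N) F p q).
    apply: eq_bigr => p _; apply: eq_bigr => q _.
    by rewrite strip_boxE /F /X !comp_ord /strip_entry /site_arg !eqSS.
  rewrite (big_ord_double N (fun p => \sum_(q < 2 * N) F p q)).
  apply: eq_bigr => k _.
  rewrite (big_ord_double N (F (2 * k)%N)) (big_ord_double N (F (2 * k).+1)) -big_split.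
  by apply: eq_bigr => l _; rewrite /= -strip_block.
have -> : \sum_(k < N) \sum_(l < N)
  ((if (l : nat) == k then (2 * cdot (hop k * X (2 * k)%N) (X (2 * k).+1))%:C else 0)
  + (if (l : nat) == k.+1 then lambda%:C * X (2 * k)%N * ((X (2 * l)%N)^*)%R else 0)
  + (if (k : nat) == l.+1 then lambda%:C * X (2 * k)%N * ((X (2 * l)%N)^*)%R else 0))
  = \sum_(k < N) ((2 * cdot (hop k * X (2 * k)%N) (X (2 * k).+1))%:C
     + lambda%:C * X (2 * k)%N * ((X (2 * k.+1)%N)^*)%R
     + lambda%:C * X (2 * k.+1)%N * ((X (2 * k)%N)^*)%R).
  have X0 k : (N <= k)%N -> X (2 * k)%N = 0.
    by move=> h; rewrite /X comp_out // leq_mul2l.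
  under eq_bigr do rewrite !big_split /=.
  rewrite !big_split /=; congr (_ + _ + _).
  - apply: eq_bigr => k _.
    rewrite (sum_pick N k (fun l => (2 * cdot (hop k * X (2 * k)%N) (X (2 * k).+1))%:C)).
    by rewrite ltn_ord.
  - apply: eq_bigr => k _.
    rewrite (sum_pick N k.+1 (fun l => lambda%:C * X (2 * k)%N * ((X (2 * l)%N)^*)%R)).
    by case: ltnP => // h; rewrite (X0 _ h) rmorph0 mulr0.
  - rewrite exchange_big; apply: eq_bigr => l _ /=.
    rewrite (sum_pick N l.+1 (fun k => lambda%:C * X (2 * k)%N * ((X (2 * l)%N)^*)%R)).
    by case: ltnP => // h; rewrite (X0 _ h) mulr0 mul0r.
rewrite Re_sum mulr_sumr -sumrB; apply: eq_bigr => k _; congr (_ - _).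
case: (X (2 * k)%N) (X (2 * k.+1)%N) => a b [c d]; rewrite /cdot /=; ring.
Qed.

(** The second component of a site is coupled only to the first one of the same site, so completing
    its square adds [|hop|^2 / E] to the diagonal and creates no new hopping. *)
Lemma strip_schur N E (x : 'rV[C]_(2 * N)) : E != 0 ->
  herm_form (strip_box lambda alpha theta N) E x =
  jacobi lambda (fun k => (2 + 2 * cos (2 * pi * site_arg k)) / E - E) (evens x)
  - E * \sum_(k < N) csqr (comp x (2 * k).+1
                          - (E^-1)%:C * hop k * comp (evens x) k).
Proof.
move=> E0; rewrite strip_form /jacobi mulr_sumr -sumrB; apply: eq_bigr => k _.
rewrite !comp_evens -csqr_hop.
case: (comp x (2 * k)) (comp x (2 * k).+1) (comp x (2 * k.+1)) (hop k).
move=> a b [c d] [e f] [g h]; by rewrite /csqr /cdot /=; field.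
Qed.

End StripForm.

(** * Scaling, sign flip, and elimination of the odd mosaic sites *)

Section JacobiOps.
Local Open Scope complex_scope.
Context {R : realType}.
Local Notation C := R[i].

Lemma jacobi_scale N (a c : R) d (x : 'rV[C]_N) :
  jacobi (a * c) (fun j => a * d j) x = a * jacobi c d x.
Proof. by rewrite /jacobi mulr_sumr; apply: eq_bigr => j _; ring. Qed.

Lemma pos_index_jacobi_scale N (a c : R) d : 0 < a ->
  pos_index (jacobi (a * c) (fun j => a * d j) (N := N)) = pos_index (jacobi c d (N := N)).
Proof.
move=> a0; apply/eqP; rewrite eqn_leq; apply/andP.
by split; apply: pos_index_mono; rewrite ?jacobi0 // => x; rewrite jacobi_scale pmulr_rgt0.
Qed.

Lemma pos_index_jacobi_flip N (c : R) d :
  pos_index (jacobi (- c) d (N := N)) = pos_index (jacobi c d (N := N)).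
Proof.
pose sg (j : nat) : C := if odd j then -1 else 1.
have H (c' : R) : (pos_index (jacobi (- c') d (N := N)) <= pos_index (jacobi c' d (N := N)))%N.
  apply: (pos_index_le0 (f := fun x : 'rV[C]_N => \row_(j < N) (sg j * comp x j))).
  - apply: (@linear_row _ _ _ (fun x j => sg j * comp x j)) => j a u v.
    by rewrite comp_lin; ring.
  - by rewrite jacobi0.
  move=> x; congr (0 < _); apply: eq_bigr => j _.
  have cs k : comp (\row_(j < N) (sg j * comp x j)) k = sg k * comp x k.
    have [kN|kN] := ltnP k N; first by rewrite (comp_row (fun j => sg j * comp x j)).
    by rewrite !comp_out // mulr0.
  rewrite !cs /sg /=; case: (odd j) => /=; rewrite ?mulN1r ?mul1r;
  by case: (comp x j) (comp x j.+1) => a b [e f]; rewrite /csqr /cdot /=; ring.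
by apply/eqP; rewrite eqn_leq H -[X in jacobi X d](opprK c) H.
Qed.

Lemma sum_shift (f : nat -> R) N : \sum_(k < N) f k.+1 = \sum_(k < N) f k - f 0%N + f N.
Proof.
elim: N => [|N IH]; first by rewrite !big_ord0; ring.
by rewrite !big_ord_recr /= IH; ring.
Qed.

Variables (v t : nat -> R) (E : R).
Hypothesis E0 : E != 0.
Hypothesis t_even : forall k, t (2 * k)%N = E - v k.
Hypothesis t_odd : forall k, t (2 * k).+1 = E.

Definition mosaic_diag (k : nat) : R := 2 + E * v k - E ^+ 2.

Definition mosaic_schur N (y : 'rV[C]_N) : R :=
  \sum_(k < N) (csqr (comp y k + comp y k.+1) / E - (E - v k) * csqr (comp y k)).

Lemma mosaic_form N (x : 'rV[C]_(2 * N)) :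
  jacobi 1 (fun j => - t j) x = mosaic_schur (evens x)
  - E * \sum_(k < N) csqr (comp x (2 * k).+1
           - (E^-1)%:C * (comp (evens x) k + comp (evens x) k.+1)).
Proof.
rewrite /jacobi (big_ord_double N (fun j => 2 * 1 * cdot (comp x j) (comp x j.+1)
   + - t j * csqr (comp x j))) /mosaic_schur mulr_sumr -sumrB; apply: eq_bigr => k _.
rewrite !comp_evens t_even t_odd mulnS add2n.
case: (comp x (2 * k)) (comp x (2 * k).+1) (comp x (2 * k).+2).
move=> a b [c d] [e f]; by rewrite /csqr /cdot /=; field.
Qed.

(** Each even site borders two eliminated sites, except site 0, which borders one. The missing
    [|y 0|^2] is a rank-one term and the source of the error 1 in [mosaic_pos] and [mosaic_neg]. *)
Lemma mosaic_schurE N (y : 'rV[C]_N) : E * mosaic_schur y =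
  jacobi 1 mosaic_diag y - csqr (comp y 0).
Proof.
rewrite /mosaic_schur /jacobi /mosaic_diag.
have sh := sum_shift (fun k => csqr (comp y k)) N; rewrite (comp_out _ (leqnn N)) csqr0 addr0 in sh.
have -> : csqr (comp y 0) = \sum_(k < N) (csqr (comp y k) - csqr (comp y k.+1)).
  by rewrite sumrB sh; ring.
rewrite mulr_sumr -sumrB; apply: eq_bigr => k _.
case: (comp y k) (comp y k.+1) => a b [c d]; by rewrite /csqr /cdot /=; field.
Qed.

Lemma mosaic_schur0 N : mosaic_schur (0 : 'rV[C]_N) = 0.
Proof.
by rewrite /mosaic_schur big1 // => k _; rewrite !comp0 addr0 csqr0 mul0r mulr0 subr0.
Qed.

Let lin0 N (i : 'I_1) : linear_map ((fun y : 'rV[C]_N => comp y 0) : _ -> C^o).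
Proof. by move=> a u w; rewrite comp_lin. Qed.

Let L N (y : 'rV[C]_N) (k : nat) : C := (E^-1)%:C * (comp y k + comp y k.+1).
Let lL N k (a : C) (u w : 'rV[C]_N) : L (a *: u + w) k = a * L u k + L w k.
Proof. by rewrite /L !comp_lin; ring. Qed.

Lemma mosaic_pos N : 0 < E ->
  `|(pos_index (jacobi 1 (fun j => - t j) (N := 2 * N)))%:R
    - (pos_index (jacobi 1 mosaic_diag (N := N)))%:R| <= 1 :> R.
Proof.
move=> Ep; rewrite (schur_pos (@lL N) (mosaic_schur0 N) (@mosaic_form N) Ep).
have h1 : (pos_index (@mosaic_schur N) <=
           pos_index (jacobi 1 mosaic_diag (N := N)))%N.
  apply: pos_index_mono => [|x]; rewrite ?jacobi0 // => hx.
  have := mosaic_schurE x; have := csqr_ge0 (comp x 0).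
  by have := mulr_gt0 Ep hx; lra.
have h2 : (pos_index (jacobi 1 mosaic_diag (N := N))
    <= pos_index (@mosaic_schur N) + 1)%N.
  have := pos_index_le_id (A := [set: 'I_1]%SET) (@lin0 N)
    (Q := jacobi 1 mosaic_diag (N := N)) (Q' := @mosaic_schur N).
  rewrite cardsT card_ord mosaic_schur0; apply=> // x /(_ ord0) hx Jx.
  by rewrite -(pmulr_rgt0 _ Ep) mosaic_schurE hx ?inE // csqr0 subr0.
by move: h1 h2; rewrite -!(ler_nat R) natrD ler_norml; lra.
Qed.

(** The [N] odd sites have positive diagonal [- E]. Multiplying the complement by [- E > 0] gives
    hopping -1 and diagonal [- mosaic_diag]; the sign flip restores hopping 1. *)
Lemma mosaic_neg N : E < 0 ->
  `|(pos_index (jacobi 1 (fun j => - t j) (N := 2 * N)))%:R - (N%:R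
    + (pos_index (jacobi 1 (fun k => - mosaic_diag k) (N := N)))%:R)| <= 1 :> R.
Proof.
move=> En; rewrite (schur_neg (@lL N) (mosaic_schur0 N) (@mosaic_form N) En).
rewrite -pos_index_jacobi_flip.
have jE (y : 'rV[C]_N) : jacobi (-1) (fun k => - mosaic_diag k) y =
    - E * mosaic_schur y - csqr (comp y 0).
  rewrite mulNr mosaic_schurE -[X in jacobi X](mulr1 (-1)).
  under [fun k => - _]eq_fun do rewrite -mulN1r.
  by rewrite jacobi_scale; ring.
have Ep : 0 < - E by rewrite oppr_gt0.
have h1 : (pos_index (jacobi (-1) (fun k => - mosaic_diag k) (N := N)) <=
           pos_index (@mosaic_schur N))%N.
  apply: pos_index_mono => [|x]; rewrite ?mosaic_schur0 // jE => hx.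
  by rewrite -(pmulr_rgt0 _ Ep); have := csqr_ge0 (comp x 0); lra.
have h2 : (pos_index (@mosaic_schur N) <=
    pos_index (jacobi (-1) (fun k => - mosaic_diag k) (N := N)) + 1)%N.
  have := pos_index_le_id (A := [set: 'I_1]%SET) (@lin0 N) (Q := @mosaic_schur N)
    (Q' := jacobi (-1) (fun k => - mosaic_diag k) (N := N)).
  rewrite cardsT card_ord jacobi0; apply=> // x /(_ ord0) hx Sx.
  by rewrite jE hx ?inE // csqr0 subr0 mulr_gt0.
by move: h1 h2; rewrite -!(ler_nat R) !natrD ler_norml; lra.
Qed.

End JacobiOps.

(** * Aubry duality *)

Section Fourier.
Local Open Scope complex_scope.
Context {R : realType}.
Local Notation C := R[i].
Implicit Types (X Y : nat -> C) (x y : R).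

Lemma cisD x y : cis (x + y) = cis x * cis y.
Proof. rewrite /cis mulrDr cosD sinD; move: (cos _) (cos _) (sin _) (sin _) => a b c d.
by apply/eqP; rewrite eq_complex /=; apply/andP; split; apply/eqP; ring. Qed.

Lemma cis_int (k : int) : cis (k%:~R : R) = 1.
Proof.
by rewrite -[k%:~R]add0r /cis cos_2pi_addz sin_2pi_addz mulr0 cos0 sin0.
Qed.

Lemma cisMn x n : cis (x * n%:R) = cis x ^+ n.
Proof.
elim: n => [|n IH]; first by rewrite mulr0 (cis_int 0).
by rewrite -natr1 mulrDr mulr1 cisD IH exprSr.
Qed.

Lemma cis_eq1 x : cis x = 1 -> exists k : int, x = k%:~R.
Proof. by move=> /(congr1 (@complex.Re R)) /= /cos_2pi_eq1. Qed.

Lemma cdotE (z w : C) : cdot z w = complex.Re (z * (w^*)%R).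
Proof. by case: z w => a b [c d]; rewrite /cdot /=; ring. Qed.

Variables (q : nat) (p : int).
Hypothesis q0 : (0 < q)%N.
Hypothesis pq : coprimez p q.

Let z (m : int) : C := cis ((p * m)%:~R / q%:R).

Let zD m n : z (m + n) = z m * z n.
Proof. by rewrite /z -cisD mulrDr intrD mulrDl. Qed.

Let zN m : z (- m) = ((z m)^*)%R.
Proof. by rewrite /z mulrN intrN mulNr cisN. Qed.

Let qR : q%:R != 0 :> R. Proof. by rewrite pnatr_eq0 -lt0n. Qed.

Let z_mulq (m : int) : z (m * q%:Z) = 1.
Proof. by rewrite /z mulrA intrM mulfK // cis_int. Qed.

(** Coprimality enters here: the character has exact period [q], which gives the orthogonality
    behind [dft_parseval]. *)
Let z_eq1 m : z m = 1 -> (q %| m)%Z.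
Proof.
move=> /cis_eq1[k /(congr1 ( *%R^~ q%:R))]; rewrite divfK // => e.
have {e} : p * m = k * q%:Z by apply: (@intr_inj R); rewrite e [RHS]intrM.
by move=> e; rewrite -(Gauss_dvdzr m (_ : coprimez q p)) ?e ?dvdz_mull // coprimez_sym.
Qed.

Let zX m n : z (m * n%:Z) = z m ^+ n.
Proof. by rewrite /z mulrA intrM -cisMn; congr cis; rewrite mulrAC. Qed.

Let z_modn j k : z (j * (k %% q)%N%:Z) = z (j * k%:Z).
Proof.
rewrite {2}(divn_eq k q) PoszD PoszM mulrDr zD mulrA.
by rewrite z_mulq mul1r.
Qed.

(** The root of unity is [cis (p / q)], not [cis (1 / q)], so that a shift by one site corresponds
    exactly to the phase of the potential. *)
Definition dft X (k : nat) : C := \sum_(j < q) X j * z (j%:Z * k%:Z).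

Lemma dft_parseval X Y :
  \sum_(k < q) cdot (dft X k) (dft Y k) = q%:R * \sum_(j < q) cdot (X j) (Y j).
Proof.
transitivity (complex.Re (\sum_(j < q) \sum_(l < q) (X j * ((Y l)^*)%R) *
    \sum_(k < q) z ((j%:Z - l%:Z) * k%:Z))).
  under eq_bigr do rewrite cdotE.
  rewrite -Re_sum; congr complex.Re.
  transitivity (\sum_(k < q) \sum_(j < q) \sum_(l < q)
     (X j * ((Y l)^*)%R) * z ((j%:Z - l%:Z) * k%:Z)).
    apply: eq_bigr => k _; rewrite /dft rmorph_sum mulr_suml; apply: eq_bigr => j _.
    rewrite mulr_sumr; apply: eq_bigr => l _.
    by rewrite rmorphM mulrBl zD -mulNr [- _ * _]mulNr zN; ring.
  rewrite exchange_big; apply: eq_bigr => j _; rewrite exchange_big.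
  by apply: eq_bigr => l _; rewrite mulr_sumr.
have ker (j l : 'I_q) : \sum_(k < q) z ((j%:Z - l%:Z) * k%:Z) = if l == j then q%:R else 0.
  under eq_bigr do rewrite zX.
  have [->|lj] := eqVneq l j.
    under eq_bigr do rewrite subrr /z mulr0 mul0r (cis_int 0) expr1n.
    by rewrite sumr_const card_ord.
  have z1 : z (j%:Z - l%:Z) - 1 != 0.
    rewrite subr_eq0; apply: contraNneq lj => /z_eq1 /dvdzP[k e].
    apply/eqP/val_inj => /=; have := ltn_ord j; have := ltn_ord l.
    have [k0|[k1|k1]] : k = 0 \/ (1 <= k \/ k <= -1) by lia.
    - by move: e; rewrite k0; lia.
    - have : q%:Z <= k * q%:Z by nia.
      lia.
    - have : q%:Z <= - k * q%:Z by nia.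
      rewrite mulNr; lia.
  by apply: (mulfI z1); rewrite -subrX1 -zX z_mulq subrr mulr0.
rewrite Re_sum mulr_sumr; apply: eq_bigr => j _.
under eq_bigr do rewrite ker.
rewrite (bigD1 j) //= eqxx big1 ?addr0 => [|l /negbTE ->]; last by rewrite mulr0.
rewrite cdotE; case: (X j * _) => a b /=.
by rewrite -(rmorph_nat (real_complex R)) /=; ring.
Qed.

Lemma sum_cyclic (V : nmodType) (g : nat -> V) :
  \sum_(j < q) g (j.+1 %% q)%N = \sum_(j < q) g j.
Proof.
case: q q0 => // m _; rewrite big_ord_recr big_ord_recl /= modnn addrC; congr (_ + _).
by apply: eq_bigr => j _; rewrite modn_small // ltnS ltn_ord.
Qed.

Lemma dft_next X k : dft X (k.+1 %% q) = dft (fun j => z j%:Z * X j) k.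
Proof.
by apply: eq_bigr => j _; rewrite z_modn intS mulrDr mulr1 zD; ring.
Qed.

Lemma dft_cyclic X k : dft (fun j => X (j.+1 %% q)%N) k = z (- k%:Z) * dft X k.
Proof.
rewrite /dft -(sum_cyclic (fun j => X j * z (j%:Z * k%:Z))) mulr_sumr.
apply: eq_bigr => j _.
rewrite [(j.+1 %% q)%N%:Z * _]mulrC z_modn intS mulrDr mulr1 zD [k%:Z * j%:Z]mulrC.
rewrite mulrCA [z (- _) * _]mulrA -zD addNr.
have -> : z 0 = 1 by rewrite -(mul0r q%:Z) z_mulq.
by rewrite mul1r.

Qed.

Definition periodic_jacobi (c : R) (d : nat -> R) (x : 'rV[C]_q) : R :=
  \sum_(k < q) (2 * c * cdot (comp x k) (comp x (k.+1 %% q)) + d k * csqr (comp x k)).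

Let angle (k : nat) : R := (p * k%:Z)%:~R / q%:R.

Definition cos_diag (b c : R) (k : nat) : R := 2 * b * cos (2 * pi * ((p * k%:Z)%:~R / q%:R)) + c.

Let cdot_cis (k : nat) (w : C) : cdot w (z k%:Z * w) = cos (2 * pi * angle k) * csqr w.
Proof. by rewrite /z /cis -/(angle k); case: w => a b; rewrite /cdot /csqr /cdot /=; ring. Qed.

Let cdot_cisN (k : nat) (w : C) : cdot w (z (- k%:Z) * w) = cos (2 * pi * angle k) * csqr w.
Proof.
by rewrite zN /z /cis -/(angle k); case: w => a b; rewrite /cdot /csqr /cdot /=; ring.
Qed.

(* The Fourier transform exchanges the cyclic shift and the multiplication by
   the character, hence the roles of [a] and [b]: this is Aubry duality. *)
Lemma periodic_duality (a b c : R) (x : 'rV[C]_q) :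
  periodic_jacobi b (cos_diag a c)
     (\row_(k < q) dft (comp x) k) =
  q%:R * periodic_jacobi a (cos_diag b c) x.
Proof.
have ce k : (k < q)%N -> comp (\row_(k < q) dft (comp x) k) k = dft (comp x) k.
  exact: (comp_row (dft (comp x))).
have s1 : \sum_(k < q) csqr (dft (comp x) k) = q%:R * \sum_(k < q) csqr (comp x k).
  exact: dft_parseval.
have s2 : \sum_(k < q) cdot (dft (comp x) k) (dft (comp x) (k.+1 %% q)) =
    q%:R * \sum_(k < q) cos (2 * pi * angle k) * csqr (comp x k).
  under eq_bigr do rewrite dft_next.
  by rewrite dft_parseval; congr (_ * _); apply: eq_bigr => k _; rewrite cdot_cis.
have s3 : \sum_(k < q) cos (2 * pi * angle k) * csqr (dft (comp x) k) =
    q%:R * \sum_(k < q) cdot (comp x k) (comp x (k.+1 %% q)).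
  rewrite -(dft_parseval (comp x) (fun j => comp x (j.+1 %% q))).
  by apply: eq_bigr => k _; rewrite dft_cyclic cdot_cisN.
have split_form (f : nat -> C) (a' b' : R) :
    \sum_(k < q) (2 * b' * cdot (f k) (f (k.+1 %% q)%N) +
      (2 * a' * cos (2 * pi * angle k) + c) * csqr (f k)) =
    2 * b' * \sum_(k < q) cdot (f k) (f (k.+1 %% q)%N) +
    2 * a' * (\sum_(k < q) cos (2 * pi * angle k) * csqr (f k)) +
    c * \sum_(k < q) csqr (f k).
  rewrite !mulr_sumr -!big_split /=; apply: eq_bigr => k _; ring.
transitivity (\sum_(k < q) (2 * b * cdot (dft (comp x) k) (dft (comp x) (k.+1 %% q)) +
      (2 * a * cos (2 * pi * angle k) + c) * csqr (dft (comp x) k))).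
  by apply: eq_bigr => k _; rewrite !ce ?ltn_mod // ltn_ord.
rewrite split_form s1 s2 s3 /periodic_jacobi split_form; ring.
Qed.

Lemma pos_index_periodic_duality (a b c : R) :
  (pos_index (periodic_jacobi a (cos_diag b c)) <=
   pos_index (periodic_jacobi b (cos_diag a c)))%N.
Proof.
apply: (pos_index_le0 (f := fun x : 'rV[C]_q => \row_(k < q) dft (comp x) k)).
- move=> u x y; apply/rowP => j; rewrite !mxE /dft mulr_sumr -big_split /=.
  by apply: eq_bigr => k _; rewrite comp_lin; ring.
- by rewrite /periodic_jacobi big1 // => k _; rewrite !comp0 cdot0l csqr0 !mulr0 addr0.
by move=> x hx; rewrite periodic_duality mulr_gt0 // ltr0n.
Qed.

End Fourier.

(** * Asymptotically linear sequences *)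

Section LinearGrowth.
Local Open Scope complex_scope.
Context {R : realType}.
Implicit Types (u v : nat -> R) (l C : R).

(** Equivalent to the convergence of [u n / n] to [l], in a form that absorbs bounded errors and
    involves no quotient at [n = 0]. *)
Definition lin_growth u l := forall eps : R, 0 < eps -> exists C, forall n : nat,
  `|u n - l * n%:R| <= eps * n%:R + C.

Lemma lin_growth_cvg u l : lin_growth u l -> (fun n => u n / n%:R) @ \oo --> l.
Proof.
move=> h; apply: (@cvg_le_linear R (fun n => l * n%:R)) => //.
apply: (cvg_trans _ (@cvg_cst _ l _ \oo _)); apply: near_eq_cvg.
by exists 1%N => // n /= n1; rewrite mulfK // pnatr_eq0 -lt0n.
Qed.

Lemma cvg_lin_growth u l : (fun n => u n / n%:R) @ \oo --> l -> lin_growth u l.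
Proof.
move=> /cvgrPdist_le h eps e0; have [K _ hK] := h _ e0.
(* The sum covers the indices below [K]; the last term covers index 0 when [K = 0], since the
   quotient by 0 says nothing about [u 0]. *)
exists (\sum_(n < K) `|u n - l * n%:R| + `|u 0%N|) => n.
have S0 : 0 <= \sum_(n < K) `|u n - l * n%:R| by apply: sumr_ge0.
have e1 : 0 <= eps * n%:R by rewrite mulr_ge0 // ltW.
have [nK|Kn] := ltnP n K.
  have : `|u n - l * n%:R| <= \sum_(n < K) `|u n - l * n%:R|.
    by rewrite (bigD1 (Ordinal nK)) //= lerDl sumr_ge0.
  by have := normr_ge0 (u 0%N); lra.
case: n Kn e1 => [|n] Kn e1; first by rewrite mulr0 subr0; lra.
have n0 : 0 < n.+1%:R :> R by rewrite ltr0n.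
have := hK _ Kn; rewrite /= distrC -(ler_pM2r n0) -[X in _ * X <= _]gtr0_norm // -normrM.
rewrite mulrBl divfK ?gt_eqF //; have := normr_ge0 (u 0%N); lra.
Qed.

Lemma lin_growth_close u v l C : lin_growth u l -> (forall n, `|v n - u n| <= C) ->
  lin_growth v l.
Proof.
move=> h hC e e0; have [D hD] := h _ e0; exists (D + C) => n.
by have := hD n; have := hC n; rewrite !ler_norml; lra.
Qed.

Lemma lin_growthZ u l (a : R) : lin_growth u l -> lin_growth (fun n => a * u n) (a * l).
Proof.
move=> /lin_growth_cvg h; apply: cvg_lin_growth.
under eq_fun do rewrite -mulrA; exact: cvgMr.
Qed.

Lemma lin_growthD u v l l' : lin_growth u l -> lin_growth v l' ->
  lin_growth (fun n => u n + v n) (l + l').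
Proof.
move=> /lin_growth_cvg h /lin_growth_cvg h'; apply: cvg_lin_growth.
under eq_fun do rewrite mulrDl; exact: cvgD.
Qed.

Lemma lin_growth_nat : lin_growth (fun n => n%:R) 1.
Proof.
by move=> e e0; exists 0 => n; rewrite mul1r subrr normr0 addr0 mulr_ge0 // ltW.
Qed.

Lemma lin_growth_half u l : lin_growth u l -> lin_growth (fun n => u n./2) (l / 2).
Proof.
move=> h e e0; have [C hC] := h _ e0; exists (C + `|l|) => n.
have := hC n./2; have := normr_ge0 l; have := ler_norm l; have := ler_norm (- l).
have -> : n%:R = 2 * n./2%:R + (odd n)%:R :> R.
  by rewrite -[in LHS](odd_double_half n) natrD -mul2n natrM addrC.
have : 0 <= n./2%:R :> R by [].
rewrite normrN; move: (n./2%:R) (`|l|) => m L; case: (odd n); rewrite /= ?mulr0n ?mulr1n !ler_norml; nra.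
Qed.

(** The comparison is required only at arbitrarily large [n]: duality provides it only along
    denominators of good approximations. *)
Lemma lin_growth_le u v l l' :  lin_growth u l -> lin_growth v l' ->
  (exists C, forall K, exists2 n, (K <= n)%N & u n <= v n + C) -> l <= l'.
Proof.
move=> hu hv [C hC]; apply/ler_addgt0Pr => e e0.
have e40 : 0 < e / 4 by rewrite divr_gt0.
have [C1 h1] := hu _ e40; have [C2 h2] := hv _ e40.
have [n Kn hn] := hC (Num.truncn ((C + C1 + C2) / (e / 4))).+1.
have n0 : 0 < n%:R :> R by rewrite ltr0n; apply: leq_trans Kn.
have hb : C + C1 + C2 <= e / 4 * n%:R.
  rewrite mulrC -ler_pdivrMr // (le_trans (ltW (truncnS_gt _))) // ler_nat //.
rewrite -(ler_pM2r n0); have := h1 n; have := h2 n; rewrite !ler_norml; nra.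
Qed.

End LinearGrowth.

(** * Index densities and duality in the limit *)

Section Limits.
Local Open Scope complex_scope.
Context {R : realType}.
Local Notation C := R[i].
Variables (beta : R).
Hypothesis irr : forall (d : nat) (p : int), (0 < d)%N -> d%:R * beta <> p%:~R.
Implicit Types (tau : R -> R).

Lemma rotate_growth tau theta phi : (forall x, tau (x + 1) = tau x) -> continuous tau ->
  lin_growth (fun n => rotate (orbit_val beta tau theta) n phi) (rho beta tau).
Proof.
move=> per ct; apply: (@lin_growth_close _ _ _ _ (`|phi|)
  (cvg_lin_growth (rotation_cvg irr per ct theta phi))) => n.
by rewrite opprB addrCA subrr addr0.
Qed.

Lemma jacobi_growth tau theta : (forall x, tau (x + 1) = tau x) -> continuous tau ->
  lin_growth (fun N => (pos_index (jacobi 1 (fun j => - orbit_val beta tau theta j) (N := N)))%:R)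
    (2 * rho beta tau).
Proof.
move=> per ct; apply: (lin_growth_close (lin_growthZ 2 (rotate_growth theta 0 per ct))).
move=> n; exact: jacobi_rotation.
Qed.

Lemma rho_bounds tau : (forall x, tau (x + 1) = tau x) -> continuous tau ->
  0 <= rho beta tau <= 1 / 2.
Proof.
move=> per ct; have h := jacobi_growth 0 per ct.
have h1 : 2 * rho beta tau <= 1.
  apply: (lin_growth_le h lin_growth_nat); exists 0 => K; exists K => //.
  by rewrite addr0 ler_nat pos_index_le_dim.
have h0 : 0 * 1 <= 2 * rho beta tau.
  apply: (lin_growth_le (lin_growthZ 0 lin_growth_nat) h); exists 0 => K; exists K => //.
  by rewrite mul0r addr0.
by lra.
Qed.

Lemma cos_per (x : R) : cos (2 * pi * (x + 1)) = cos (2 * pi * x).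
Proof. exact: (cos_2pi_addz x 1). Qed.

Lemma continuous_cos2pi : continuous (fun x : R => cos (2 * pi * x)).
Proof.
move=> x; apply: (@continuous_comp _ _ _ (fun x : R => 2 * pi * x) (@cos R)).
  exact: mulrl_continuous.
exact: continuous_cos.
Qed.

(* [a J + 2 b cos + c] is [`|a|] times the Jacobi form with this potential, up
   to the alternating sign change of the coordinates when [a < 0]. *)
Definition mathieu (a b c : R) (x : R) : R := - (2 * b * cos (2 * pi * x) + c) / `|a|.

Lemma mathieu_per a b c x : mathieu a b c (x + 1) = mathieu a b c x.
Proof. by rewrite /mathieu cos_per. Qed.

Lemma continuous_mathieu a b c : continuous (mathieu a b c).
Proof.
move=> x; apply: cvgMl; apply: cvgN; apply: cvgD; last exact: cvg_cst.
by apply: cvgMr; exact: continuous_cos2pi.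
Qed.

Lemma mathieu_growth a b c : a != 0 ->
  lin_growth (fun N => (pos_index (jacobi a
     (fun k => 2 * b * cos (2 * pi * (k%:R * beta)) + c) (N := N)))%:R)
    (2 * rho beta (mathieu a b c)).
Proof.
move=> a0; have an : 0 < `|a| by rewrite normr_gt0.
apply: (@lin_growth_close _ _ _ _ 0 (jacobi_growth 0 (mathieu_per a b c) (@continuous_mathieu a b c))).
move=> N; rewrite (_ : pos_index _ = pos_index (jacobi 1
  (fun j => - orbit_val beta (mathieu a b c) 0 j) (N := N))) ?subrr ?normr0 //.
transitivity (pos_index (jacobi `|a|
     (fun k => 2 * b * cos (2 * pi * (k%:R * beta)) + c) (N := N))).
  case: (ger0P a) => // _; by rewrite -pos_index_jacobi_flip.
rewrite -(pos_index_jacobi_scale N 1 _ an) mulr1; congr (pos_index (jacobi _ _)).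
by apply/funext => k; rewrite /orbit_val /mathieu add0r; field; rewrite gt_eqF.
Qed.

Lemma far_from_int K : exists2 eta : R, 0 < eta &
  forall (d : nat) (p : int), (0 < d < K)%N -> eta <= `|d%:R * beta - p%:~R|.
Proof.
elim: K => [|K [eta eta0 h]]; first by exists 1 => // d p; rewrite ltn0 andbF.
have [->|K0] := posnP K; first by exists 1 => // d p; case: d => [|[]].
set x := K%:R * beta; have lo := floor_le_tmp x; have hi := lt_succ_floor x.
have nz : x != (Num.floor x)%:~R by apply/eqP; exact: irr.
have f0 : 0 < x - (Num.floor x)%:~R by rewrite subr_gt0 lt_neqAle eq_sym nz.
have f1 : 0 < (Num.floor x)%:~R + 1 - x by rewrite subr_gt0 -intrD1.
exists (Num.min eta (Num.min (x - (Num.floor x)%:~R) ((Num.floor x)%:~R + 1 - x))).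
  by rewrite !lt_min eta0 f0.
move=> d p /andP[d0]; rewrite ltnS leq_eqVlt => /orP[/eqP ->|dK].
  rewrite !ge_min; apply/orP; right; rewrite -/x.
  have [pf|pf] := lerP p (Num.floor x).
    apply/orP; left; apply: le_trans (ler_norm _).
    by rewrite lerD2l lerN2 ler_int.
  apply/orP; right; rewrite distrC; apply: le_trans (ler_norm _).
  by rewrite lerD2r -intrD1 ler_int lezD1.
by rewrite ge_min h // d0.
Qed.

(** Reducing a Dirichlet approximation to lowest terms divides the error by the gcd. Asking for an
    error below [eta], the distance achieved by all denominators under [K], forces [K <= q]. *)
Lemma coprime_approx K eps : 0 < eps -> exists q : nat, exists p : int,
  [/\ (K <= q)%N, (0 < q)%N, coprimez p q & `|q%:R * beta - p%:~R| < eps].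
Proof.
move=> e0; have [eta eta0 heta] := far_from_int K.
set m := Num.min eta eps; have m0 : 0 < m by rewrite lt_min eta0.
set Q := (Num.truncn m^-1).+1.
have Qm : Q%:R^-1 < m by rewrite invf_plt ?posrE // ?truncnS_gt // ltr0n.
have [d [p [/andP[d0 _] hd]]] := @dirichlet R beta Q isT.
pose g := gcdn d `|p|; have g0 : (0 < g)%N by rewrite gcdn_gt0 d0.
have [q hq] := dvdnP (dvdn_gcdl d `|p|); rewrite -/g in hq.
have [r hr] : exists r : int, p = r * g%:Z.
  by apply/dvdzP; rewrite /dvdz /=; exact: dvdn_gcdr.
have q0 : (0 < q)%N by move: d0; rewrite hq muln_gt0 => /andP[].
have cop : coprimez r q.
  have : (g * gcdn q `|r| = g * 1)%N.
    by rewrite muln1 muln_gcdr mulnC -hq mulnC -[X in (`|r| * X)%N]/(`|g%:Z|%N) -abszM -hr.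
  by move/eqP; rewrite eqn_pmul2l // /coprimez /gcdz gcdnC /= => /eqP ->.
have small : `|q%:R * beta - r%:~R| < m.
  apply: le_lt_trans (lt_trans hd Qm); rewrite hq hr natrM intrM.
  rewrite (_ : q%:R * g%:R * beta - r%:~R * g%:~R = g%:R * (q%:R * beta - r%:~R)); last by ring.
  by rewrite normrM ger0_norm // ler_peMl // ler1n.
exists q, r; split=> //.
- rewrite leqNgt; apply/negP => qK; have := heta q r; rewrite q0 qK => /(_ isT).
  by move: small; rewrite lt_min => /andP[]; lra.
- by move: small; rewrite lt_min => /andP[].
Qed.

(* On vectors with [x 0 = 0] the corner terms of the cyclic form vanish. *)
Lemma jacobi_periodic_le (a eps : R) (q : nat) (d d' : nat -> R) :
  (forall k, (k < q)%N -> d k <= d' k + eps) ->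
  (pos_index (jacobi a d (N := q)) <=
   pos_index (periodic_jacobi a (fun k => (d' k + eps)%R) (q := q)) + 1)%N /\
  (pos_index (periodic_jacobi a d (q := q)) <=
   pos_index (jacobi a (fun k => (d' k + eps)%R) (N := q)) + 1)%N.
Proof.
move=> dd'.
pose l (_ : 'I_1) (x : 'rV[C]_q) := comp x 0.
have ll i : linear_map (l i : 'rV[C]_q -> C^o) by move=> u x y; rewrite /l comp_lin.
have eqf (d0 : nat -> R) (x : 'rV[C]_q) : comp x 0 = 0 ->
    jacobi a d0 x = periodic_jacobi a d0 x.
  move=> x0; apply: eq_bigr => k _; congr (_ * _ + _); congr cdot.
  have := ltn_ord k; rewrite leq_eqVlt => /orP[/eqP e|h]; last by rewrite modn_small.
  by rewrite e modnn x0 comp_out.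
have mono (x : 'rV[C]_q) : jacobi a d x <= jacobi a (fun k => d' k + eps) x.
  by apply: ler_sum => k _; rewrite lerD2l ler_wpM2r ?csqr_ge0 // dd'.
have z0 (d0 : nat -> R) : periodic_jacobi a d0 (0 : 'rV[C]_q) = 0.
  by rewrite /periodic_jacobi big1 // => k _; rewrite !comp0 cdot0l csqr0 !mulr0 addr0.
split; rewrite -[in X in (_ <= _ + X)%N](card_ord 1) -cardsT.
  apply: (pos_index_le_id ll) => [|x /(_ ord0) hx]; first by rewrite z0.
  by rewrite -eqf; [move/lt_le_trans; apply; exact: mono | apply: hx; rewrite inE].
apply: (pos_index_le_id ll) => [|x /(_ ord0) hx]; first by rewrite jacobi0.
by rewrite -eqf; [move/lt_le_trans; apply; exact: mono | apply: hx; rewrite inE].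
Qed.

(** Half of [eps] pays for replacing the box by the cyclic form at [p / q], the other half for
    returning to a box after the Fourier transform has exchanged the couplings. *)
Lemma mathieu_rho_le (a b c eps : R) : a != 0 -> b != 0 -> 0 < eps ->
  rho beta (mathieu a b c) <= rho beta (mathieu b a (c + eps)).
Proof.
move=> a0 b0 e0; suff : 2 * rho beta (mathieu a b c) <= 2 * rho beta (mathieu b a (c + eps)) by lra.
apply: (lin_growth_le (mathieu_growth b c a0) (mathieu_growth a (c + eps) b0)).
(* One constraint for each of the two passages between box and cyclic form. *)
exists 2 => K.
pose M := 2 * (`|a| + `|b|).
have M0 : 0 < M by rewrite mulr_gt0 // addr_gt0 // normr_gt0.
have [del del0 hdel] := periodic_unif cos_per continuous_cos2pi
   (divr_gt0 (divr_gt0 e0 (ltr0n _ 2)) M0).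
have [q [p [Kq q0 cop hq]]] := coprime_approx K del0.
exists q => //.
have qR : 0 < q%:R :> R by rewrite ltr0n.
(* The angles differ by [k / q] times [q beta - p], so a box as long as the denominator keeps the
   error below [del] at every site. *)
have close k : (k < q)%N ->
   `|cos (2 * pi * (k%:R * beta)) - cos (2 * pi * ((p * k%:Z)%:~R / q%:R))| < eps / 2 / M.
  move=> kq; apply: (hdel _ _ 0); rewrite subr0.
  have -> : k%:R * beta - (p * k%:Z)%:~R / q%:R = k%:R / q%:R * (q%:R * beta - p%:~R).
    by rewrite intrM; field; rewrite gt_eqF.
  apply: le_lt_trans hq; rewrite normrM ger0_norm ?divr_ge0 // ler_piMl //.
  by rewrite ler_pdivrMr // mul1r ler_nat ltnW.
have bnd (y : R) k : (k < q)%N -> `|y| <= `|a| + `|b| ->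
   `|2 * y * (cos (2 * pi * (k%:R * beta)) - cos (2 * pi * ((p * k%:Z)%:~R / q%:R)))| <= eps / 2.
  move=> kq yab; rewrite !normrM ger0_norm //.
  have h := ltW (close k kq); rewrite ler_pdivlMr // in h.
  by apply: le_trans h; rewrite mulrC ler_wpM2l // /M ler_wpM2l.
have ha : `|a| <= `|a| + `|b| by rewrite lerDl.
have hb : `|b| <= `|a| + `|b| by rewrite lerDr.
have [h1 _] := @jacobi_periodic_le a (eps / 2) q
  (fun k => 2 * b * cos (2 * pi * (k%:R * beta)) + c) (cos_diag q p b c)
  (fun k kq => ltac:(have := bnd b k kq hb; rewrite /cos_diag ler_norml; lra)).
have [_ h2] := @jacobi_periodic_le b (eps / 2) q
  (cos_diag q p a (c + eps / 2)) (fun k => 2 * a * cos (2 * pi * (k%:R * beta)) + c + eps / 2)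
  (fun k kq => ltac:(have := bnd a k kq ha; rewrite /cos_diag ler_norml; lra)).
have h3 := pos_index_periodic_duality q0 cop a b (c + eps / 2).
have e1 : (fun k => cos_diag q p b c k + eps / 2) = cos_diag q p b (c + eps / 2).
  by apply/funext => k; rewrite /cos_diag addrA.
have e2 : (fun k : nat => 2 * a * cos (2 * pi * (k%:R * beta)) + c + eps / 2 + eps / 2)
    = (fun k => 2 * a * cos (2 * pi * (k%:R * beta)) + (c + eps)).
  by apply/funext => k; lra.
rewrite e1 in h1; rewrite e2 in h2.
rewrite -natrD ler_nat; lia.
Qed.

Lemma mathieu_duality (a b c : R) : a != 0 -> b != 0 ->
  rho beta (mathieu a b c) = rho beta (mathieu b a c).
Proof.
suff H (a' b' : R) : a' != 0 -> b' != 0 ->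
    rho beta (mathieu a' b' c) <= rho beta (mathieu b' a' c).
  by move=> a0 b0; apply/eqP; rewrite eq_le !H.
move=> a0 b0; apply/ler_addgt0Pr => e e0.
have bn : 0 < `|b'| by rewrite normr_gt0.
have [B hB] := periodic_bounded (mathieu_per b' a' c) (@continuous_mathieu b' a' c).
have [d d0 hd] := rho_close irr (B + 1) e0.
(* The factor [|b'|] turns the shift of [c] into a shift of the potential by [Num.min 1 (d / 2)]:
   below [d] for [rho_close], and at most 1 to stay within the bound [B + 1]. *)
pose eps := Num.min 1 (d / 2) * `|b'|.
have m0 : 0 < Num.min 1 (d / 2) by rewrite lt_min ltr01 divr_gt0.
have eps0 : 0 < eps by rewrite mulr_gt0.
have diff x : mathieu b' a' (c + eps) x = mathieu b' a' c x - Num.min 1 (d / 2).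
  by rewrite /mathieu /eps; move: (Num.min _ _) => m; field; rewrite gt_eqF.
have := hd _ _ (mathieu_per b' a' (c + eps)) (@continuous_mathieu b' a' (c + eps))
  (mathieu_per b' a' c) (@continuous_mathieu b' a' c).
have m1 : Num.min 1 (d / 2) <= 1 by rewrite ge_min lexx.
have m2 : Num.min 1 (d / 2) <= d / 2 by rewrite ge_min lexx orbT.
move=> H; have {H} : `|rho beta (mathieu b' a' (c + eps)) - rho beta (mathieu b' a' c)| <= e.
  apply: H => x; rewrite ?diff; have := hB x; rewrite ?ltr_norml ?ler_norml; lra.
by have := mathieu_rho_le c a0 b0 eps0; rewrite ler_norml; lra.
Qed.

End Limits.

(** * Limits of the eigenvalue counts *)

Section Strip.
Local Open Scope complex_scope.
Context {R : realType}.
Local Notation C := R[i].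
Variables (lambda alpha : R).
Hypothesis lambda0 : 0 < lambda.
Local Notation beta := (2 * alpha).
Hypothesis irr : forall (d : nat) (p : int), (0 < d)%N -> d%:R * beta <> p%:~R.
Implicit Types (E theta phi : R).

Definition strip_tau (E x : R) : R := (E ^+ 2 - 2 - 2 * cos (2 * pi * x)) / (E * lambda).

Lemma strip_tau_per E x : strip_tau E (x + 1) = strip_tau E x.
Proof. by rewrite /strip_tau cos_per. Qed.

Lemma continuous_strip_tau E : continuous (strip_tau E).
Proof.
move=> x; apply: cvgMl; apply: cvgB; first exact: cvg_cst.
by apply: cvgMr; exact: continuous_cos2pi.
Qed.

Lemma strip_jacobi E theta N : E != 0 ->
  pos_index (jacobi lambda
    (fun k => (2 + 2 * cos (2 * pi * site_arg alpha theta k)) / E - E) (N := N)) =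
  pos_index (jacobi 1 (fun j => - orbit_val beta (strip_tau E) (theta + beta) j) (N := N)).
Proof.
move=> E0; rewrite -(pos_index_jacobi_scale N 1 _ lambda0) mulr1.
congr (pos_index (jacobi _ _)); apply/funext => k.
have -> : site_arg alpha theta k = theta + beta + k%:R * beta.
  by rewrite /site_arg -natr1; ring.
rewrite /orbit_val /strip_tau; move: (cos _) => c.
by field; rewrite E0 gt_eqF.
Qed.

Let hopL E theta N (y : 'rV[C]_N) (k : nat) : C :=
  (E^-1)%:C * hop alpha theta k * comp y k.

Let hopL_lin E theta N k (a : C) (u v : 'rV[C]_N) :
  hopL E theta (a *: u + v) k = a * hopL E theta u k + hopL E theta v k.
Proof. by rewrite /hopL comp_lin; ring. Qed.

Lemma eig_count_pos E theta N : 0 < E ->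
  (eig_count lambda alpha theta N E +
   pos_index (jacobi 1 (fun j => - orbit_val beta (strip_tau E) (theta + beta) j) (N := N))
   = 2 * N)%N.
Proof.
move=> E0; rewrite -strip_jacobi ?gt_eqF //.
have S0 : jacobi lambda
    (fun k => (2 + 2 * cos (2 * pi * site_arg alpha theta k)) / E - E) (0 : 'rV[C]_N) = 0.
  exact: jacobi0.
rewrite -(schur_pos (@hopL_lin E theta N) S0
  (fun x => strip_schur lambda alpha theta x (lt0r_neq0 E0)) E0) addnC.
exact: spectral_count (strip_box_hermitian _ _ _ _).
Qed.

Lemma eig_count_neg E theta N : E < 0 ->
  (eig_count lambda alpha theta N E + (N +
   pos_index (jacobi 1 (fun j => - orbit_val beta (strip_tau E) (theta + beta) j) (N := N)))
   = 2 * N)%N.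
Proof.
move=> E0; rewrite -strip_jacobi ?lt_eqF //.
have S0 : jacobi lambda
    (fun k => (2 + 2 * cos (2 * pi * site_arg alpha theta k)) / E - E) (0 : 'rV[C]_N) = 0.
  exact: jacobi0.
rewrite -(schur_neg (@hopL_lin E theta N) S0
  (fun x => strip_schur lambda alpha theta x (ltr0_neq0 E0)) E0) addnC.
exact: spectral_count (strip_box_hermitian _ _ _ _).
Qed.

Lemma ids_cvg_pos E theta : 0 < E ->
  (fun N => ids_box lambda alpha theta N E) @ \oo --> 1 - rho beta (strip_tau E).
Proof.
move=> E0; have := jacobi_growth irr (theta + beta) (strip_tau_per E) (@continuous_strip_tau E).
move=> /(lin_growthZ (- (1 / 2))) /(lin_growthD lin_growth_nat) /lin_growth_cvg.
rewrite (_ : 1 + _ = 1 - rho beta (strip_tau E)); last by lra.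
apply: cvg_trans; apply: near_eq_cvg; exists 1%N => // N /= N1.
have := eig_count_pos theta N E0; rewrite /ids_box.
move=> /(congr1 (fun n => n%:R : R)); rewrite natrD natrM => h.
have N0 : N%:R != 0 :> R by rewrite pnatr_eq0 -lt0n.
set P := (pos_index _)%:R in h *; move: h N0.
move: P (_%:R : R) (N%:R : R) => P e n h n0.
have -> : e = 2 * n - P by lra.
by field.
Qed.

Lemma ids_cvg_neg E theta : E < 0 ->
  (fun N => ids_box lambda alpha theta N E) @ \oo --> 1 / 2 - rho beta (strip_tau E).
Proof.
move=> E0; have := jacobi_growth irr (theta + beta) (strip_tau_per E) (@continuous_strip_tau E).
move=> /(lin_growthZ (- (1 / 2))) /(lin_growthD (lin_growthZ (1 / 2) lin_growth_nat)) /lin_growth_cvg.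
rewrite (_ : 1 / 2 * 1 + _ = 1 / 2 - rho beta (strip_tau E)); last by lra.
apply: cvg_trans; apply: near_eq_cvg; exists 1%N => // N /= N1.
have := eig_count_neg theta N E0; rewrite /ids_box.
move=> /(congr1 (fun n => n%:R : R)); rewrite 2!natrD natrM => h.
have N0 : N%:R != 0 :> R by rewrite pnatr_eq0 -lt0n.
set P := (pos_index _)%:R in h *; move: h N0.
move: P (_%:R : R) (N%:R : R) => P e n h n0.
have -> : e = n - P by lra.
by field.
Qed.

Lemma ids_box_mono theta N : {homo ids_box lambda alpha theta N : E E' / E <= E'}.
Proof.
move=> E E' EE'; rewrite /ids_box ler_wpM2r ?invr_ge0 // ler_nat.
apply/subset_leq_card/fintype.subsetP => j; rewrite !inE => /le_trans; apply.
by rewrite lecR.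
Qed.

Definition mosaic_val E theta (j : nat) : R :=
  E - (if odd j then 0 else 2 * lambda * cos (2 * pi * (theta + j%:R * alpha))).

(** The potential of the form with diagonal [sg E * mosaic_diag]; the sign is the one by which the
    Schur complement multiplies the form. *)
Definition mosaic_tau E : R -> R :=
  mathieu (Num.sg E) (Num.sg E * lambda * E) (Num.sg E * (2 - E ^+ 2)).

(** Duality turns the coupling [lambda * |E|] of the cosine into the hopping; dividing by it leaves
    [strip_tau], the two signs of [E] recombining into [E * lambda]. *)
Lemma mosaic_tau_rho E : E != 0 -> rho beta (mosaic_tau E) = rho beta (strip_tau E).
Proof.
move=> E0; rewrite /mosaic_tau mathieu_duality ?sgr_eq0 //; last first.
  by rewrite !mulf_neq0 ?sgr_eq0 // gt_eqF.
congr rho; apply/funext => x; rewrite /mathieu /strip_tau.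
have -> : `|Num.sg E * lambda * E| = Num.sg E * lambda * E.
  have -> : Num.sg E * lambda * E = lambda * `|E| by rewrite normrEsg; ring.
  by rewrite gtr0_norm // mulr_gt0 // normr_gt0.
move: (cos _) => c; case: (ltgtP E 0) E0 => // Es _.
  by rewrite (ltr0_sg Es); field; rewrite ?(lt_eqF Es) ?(gt_eqF lambda0).
by rewrite (gtr0_sg Es); field; rewrite ?(gt_eqF Es) ?(gt_eqF lambda0).
Qed.

Lemma lin_growth_div2 (u : nat -> R) l :
  lin_growth (fun n => 2 * u n) (2 * l) -> lin_growth u l.
Proof.
move=> h e e0; have [D hD] := h _ e0; exists D => n; have := hD n.
have := normr_ge0 (u n - l * n%:R).
by rewrite -mulrA -mulrBr normrM ger0_norm //; lra.
Qed.

Lemma half_growth (t : nat -> R) phi l :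
  lin_growth (fun N => rotate t (2 * N) 0) l ->
  lin_growth (fun n => rotate t n phi) (l / 2).
Proof.
move=> /lin_growth_half h; apply: (@lin_growth_close _ _ _ _ (`|phi| + 3) h) => n.
have h1 := rotate_defect t n phi.
have h2 := rotate_quasi_add t (2 * n./2) (odd n).
have h3 := rotate_step (fun j => t (2 * n./2 + j)%N) (odd n) 0.
have e : (2 * n./2 + odd n = n)%N by rewrite mul2n addnC odd_double_half.
rewrite e in h2; have := ler_norm phi; have := ler_norm (- phi); rewrite normrN.
have b1 : (odd n)%:R <= 1 :> R by case: (odd n).
move: (`|phi|) b1 h1 h2 h3 => m; rewrite !ler_norml; lra.
Qed.

Lemma mosaic_even E theta k : mosaic_val E theta (2 * k) =
  E - 2 * lambda * cos (2 * pi * (theta + k%:R * beta)).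
Proof.
rewrite /mosaic_val mul2n odd_double; congr (_ - _ * cos (_ * (_ + _))).
by rewrite -mul2n natrM; ring.
Qed.

Lemma mosaic_odd E theta k : mosaic_val E theta (2 * k).+1 = E.
Proof. by rewrite /mosaic_val mul2n /= odd_double /= subr0. Qed.

Lemma mosaic_growth_pos E theta phi : 0 < E ->
  lin_growth (fun n => rotate (mosaic_val E theta) n phi) (rho beta (strip_tau E) / 2).
Proof.
move=> E0; apply: half_growth; rewrite -mosaic_tau_rho ?gt_eqF //.
have h := jacobi_growth irr theta (mathieu_per (Num.sg E) (Num.sg E * lambda * E)
  (Num.sg E * (2 - E ^+ 2))) (@continuous_mathieu _ _ _ _).
apply: lin_growth_div2; have : lin_growth (fun N => 2 * rotate (mosaic_val E theta) (2 * N) 0)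
    (2 * rho beta (mosaic_tau E)).
  (* 4 from [jacobi_rotation] and 1 from [mosaic_pos]. *)
  apply: (@lin_growth_close _ _ _ _ 5 h) => N.
  have h1 := jacobi_rotation (mosaic_val E theta) (2 * N).
  have h2 := mosaic_pos (lt0r_neq0 E0) (mosaic_even E theta) (mosaic_odd E theta) N E0.
  have -> : (fun j => - orbit_val beta (mathieu (Num.sg E) (Num.sg E * lambda * E)
     (Num.sg E * (2 - E ^+ 2))) theta j) =
     mosaic_diag (fun k => 2 * lambda * cos (2 * pi * (theta + k%:R * beta))) E.
    apply/funext => k; rewrite /orbit_val /mathieu /mosaic_diag gtr0_sg // normr1.
    by move: (cos _) => c; field.
  by move: h1 h2; rewrite !ler_norml; lra.
exact.
Qed.

(** The additional [N] in the index of [2 * N] sites has density 1/2, that is, rotation 1/4 per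
    step. *)
Lemma mosaic_growth_neg E theta phi : E < 0 ->
  lin_growth (fun n => rotate (mosaic_val E theta) n phi)
    (1 / 4 + rho beta (strip_tau E) / 2).
Proof.
move=> E0; have -> : 1 / 4 + rho beta (strip_tau E) / 2 =
   (1 / 2 + rho beta (strip_tau E)) / 2 by lra.
apply: half_growth; rewrite -mosaic_tau_rho ?lt_eqF //.
have h := jacobi_growth irr theta (mathieu_per (Num.sg E) (Num.sg E * lambda * E)
  (Num.sg E * (2 - E ^+ 2))) (@continuous_mathieu _ _ _ _).
apply: lin_growth_div2; have : lin_growth (fun N => 2 * rotate (mosaic_val E theta) (2 * N) 0)
    (1 + 2 * rho beta (mosaic_tau E)).
  apply: (@lin_growth_close _ _ _ _ 5 (lin_growthD lin_growth_nat h)) => N.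
  have h1 := jacobi_rotation (mosaic_val E theta) (2 * N).
  have h2 := mosaic_neg (ltr0_neq0 E0) (mosaic_even E theta) (mosaic_odd E theta) N E0.
  have -> : (fun j => - orbit_val beta (mathieu (Num.sg E) (Num.sg E * lambda * E)
     (Num.sg E * (2 - E ^+ 2))) theta j) = (fun j =>
     - mosaic_diag (fun k => 2 * lambda * cos (2 * pi * (theta + k%:R * beta))) E j).
    apply/funext => k; rewrite /orbit_val /mathieu /mosaic_diag ltr0_sg // normrN1.
    by move: (cos _) => c; field.
  by move: h1 h2; rewrite !ler_norml; lra.
by rewrite mulrDr (_ : 2 * (1 / 2) = 1); last by lra.
Qed.

Lemma rotation_gap K : exists2 eta : R, 0 < eta &
  forall d, (0 < d < K)%N -> cos (2 * pi * (d%:R * beta)) <= 1 - eta.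
Proof.
elim: K => [|K [eta eta0 h]]; first by exists 1 => // d; rewrite ltn0 andbF.
have [->|K0] := posnP K; first by exists 1 => // d; case: d => [|[]].
have c1 : 0 < 1 - cos (2 * pi * (K%:R * beta)).
  rewrite subr_gt0 lt_neqAle cos_le1 andbT; apply/eqP => /cos_2pi_eq1[p hp].
  exact: (irr K0 hp).
exists (Num.min eta (1 - cos (2 * pi * (K%:R * beta)))); first by rewrite lt_min eta0.
move=> d /andP[d0]; rewrite ltnS leq_eqVlt => /orP[/eqP ->|dK].
  by rewrite lerBrDr -lerBrDl ge_min lexx orbT.
have := h d; rewrite d0 dK => /(_ isT); have : Num.min eta (1 - cos (2 * pi * (K%:R * beta))) <= eta.
  by rewrite ge_min lexx.
by lra.
Qed.

Lemma sparse_count (b : pred nat) D N :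
  (forall k m, (k < m < k + D)%N -> b k -> b m -> False) ->
  (D * \sum_(k < N) b k <= N + D)%N.
Proof.
(* The induction remembers the last hit [k]; the next one lies at least [D] further. *)
move=> h; suff : (\sum_(k < N) b k = 0)%N \/
    exists k, [/\ (k < N)%N, b k & (D * \sum_(k < N) b k <= k + D)%N].
  by case=> [->|[k [kN _ /leq_trans]]]; [rewrite muln0 | apply; rewrite leq_add2r ltnW].
elim: N => [|N IH]; first by left; rewrite big_ord0.
rewrite big_ord_recr /=; case: (boolP (b N)) => bN; last first.
  rewrite addn0; case: IH => [->|[k [kN bk hk]]]; [by left | right; exists k; split=> //].
  exact: ltnW.
right; exists N; split=> //; rewrite mulnDr muln1 leq_add2r.
case: IH => [->|[k [kN bk hk]]]; first by rewrite muln0.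
apply: leq_trans hk _; rewrite leqNgt; apply/negP => Nk.
by apply: (h k N) => //; rewrite kN.
Qed.

(* Two visits at distance [d < D] of the neighbourhood of 1/2 where
   [2 + 2 cos] is small would make [cos (2 pi d beta)] close to 1. *)
Lemma small_hop_sparse D : exists2 eta : R, 0 < eta & forall theta N,
  (D * \sum_(k < N) (2 + 2 * cos (2 * pi * (theta + k%:R * beta)) < eta)%R <= N + D)%N.
Proof.
have [e e0 he] := rotation_gap D.
exists (Num.min 1 (e / 4)) => [|theta N]; first by rewrite lt_min ltr01 divr_gt0.
apply: (@sparse_count (fun k => 2 + 2 * cos (2 * pi * (theta + k%:R * beta)) < Num.min 1 (e / 4))).
move=> k m /andP[km mk]; rewrite !lt_min => /andP[a1 a2] /andP[b1 b2].
have := he (m - k)%N; have -> : (0 < m - k < D)%N by lia.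
move=> /(_ isT).
have -> : 2 * pi * ((m - k)%:R * beta) =
    2 * pi * (theta + m%:R * beta) - 2 * pi * (theta + k%:R * beta).
  rewrite (natrB _ (ltnW km)) -mulrBr; congr (_ * _); ring.
rewrite cosB; have := cos2Dsin2 (2 * pi * (theta + m%:R * beta)).
have := cos2Dsin2 (2 * pi * (theta + k%:R * beta)).
have := cos_geN1 (2 * pi * (theta + k%:R * beta)).
have := cos_geN1 (2 * pi * (theta + m%:R * beta)).
move: a1 a2 b1 b2.
move: (cos _) (sin _) (cos (_ * (_ + m%:R * _))) (sin _) => c s c' s' a1 a2 b1 b2 n1 n2 h1 h2 h.
(* By [p1], [s s' >= - (s^2 + s'^2) / 2]; with the other three squares and products, [c c' + s s' >=
   1 - 2 (1 + c) - 2 (1 + c') > 1 - e / 2], against the gap [e]. *)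
have p1 : 0 <= (s + s') ^+ 2 by exact: sqr_ge0.
have p2 : 0 <= (1 + c) * (1 + c') by rewrite mulr_ge0 //; lra.
have p3 : 0 <= (1 + c) ^+ 2 by exact: sqr_ge0.
have p4 : 0 <= (1 + c') ^+ 2 by exact: sqr_ge0.
lra.
Qed.

Lemma jacobi_bound N d (x : 'rV[C]_N) :
  `|jacobi lambda d x - \sum_(k < N) d k * csqr (comp x k)| <=
    \sum_(k < N) 2 * lambda * csqr (comp x k).
Proof.
have -> : jacobi lambda d x - \sum_(k < N) d k * csqr (comp x k) =
    \sum_(k < N) 2 * lambda * cdot (comp x k) (comp x k.+1).
  by rewrite /jacobi -sumrB; apply: eq_bigr => k _; ring.
have sh := sum_shift (fun k => csqr (comp x k)) N.
rewrite (comp_out _ (leqnn N)) csqr0 addr0 in sh.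
apply: (@le_trans _ _ (\sum_(k < N) lambda * (csqr (comp x k) + csqr (comp x k.+1)))).
  apply: le_trans (ler_norm_sum _ _ _) _; apply: ler_sum => k _.
  case: (comp x k) (comp x k.+1) => a b [c e]; rewrite /csqr /cdot /=.
  rewrite ler_norml; apply/andP; split.
    have : 0 <= lambda * ((a + c) ^+ 2 + (b + e) ^+ 2).
      by apply: mulr_ge0; [exact: ltW | rewrite addr_ge0 ?sqr_ge0].
    by lra.
  have : 0 <= lambda * ((a - c) ^+ 2 + (b - e) ^+ 2).
    by apply: mulr_ge0; [exact: ltW | rewrite addr_ge0 ?sqr_ge0].
  by lra.
rewrite -mulr_sumr -[leRHS]mulr_sumr big_split /= sh.
have := mulr_ge0 (ltW lambda0) (csqr_ge0 (comp x 0)).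
by move: (\sum_(k < N) _) => S; lra.
Qed.

(* Off these sites the diagonal dominates the hopping terms. *)
Definition bad_sites (d : nat -> R) N : {set 'I_N} := [set k : 'I_N | `|d k| <= 2 * lambda]%SET.

Let coord N (k : 'I_N) (x : 'rV[C]_N) := comp x k.
Let coord_lin N (k : 'I_N) : linear_map (coord k : 'rV[C]_N -> C^o).
Proof. by move=> a u v; rewrite /coord comp_lin. Qed.

Lemma pos_index_ge_good d N :
  (forall k, 2 * lambda < `|d k| -> 0 < d k) ->
  (N <= pos_index (jacobi lambda d (N := N)) + #|bad_sites d N|)%N.
Proof.
move=> good; apply: (pos_index_ge_constr (@coord_lin N)) => [|x hx x0]; first by rewrite jacobi0.
have := jacobi_bound d x; rewrite ler_norml => /andP[lo _].
suff : 0 < \sum_(k < N) (d k - 2 * lambda) * csqr (comp x k).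
  by under eq_bigr do rewrite mulrBl; rewrite sumrB; lra.
have nn (k : 'I_N) : 0 <= (d k - 2 * lambda) * csqr (comp x k).
  have [kb|kb] := boolP (k \in bad_sites d N).
    by rewrite -/(coord k x) hx // csqr0 mulr0.
  rewrite inE -ltNge in kb; have dp := good _ kb; rewrite gtr0_norm // in kb.
  by rewrite mulr_ge0 ?csqr_ge0 // subr_ge0 ltW.
rewrite lt_neqAle sumr_ge0 // andbT eq_sym psumr_eq0 //.
apply: contra x0 => /allP h; apply/eqP/comp_eq0 => j jN.
have [kb|kb] := boolP (Ordinal jN \in bad_sites d N); first exact: (hx (Ordinal jN)).
have := h (Ordinal jN) (mem_index_enum _); rewrite mulf_eq0 csqr_eq0 => /orP[|/eqP //].
rewrite inE -ltNge /= in kb; have := good _ kb => dp.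
by rewrite gtr0_norm // in kb; rewrite subr_eq0 gt_eqF.
Qed.

Lemma pos_index_le_bad d N :
  (forall k, 2 * lambda < `|d k| -> d k < 0) ->
  (pos_index (jacobi lambda d (N := N)) <= #|bad_sites d N|)%N.
Proof.
move=> good; apply: (pos_index_le_constr (@coord_lin N)) => x hx.
have := jacobi_bound d x; rewrite ler_norml => /andP[_ up].
suff : \sum_(k < N) (d k + 2 * lambda) * csqr (comp x k) <= 0.
  by under eq_bigr do rewrite mulrDl; rewrite big_split /=; lra.
apply: sumr_le0 => k _.
have [kb|kb] := boolP (k \in bad_sites d N).
  by rewrite -/(coord k x) hx // csqr0 mulr0.
rewrite inE -ltNge in kb; have dk := good _ kb.
rewrite ltr0_norm // in kb; rewrite mulr_le0_ge0 ?csqr_ge0 //; lra.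
Qed.

Lemma rho_near0 eps : 0 < eps -> exists2 e, 0 < e & forall E, 0 < `|E| < e ->
  (0 < E -> 1 / 2 - eps <= rho beta (strip_tau E)) /\
  (E < 0 -> rho beta (strip_tau E) <= eps).
Proof.
move=> eps0; pose D := (Num.truncn eps^-1).+1.
have [eta eta0 heta] := small_hop_sparse D.
pose e := Num.min (Num.min 1 (2 * lambda)) (eta / (2 * lambda + 2)).
have l2 : 0 < 2 * lambda + 2 by rewrite addr_gt0 // mulr_gt0.
exists e; first by rewrite !lt_min ltr01 divr_gt0 // mulr_gt0.
move=> E /andP[E0 Ee]; have En0 : E != 0 by rewrite -normr_gt0.
have {Ee} [E1 El E2] : [/\ `|E| < 1, `|E| < 2 * lambda & `|E| * (2 * lambda + 2) < eta].
  by move: Ee; rewrite !lt_min ltr_pdivlMr // => /andP[/andP[]].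
pose d k := (2 + 2 * cos (2 * pi * site_arg alpha beta k)) / E - E.
pose c k := 2 + 2 * cos (2 * pi * (2 * beta + k%:R * beta)).
have dE k : d k = c k / E - E.
  rewrite /d /c; congr ((2 + 2 * cos (2 * pi * _)) / _ - _).
  by rewrite /site_arg -natr1; ring.
have c0 k : 0 <= c k by rewrite /c; have := cos_geN1 (2 * pi * (2 * beta + k%:R * beta)); lra.
have dnorm k : eta <= c k -> 2 * lambda < `|d k|.
  move=> ck; have h : 2 * lambda + 2 < c k / `|E| by rewrite ltr_pdivlMr // mulrC; lra.
  have -> : `|d k| = `|c k / `|E| - `|E| |.
    by rewrite dE; case: (ltgtP E 0) En0 => // Es _; [rewrite (ltr0_norm Es) invrN mulrN -opprD normrN | rewrite (gtr0_norm Es)].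
  by rewrite ger0_norm; lra.
have badle N : (D * #|bad_sites d N| <= N + D)%N.
  apply: leq_trans (heta (2 * beta) N); rewrite leq_mul2l; apply/orP; right.
  rewrite -sum1_card big_mkcond /=; apply: leq_sum => k _; rewrite inE -/(c k).
  by case: ltP => [_|/dnorm]; [case: ifP | rewrite ltNge => /negbTE ->].
have sgn k : 2 * lambda < `|d k| -> 0 < d k * E.
  move=> h; have dEE : d k * E = c k - E ^+ 2 by rewrite dE mulrBl divfK.
  rewrite dEE subr_gt0 ltNge; apply/negP => cE.
  have : `|d k| * `|E| <= `|E| * `|E|.
    by rewrite -!normrM dEE -expr2 ler0_norm ?subr_le0 // ger0_norm ?sqr_ge0 //; have := c0 k; lra.
  by rewrite ler_pM2r //; lra.
have Dn : 0 < D%:R :> R by rewrite ltr0n.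
have De : 1 <= eps * D%:R.
  by rewrite mulrC -ler_pdivrMr // mul1r ltW // truncnS_gt.
have bad_growth : lin_growth (fun N => D%:R^-1 * N%:R : R) D%:R^-1.
  by have := lin_growthZ D%:R^-1 (@lin_growth_nat R); rewrite mulr1.
have growth : lin_growth (fun N => (pos_index (jacobi lambda d (N := N)))%:R)
    (2 * rho beta (strip_tau E)).
  have := jacobi_growth irr (beta + beta) (strip_tau_per E) (@continuous_strip_tau E).
  by under eq_fun do rewrite -strip_jacobi //.
have badR N : (#|bad_sites d N|)%:R <= D%:R^-1 * N%:R + 1 :> R.
  rewrite -(ler_pM2l Dn) mulrDr mulr1 mulrA mulfV ?gt_eqF // mul1r -natrM -natrD ler_nat.
  exact: badle.
have Dl : D%:R^-1 <= eps by rewrite -div1r ler_pdivrMr.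
split=> Es.
  have good k : 2 * lambda < `|d k| -> 0 < d k by move/sgn; rewrite pmulr_lgt0.
  have : 1 <= 2 * rho beta (strip_tau E) + D%:R^-1.
    apply: (lin_growth_le lin_growth_nat (lin_growthD growth bad_growth)).
    exists 1 => K; exists K => //; have := pos_index_ge_good K good.
    by rewrite -(ler_nat R) natrD; have := badR K; lra.
  by lra.
have good k : 2 * lambda < `|d k| -> d k < 0 by move/sgn; rewrite nmulr_lgt0.
have : 2 * rho beta (strip_tau E) <= D%:R^-1.
  apply: (lin_growth_le growth bad_growth).
  exists 1 => K; exists K => //; have := pos_index_le_bad K good.
  by rewrite -(ler_nat R); have := badR K; lra.
have /andP[] := rho_bounds irr (strip_tau_per E) (@continuous_strip_tau E).
by lra.
Qed.

End Strip.

(** * The integrated density of states *)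

Section DensityOfStates.
Context {R : realType}.
Variables (lambda alpha : R).
Hypothesis lambda0 : 0 < lambda.
Local Notation beta := (2 * alpha).
Hypothesis irr : forall (d : nat) (p : int), (0 < d)%N -> d%:R * beta <> p%:~R.
Local Notation rho_E := (fun E : R => rho beta (strip_tau lambda E)).

(** The value at 0 is forced by continuity: [1 - 1/2] from the right and [1/2 - 0] from the left. *)
Definition dos (E : R) : R :=
  if 0 < E then 1 - rho_E E else if E < 0 then 1 / 2 - rho_E E else 1 / 2.

Lemma dos_pos E : 0 < E -> dos E = 1 - rho_E E.
Proof. by rewrite /dos => ->. Qed.

Lemma dos_neg E : E < 0 -> dos E = 1 / 2 - rho_E E.
Proof. by move=> E0; rewrite /dos ltNge (ltW E0) E0. Qed.

Lemma dos_near0 eps : 0 < eps -> exists2 e, 0 < e & forall E, `|E| < e ->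
  `|dos E - 1 / 2| <= eps.
Proof.
move=> eps0; have [e e0 he] := rho_near0 lambda0 irr eps0.
exists e => // E Ee; have [->|E0] := eqVneq E 0.
  by rewrite /dos ltxx subrr normr0 ltW.
have := he E; rewrite normr_gt0 E0 Ee => /(_ isT) [hp hn].
have /andP[r0 r1] := rho_bounds irr (strip_tau_per lambda E) (@continuous_strip_tau _ lambda E).
case: (ltgtP E 0) E0 => // Es _.
  by rewrite dos_neg // ler_norml; have := hn Es; lra.
by rewrite dos_pos // ler_norml; have := hp Es; lra.
Qed.

Lemma ids_cvg theta E : ids_box lambda alpha theta N E @[N --> \oo] --> dos E.
Proof.
case: (ltgtP E 0) => [E0|E0|->].
- by rewrite dos_neg //; exact: ids_cvg_neg.
- by rewrite dos_pos //; exact: ids_cvg_pos.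
(* At [E = 0] the Schur complement breaks down; monotonicity squeezes the count between those at
   [- e / 2] and [e / 2]. *)
apply/cvgrPdist_le => eps eps0; have e20 : 0 < eps / 2 by rewrite divr_gt0.
have [e e0 he] := dos_near0 e20.
have d0 : dos 0 = 1 / 2 by rewrite /dos ltxx.
have e2 : 0 < e / 2 by rewrite divr_gt0.
have en : - (e / 2) < 0 by rewrite oppr_lt0.
have h1 : `|dos (e / 2) - 1 / 2| <= eps / 2 by apply: he; rewrite gtr0_norm //; lra.
have h2 : `|dos (- (e / 2)) - 1 / 2| <= eps / 2.
  by apply: he; rewrite normrN gtr0_norm //; lra.
have c1 := ids_cvg_pos lambda0 irr theta e2; rewrite -dos_pos // in c1.
have c2 := ids_cvg_neg lambda0 irr theta en; rewrite -dos_neg // in c2.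
move/cvgrPdist_le : c1 => /(_ _ e20) c1; move/cvgrPdist_le : c2 => /(_ _ e20) c2.
near=> N.
have m1 : ids_box lambda alpha theta N 0 <= ids_box lambda alpha theta N (e / 2).
  by apply: ids_box_mono; exact: ltW.
have m2 : ids_box lambda alpha theta N (- (e / 2)) <= ids_box lambda alpha theta N 0.
  by apply: ids_box_mono; exact: ltW.
have b1 : `|dos (e / 2) - ids_box lambda alpha theta N (e / 2)| <= eps / 2 by near: N.
have b2 : `|dos (- (e / 2)) - ids_box lambda alpha theta N (- (e / 2))| <= eps / 2 by near: N.
rewrite d0; move: m1 m2 h1 h2 b1 b2; rewrite !ler_norml; lra.
Unshelve. all: by end_near. Qed.

Lemma dos_mono : {homo dos : E E' / E <= E'}.
Proof.
move=> E E' EE'; apply: (@ler_cvg_to _ _ _ _ (fun N => ids_box lambda alpha 0 N E)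
  (fun N => ids_box lambda alpha 0 N E') _ _ (@ids_cvg 0 E) (@ids_cvg 0 E')).
by near=> N; exact: ids_box_mono.
Unshelve. all: by end_near. Qed.

Lemma strip_tau_dist E E' x : E != 0 -> E' != 0 ->
  `|strip_tau lambda E x - strip_tau lambda E' x| <=
    `|E - E'| / lambda + 4 / lambda * `|E^-1 - E'^-1|.
Proof.
move=> E0 E'0; have -> : strip_tau lambda E x - strip_tau lambda E' x =
   (E - E') / lambda - (2 + 2 * cos (2 * pi * x)) / lambda * (E^-1 - E'^-1).
  by rewrite /strip_tau; move: (cos _) => c; field; rewrite E0 E'0 gt_eqF.
apply: le_trans (ler_normB _ _) _; rewrite !normrM normfV [`|lambda|]gtr0_norm //.
rewrite lerD2l ler_wpM2r // ler_pdivrMr // divfK ?gt_eqF //.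
by have := cos_le1 (2 * pi * x); have := cos_geN1 (2 * pi * x); rewrite ler_norml; lra.
Qed.

Lemma continuous_rho E : E != 0 -> rho_E x @[x --> E] --> rho_E E.
Proof.
move=> E0; apply/cvgrPdist_le => eps eps0.
have [B hB] := periodic_bounded (strip_tau_per lambda E) (@continuous_strip_tau _ lambda E).
have [d d0 hd] := rho_close irr (B + 1) eps0.
have c : (`|E - x| / lambda + 4 / lambda * `|E^-1 - x^-1|) @[x --> E] -->
   `|E - E| / lambda + 4 / lambda * `|E^-1 - E^-1|.
  apply: cvgD.
    by apply: cvgMl; apply: cvg_norm; apply: cvgB; [exact: cvg_cst | exact: cvg_id].
  apply: cvgMr; apply: cvg_norm; apply: cvgB; first exact: cvg_cst.
  by apply: cvgV => //; exact: cvg_id.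
rewrite !subrr normr0 mulr0 mul0r addr0 in c.
have m0 : 0 < Num.min d 1 by rewrite lt_min d0 ltr01.
have near1 : \forall x \near E, `|E - x| / lambda + 4 / lambda * `|E^-1 - x^-1| < Num.min d 1.
  by apply: cvgr_lt c _ m0.
have near2 : \forall x \near E, x != 0.
  apply/nbhs_ballP; exists `|E|; rewrite /= ?normr_gt0 // => x; rewrite /ball /=.
  by apply: contraTneq => ->; rewrite subr0 ltxx.
near=> x.
have x0 : x != 0 by near: x.
have hx : `|E - x| / lambda + 4 / lambda * `|E^-1 - x^-1| < Num.min d 1 by near: x.
have dist y := le_lt_trans (strip_tau_dist y E0 x0) hx.
apply: hd => [||||y|y|y].
- exact: strip_tau_per.
- exact: continuous_strip_tau.
- exact: strip_tau_per.
- exact: continuous_strip_tau.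
- by apply: le_trans (hB y) _; rewrite lerDl.
- have := hB y; have := dist y; rewrite lt_min => /andP[_].
  by rewrite ltr_norml !ler_norml; lra.
by have := dist y; rewrite lt_min => /andP[].
Unshelve. all: by end_near. Qed.

Lemma continuous_dos : continuous dos.
Proof.
move=> E; case: (ltgtP E 0) => [E0|E0|->].
- rewrite /continuous_at dos_neg //.
  have : (1 / 2 - rho_E x) @[x --> E] --> 1 / 2 - rho_E E.
    by apply: cvgB; [exact: cvg_cst | apply: continuous_rho; rewrite lt_eqF].
  apply: cvg_trans; apply: near_eq_cvg; near=> x; rewrite dos_neg //.
  by near: x; exact: lt_nbhsl.
- rewrite /continuous_at dos_pos //.
  have : (1 - rho_E x) @[x --> E] --> 1 - rho_E E.
    by apply: cvgB; [exact: cvg_cst | apply: continuous_rho; rewrite gt_eqF].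
  apply: cvg_trans; apply: near_eq_cvg; near=> x; rewrite dos_pos //.
  by near: x; exact: lt_nbhsr.
apply/cvgrPdist_le => eps eps0; have [e e0 he] := dos_near0 eps0.
near=> x; rewrite {1}/dos ltxx distrC; apply: he.
near: x; exists e => //= y /=; rewrite sub0r normrN.
Unshelve. all: by end_near. Qed.

Lemma is_IDS_dos : is_IDS lambda alpha dos.
Proof.
split; [exact: continuous_dos | exact: dos_mono |].
by apply: aeW => theta E; exact: (@ids_cvg theta E).
Qed.

Lemma is_IDS_unique n : is_IDS lambda alpha n -> n = dos.
Proof.
move=> [_ _ hae].
have [theta hn] : exists theta : R, forall E : R,
    ids_box lambda alpha theta N E @[N --> \oo] --> n E.
  (* If every [theta] failed, the exceptional null set would be the whole line, whose measure is at
     least that of [[0, 1]]. *)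
  apply: contrapT => /forallNP no.
  have [A [mA A0 hA]] := hae.
  have AT : A = setT by apply/seteqP; split=> // x _; apply: hA => /=; exact: no.
  move: A0; rewrite AT => h.
  have : ((lebesgue_measure `[0%R, 1%R]%classic : \bar R) <= lebesgue_measure [set: R])%E.
    by apply: le_measure; rewrite ?inE //.
  by rewrite h lebesgue_measure_itv /= lte_fin ltr01 oppr0 adde0 lee_fin ler10.
by apply/funext => E; have := @ids_cvg theta E; have := hn E; exact: cvg_unique.
Qed.

Lemma IDS_dos : IDS lambda alpha = dos.
Proof. by apply: is_IDS_unique; apply: (@getPex _ [set n | is_IDS lambda alpha n]); exists dos; exact: is_IDS_dos. Qed.

End DensityOfStates.

Lemma irrational_double (R : realType) (alpha : R) : irrational alpha ->
  forall (d : nat) (p : int), (0 < d)%N -> d%:R * (2 * alpha) <> p%:~R.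
Proof.
move=> ai d p d0 e; apply: ai; apply/rationalP; exists p, (2 * d)%N.
have d0R : d%:R != 0 :> R by rewrite pnatr_eq0 -lt0n.
by rewrite -e natrM; field.
Qed.

(** * Lifts over the torus *)

Section Lifts.
Context {R : realType}.

Lemma continuous_pair (S X Y : topologicalType) (u : S -> X) (v : S -> Y) :
  continuous u -> continuous v -> continuous (fun s => (u s, v s)).
Proof. by move=> cu cv s; exact: cvg_pair (cu s) (cv s). Qed.

Lemma enorm_cos_sin (a b : R) (u : 'cV[R]_2) :
  u 0 0 = a -> u 1 0 = b -> enorm u = Num.sqrt (a ^+ 2 + b ^+ 2).
Proof.
by move=> ua ub; rewrite /enorm big_ord_recl big_ord1 ua -ub; congr (Num.sqrt (_ + u _ 0 ^+ 2)); apply/val_inj.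
Qed.

Lemma schrodinger_circle (t phi : R) :
  let v := schrodinger t *m circle_pt phi in
  v 0 0 = t * cos (2 * pi * phi) - sin (2 * pi * phi) /\ v 1 0 = cos (2 * pi * phi).
Proof.
by rewrite /= !mxE !big_ord_recl !big_ord0 !mxE /=; split; rewrite ?mulN1r ?mul1r ?mul0r ?addr0.
Qed.

Lemma schr_lift_circle (t phi : R) :
  circle_pt (schr_lift t phi) = proj_act (schrodinger t) (circle_pt phi).
Proof.
have [v0 v1] := schrodinger_circle t phi; have [c s] := schr_lift_cos_sin t phi.
have nE := enorm_cos_sin v0 v1; rewrite -/(schr_norm t phi) in nE.
apply/matrixP => i j; rewrite [j]ord1 [LHS]mxE /proj_act nE [RHS]mxE [RHS]mulrC.
have [->|i0] := eqVneq i 0; first by rewrite v0 c.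
have -> : i = 1 by apply/val_inj; case: i i0 => -[|[|]].
by rewrite v1 s.
Qed.

Lemma schrodinger_lift (X : topologicalType) (tau : X -> R) : continuous tau ->
  lifts (fun x => schrodinger (tau x)) (fun p => schr_lift (tau p.1) p.2).
Proof.
move=> ct; split=> [|x phi|x s t|x phi] /=.
- move=> p; apply: (@continuous_comp _ _ _ (fun p : X * R => (tau p.1, p.2))
     (fun q : R * R => schr_lift q.1 q.2)).
    apply: (@continuous_pair _ _ _ (fun p : X * R => tau p.1) snd) => q; last exact: cvg_snd.
    by apply: (@continuous_comp _ _ _ fst tau); [exact: cvg_fst | exact: ct].
  exact: continuous_schr_lift.
- exact: (schr_liftDz _ _ 1).
- exact: schr_lift_lt.
- exact: schr_lift_circle.
Qed.

Lemma circle_pt_inj (x y : R) : circle_pt x = circle_pt y ->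
  exists k : int, x = y + k%:~R.
Proof.
move=> e; apply: cos_2pi_inj.
  by have /(congr1 (fun u : 'cV[R]_2 => u 0 0)) := e; rewrite !mxE.
by have /(congr1 (fun u : 'cV[R]_2 => u 1 0)) := e; rewrite !mxE.
Qed.

(** Between two distinct integers the function would take a half-integer value. *)
Lemma continuous_int_const (D : R -> R) : continuous D ->
  (forall s, exists k : int, D s = k%:~R) -> forall s t, D s = D t.
Proof.
move=> cD hD; suff H s t : s <= t -> D s = D t.
  by move=> s t; case: (leP s t) => [/H|/ltW/H].
move=> st; have [k hk] := hD s; have [m hm] := hD t.
apply: contrapT => /eqP; rewrite hk hm eqr_int => km.
pose v := Num.min (D s) (D t) + 1 / 2.
have hv : Num.min (D s) (D t) <= v <= Num.max (D s) (D t).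
  rewrite /v hk hm; case: (ltgtP k m) km => // km _; have := km;
    rewrite -lezD1 -(ler_int R) intrD => h.
    by rewrite /Order.min /Order.max ltr_int km; lra.
  by rewrite /Order.min /Order.max ltr_int (ltNge k) (ltW km) /=; lra.
have [c _ hc] := IVT st (continuous_subspaceT cD) hv.
have [j hj] := hD c; move: hc; rewrite hj /v hk hm.
have -> : Num.min k%:~R m%:~R = (Num.min k m)%:~R :> R.
  by rewrite !minEle ler_int; case: ifP.
move: (Num.min k m) => n e.
have [jn|jn] := lerP j n.
  by move: jn; rewrite -(ler_int R); lra.
by move: jn; rewrite -lezD1 -(ler_int R) intrD; lra.
Qed.

Section TwoLifts.
Variables (X : topologicalType) (A : X -> 'M[R]_2) (f g : X * R -> R).
Hypotheses (Lf : lifts A f) (Lg : lifts A g).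

Lemma lifts_diff_int p : exists k : int, g p - f p = k%:~R.
Proof.
case: Lf Lg p => [_ _ _ hf] [_ _ _ hg] [x phi].
have [k hk] : exists k : int, g (x, phi) = f (x, phi) + k%:~R.
  by apply: circle_pt_inj; rewrite hf hg.
by exists k; rewrite hk addrC addKr.
Qed.

Lemma lifts_diff_path (gam : R -> X * R) : continuous gam ->
  forall s t, g (gam s) - f (gam s) = g (gam t) - f (gam t).
Proof.
move=> cg; apply: (@continuous_int_const (fun s => g (gam s) - f (gam s))) => s.
  case: Lf Lg => [cf _ _ _] [cg' _ _ _].
  exact: cvgB (continuous_comp (cg s) (cg' (gam s))) (continuous_comp (cg s) (cf (gam s))).
exact: lifts_diff_int.
Qed.

Lemma lifts_diff_fiber x phi psi : g (x, phi) - f (x, phi) = g (x, psi) - f (x, psi).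
Proof.
apply: (@lifts_diff_path (fun s => (x, s))).
by apply: continuous_pair => s; [exact: cvg_cst | exact: cvg_id].
Qed.

End TwoLifts.

Lemma lift_iter_shift (X : Type) (T : X -> X) (f g : X * R -> R) (k : int) n x phi :
  (forall x phi (m : int), f (x, phi + m%:~R) = f (x, phi) + m%:~R) ->
  (forall p, g p = f p + k%:~R) ->
  lift_iter T g n x phi = lift_iter T f n x phi + n%:R * k%:~R.
Proof.
move=> fD fg; rewrite /lift_iter.
suff : iter n (fun p => (T p.1, g p)) (x, phi) =
  ((iter n (fun p => (T p.1, f p)) (x, phi)).1,
   (iter n (fun p => (T p.1, f p)) (x, phi)).2 + n%:R * k%:~R) by move=> ->.
elim: n => [|n IH] /=; first by rewrite mul0r addr0.
rewrite IH /= fg; case: (iter n _ _) => y psi /=.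
have -> : n%:R * k%:~R = (n%:Z * k)%:~R :> R by rewrite intrM.
by rewrite fD -natr1; congr (_, _); rewrite intrM /=; ring.
Qed.

Lemma lift_iter_rotate (X : Type) (T : X -> X) (tau : X -> R) n x phi :
  lift_iter T (fun p => schr_lift (tau p.1) p.2) n x phi =
  rotate (fun j => tau (iter j T x)) n phi.
Proof.
rewrite /lift_iter; suff -> : iter n (fun p : X * R => (T p.1, schr_lift (tau p.1) p.2)) (x, phi) =
  (iter n T x, rotate (fun j => tau (iter j T x)) n phi) by [].
by elim: n => //= n ->.
Qed.

(** All admissible lifts differ from [f] by an integer constant, so the explicit lift decides the
    number; [x0] provides a point at which limits are compared. *)
Lemma rotation_numberE (X : Type) (x0 : X) (T : X -> X) (L : set (X * R -> R))
    (tau : X -> R) (r : R) (f := fun p : X * R => schr_lift (tau p.1) p.2) :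
  0 <= r <= 1 / 2 -> L f ->
  (forall g, L g -> exists k : int, forall p, g p = f p + k%:~R) ->
  (forall x phi, lin_growth (fun n => rotate (fun j => tau (iter j T x)) n phi) r) ->
  rotation_number T L = r.
Proof.
move=> r01 Lf Lu gr.
have cf x phi : (lift_iter T f n x phi - phi) / n%:R @[n --> \oo] --> r.
  apply: lin_growth_cvg; apply: (@lin_growth_close _ _ _ _ (`|phi|) (gr x phi)) => n.
  by rewrite lift_iter_rotate addrAC subrr sub0r normrN.
pose S := [set r : R | 0 <= r <= 1 / 2 /\
    exists f, L f /\ exists k : int, forall x phi,
      (lift_iter T f n x phi - phi) / n%:R @[n --> \oo] --> r + k%:~R].
have Sr : S r.
  split=> //; exists f; split=> //; exists 0 => x phi; rewrite addr0; exact: cf.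
suff uniq r' : S r' -> r' = r by apply: uniq; apply: (@getPex _ S); exists r.
move=> [r'01 [g [Lg [k hk]]]]; have [m hm] := Lu g Lg.
have cg : (lift_iter T g n x0 0 - 0) / n%:R @[n --> \oo] --> r + m%:~R.
  have : ((lift_iter T f n x0 0 - 0) / n%:R + m%:~R) @[n --> \oo] --> r + m%:~R.
    by apply: cvgD; [exact: cf | exact: cvg_cst].
  apply: cvg_trans; apply: near_eq_cvg; exists 1%N => // n /= n1.
  rewrite (@lift_iter_shift _ T f g m) //; last by move=> x phi j; exact: schr_liftDz.
  have n0 : n%:R != 0 :> R by rewrite pnatr_eq0 -lt0n.
  by field.
have e : r' + k%:~R = r + m%:~R by move: (hk x0 0) cg; exact: cvg_unique.
(* Both representatives lie in [[0, 1/2]], so their difference cannot be a nonzero integer. *)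
have [km|km|km] := ltgtP k m.
- by move: km; rewrite -lezD1 -(ler_int R) intrD; lra.
- by move: km; rewrite -lezD1 -(ler_int R) intrD; lra.
- by move: e; rewrite km; lra.
Qed.

End Lifts.

Section Torus.
Context {R : realType}.
Local Notation tpi := (\pi_(torus R)%qT : R -> torus R).

Lemma torus_eqP (x y : R) : tpi x = tpi y <-> exists k : int, x = y + k%:~R.
Proof.
have -> : (tpi x = tpi y) <-> (x - y \in Num.int).
  rewrite -[_ \in Num.int]/(Quotient.equiv (Zsub R) x y).
  by split=> h; apply/(@eqquotP R (Quotient.equiv (Zsub R)) (Quotient.quot (Zsub R))).
split=> [/intrP[k hk]|[k ->]]; first by exists k; rewrite -hk addrC subrK.
by rewrite addrC addKr intr_int.
Qed.

Lemma repr_tpi (x : R) : exists k : int, repr (tpi x) = x + k%:~R.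
Proof. by apply/torus_eqP; rewrite reprK. Qed.

Lemma repr_iter_rot (a : R) n (x : torus R) :
  exists k : int, repr (iter n (rot a) x) = repr x + n%:R * a + k%:~R.
Proof.
elim: n => [|n [k hk]]; first by exists 0; rewrite mul0r !addr0.
have [m hm] := repr_tpi (repr (iter n (rot a) x) + a).
exists (k + m); rewrite /= /rot hm hk intrD -natr1; ring.
Qed.

Lemma continuous_torus (h : R -> R) : continuous h -> (forall x, h (x + 1) = h x) ->
  continuous (fun x : torus R => h (repr x)).
Proof.
move=> ch per; apply: (@repr_comp_continuous R _ _ h) => // x y /eqP/torus_eqP[k ->].
by apply/eqP; rewrite periodic_addz.
Qed.

(** The projection of the real line is a path through the whole torus, along which the integer
    difference is constant. *)
Lemma torus_lifts_unique (A : torus R -> 'M[R]_2) (f g : torus R * R -> R) :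
  lifts A f -> lifts A g -> exists k : int, forall p, g p = f p + k%:~R.
Proof.
move=> Lf Lg; have [k hk] := lifts_diff_int Lf Lg (tpi 0, 0).
exists k => -[x phi]; rewrite -hk (lifts_diff_fiber Lf Lg _ 0 phi).
suff -> : g (tpi 0, phi) - f (tpi 0, phi) = g (x, phi) - f (x, phi) by rewrite addrC subrK.
rewrite -[x]reprK; apply: (lifts_diff_path Lf Lg (gam := fun s => (tpi s, phi))).
by apply: continuous_pair => s; [exact: pi_continuous | exact: cvg_cst].
Qed.

End Torus.

(** * Identification of both rotation numbers and the limits at 0 *)

Section Main.
Context {R : realType}.
Variables (lambda alpha : R).
Hypothesis lambda0 : 0 < lambda.
Local Notation beta := (2 * alpha).
Hypothesis irr : forall (d : nat) (p : int), (0 < d)%N -> d%:R * beta <> p%:~R.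
Local Notation rho_E E := (rho beta (strip_tau lambda E)).
Local Notation tpi := (\pi_(torus R)%qT : R -> torus R).

Lemma rho_stripE E : rho_strip lambda alpha E = rho_E E.
Proof.
have ct : continuous (fun x : torus R => strip_tau lambda E (repr x)).
  exact: continuous_torus (@continuous_strip_tau _ lambda E) (strip_tau_per lambda E).
have Lf := schrodinger_lift ct.
apply: (@rotation_numberE R _ (tpi 0) _ _ (fun x => strip_tau lambda E (repr x))) => //.
- by have := rho_bounds irr (strip_tau_per lambda E) (@continuous_strip_tau _ lambda E).
- by move=> g Lg; exact: torus_lifts_unique Lf Lg.
move=> x phi.
have := rotate_growth irr (repr x) phi (strip_tau_per lambda E) (@continuous_strip_tau _ lambda E).
congr (lin_growth _ _); apply/funext => n; apply: eq_rotate => j _.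
have [k ->] := repr_iter_rot beta j x.
by rewrite periodic_addz //; exact: strip_tau_per.
Qed.

Definition mosaic_pot E (p : torus R * Z2) : R := E - v_mosaic lambda p.

Lemma continuous_mosaic_pot E : continuous (mosaic_pot E).
Proof.
move=> [x i]; apply: cvgB; first exact: cvg_cst.
have c0 : continuous (fun p : torus R * Z2 => cos (2 * pi * repr p.1)).
  move=> q; apply: (@continuous_comp _ _ _ fst (fun y : torus R => cos (2 * pi * repr y))).
    exact: cvg_fst.
  exact: (continuous_torus (@continuous_cos2pi R) (@cos_per R)).
have cx : (fun p : torus R * Z2 => 2 * lambda * cos (2 * pi * repr p.1)) @ (x, i)
    --> 2 * lambda * cos (2 * pi * repr x).
  exact: cvgMr (c0 (x, i)).
have near_i : \forall p \near (x, i), p.2 = i.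
  by exists (setT, [set i]); [split=> /=; [exact: filterT | exact: discrete_set1] | move=> p []].
rewrite /v_mosaic /=; have [i0|i0] := eqVneq (i : 'Z_2) 0.
  apply: cvg_trans cx; apply: near_eq_cvg; near=> p.
  have pe : p.2 = i by near: p.
  by rewrite pe i0 eqxx.
apply: cvg_trans (@cvg_cst _ (0 : R) _ (nbhs (x, i)) _); apply: near_eq_cvg; near=> p.
have pe : p.2 = i by near: p.
by rewrite pe (negbTE i0).
Unshelve. all: by end_near. Qed.

Lemma iter_skew j (x : torus R) (i : Z2) :
  iter j (T_skew alpha) (x, i) = (iter j (rot alpha) x, (i : 'Z_2) + j%:R).
Proof.
elim: j => [|j IH]; first by rewrite addr0.
by rewrite /= IH /T_skew /= -natr1 addrA.
Qed.

Lemma Z2_natr_eq0 j : ((j%:R : 'Z_2) == 0) = ~~ odd j.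
Proof. by rewrite -val_eqE /= val_Zp_nat //= modn2; case: (odd j). Qed.

(** An orbit starting on the second circle enters the mosaic sequence at index 1, so index 0 sits
    one rotation earlier, at [repr x - alpha]. *)
Lemma mosaic_potE E j (x : torus R) (i : Z2) :
  mosaic_pot E (iter j (T_skew alpha) (x, i)) =
  if (i : 'Z_2) == 0 then mosaic_val lambda alpha E (repr x) j
  else mosaic_val lambda alpha E (repr x - alpha) (1 + j).
Proof.
rewrite iter_skew /mosaic_pot /v_mosaic /mosaic_val /=.
have [k hk] := repr_iter_rot alpha j x; rewrite hk cos_2pi_addz.
have [->|i0] := eqVneq (i : 'Z_2) 0.
  by rewrite add0r Z2_natr_eq0 if_neg.
have -> : (i : 'Z_2) = 1 by apply/val_inj; case: (i) i0 => -[|[|]].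
have -> : repr x - alpha + (1 + j)%:R * alpha = repr x + j%:R * alpha.
  by rewrite natrD; ring.
by rewrite nat1r Z2_natr_eq0 /= add0n; case: (odd j).
Qed.

Lemma mosaic_rotate_growth E l :
  (forall theta phi, lin_growth (fun n => rotate (mosaic_val lambda alpha E theta) n phi) l) ->
  forall x phi, lin_growth
    (fun n => rotate (fun j => mosaic_pot E (iter j (T_skew alpha) x)) n phi) l.
Proof.
move=> gr [x i] phi; have [i0|i0] := boolP ((i : 'Z_2) == 0).
  have := gr (repr x) phi; congr (lin_growth _ _); apply/funext => n.
  by apply: eq_rotate => j _; rewrite mosaic_potE i0.
have gr0 := gr (repr x - alpha) 0.
set t := mosaic_val lambda alpha E (repr x - alpha) in gr0.
(* One unit each for the starting angle [phi], the cut after the first step, the first step itself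
   and the one step too many at the end. *)
apply: (@lin_growth_close _ _ _ _ (`|phi| + 4) gr0) => n.
have -> : rotate (fun j => mosaic_pot E (iter j (T_skew alpha) (x, i))) n phi =
    rotate (fun j => t (1 + j)%N) n phi.
  by apply: eq_rotate => j _; rewrite mosaic_potE (negbTE i0).
have h1 := rotate_defect (fun j => t (1 + j)%N) n phi.
have h2 := rotate_quasi_add t 1 n.
have h3 := rotate_step t 1 0.
have h4 := schr_lift_step (t n) (rotate t n 0).
rewrite add1n /= in h2 h3; have := ler_norm phi; have := ler_norm (- phi); rewrite normrN.
by move: (`|phi|) h1 h2 h3 h4 => m; rewrite !ler_norml; lra.
Qed.

(** The angles -1/4 and 1/4 go to 0 and 1/2 for every [t], and 0 lies between them; hence the
    explicit lift is coherent over both circles. *)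
Lemma floor_schr_lift0 (t : R) : Num.floor (schr_lift t 0) = 0.
Proof.
apply/floor_def; rewrite /= add0r.
have := schr_lift_half t (- (1 / 4)); have -> : - (1 / 4) + 1 / 2 = 1 / 4 :> R by lra.
rewrite schr_lift_quarter.
have h1 : schr_lift t (- (1 / 4)) < schr_lift t 0 by apply: schr_lift_lt; lra.
have := @schr_lift_lt _ t 0 (1 / 4); rewrite schr_lift_quarter.
by move=> h2 h3; have := h2 ltac:(lra); lra.
Qed.

(** On each fibre the difference from [f] is an integer constant; comparing integer parts at angle 0
    makes it the same over all base points, across the two circles as well. *)
Lemma mosaic_lifts_unique E (f := fun p => schr_lift (mosaic_pot E p.1) p.2) g :
  coherent_lifts (S_mosaic lambda E) g -> exists k : int, forall p, g p = f p + k%:~R.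
Proof.
move=> [Lg cg].
have Lf : lifts (S_mosaic lambda E) f := schrodinger_lift (@continuous_mosaic_pot E).
have ff p : Num.floor (f (p, 0)) = 0 := floor_schr_lift0 _.
have fk p (n : int) : Num.floor (f (p, 0) + n%:~R) = n.
  by rewrite floorDrz ?intr_int // intrKfloor ff add0r.
have [k hk] := lifts_diff_int Lf Lg ((tpi 0, 0 : Z2), 0).
exists k => -[[x i] phi].
have gf0 y (j : Z2) : g ((y, j), 0) - f ((y, j), 0) = k%:~R.
  have [m hm] := lifts_diff_int Lf Lg ((y, j), 0).
  have e1 : g ((tpi 0, 0 : Z2), 0) = f ((tpi 0, 0 : Z2), 0) + k%:~R by rewrite -hk addrC subrK.
  have e2 : g ((y, j), 0) = f ((y, j), 0) + m%:~R by rewrite -hm addrC subrK.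
  have km := cg (tpi 0, 0 : Z2) (y, j); rewrite e1 e2 !fk in km.
  by rewrite hm km.
have := lifts_diff_fiber Lf Lg (x, i) phi 0; rewrite gf0 => e.
by rewrite -e addrC subrK.
Qed.

Lemma rho_mosaicE E r : 0 <= r <= 1 / 2 ->
  (forall theta phi, lin_growth (fun n => rotate (mosaic_val lambda alpha E theta) n phi) r) ->
  rho_mosaic lambda alpha E = r.
Proof.
move=> r01 gr.
apply: (@rotation_numberE R _ (tpi 0, 0 : Z2) _ _ (mosaic_pot E)) => //.
- split; first exact: (schrodinger_lift (@continuous_mosaic_pot E)).
  by move=> x y; rewrite !floor_schr_lift0.
- exact: mosaic_lifts_unique.
exact: mosaic_rotate_growth.
Qed.

Lemma rho_mosaic_pos E : 0 < E -> rho_mosaic lambda alpha E = rho_E E / 2.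
Proof.
move=> E0; apply: rho_mosaicE => [|theta phi]; last exact: mosaic_growth_pos.
have := rho_bounds irr (strip_tau_per lambda E) (@continuous_strip_tau _ lambda E); lra.
Qed.

Lemma rho_mosaic_neg E : E < 0 -> rho_mosaic lambda alpha E = 1 / 4 + rho_E E / 2.
Proof.
move=> E0; apply: rho_mosaicE => [|theta phi]; last exact: mosaic_growth_neg.
have := rho_bounds irr (strip_tau_per lambda E) (@continuous_strip_tau _ lambda E); lra.
Qed.

Lemma rho_at_right : rho_strip lambda alpha E @[E --> 0^'+] --> (1 / 2 : R).
Proof.
apply/cvgrPdist_le => eps eps0; have [e e0 he] := rho_near0 lambda0 irr eps0.
near=> E; have E0 : 0 < E by [].
have := rho_bounds irr (strip_tau_per lambda E) (@continuous_strip_tau _ lambda E).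
have [|h _] := he E; first by rewrite gtr0_norm // E0 /=; near: E; exact: nbhs_right_lt.
by rewrite rho_stripE ler_norml; have := h E0; lra.
Unshelve. all: by end_near. Qed.

Lemma rho_at_left : rho_strip lambda alpha E @[E --> 0^'-] --> (0 : R).
Proof.
apply/cvgrPdist_le => eps eps0; have [e e0 he] := rho_near0 lambda0 irr eps0.
near=> E; have E0 : E < 0 by [].
have := rho_bounds irr (strip_tau_per lambda E) (@continuous_strip_tau _ lambda E).
have [|_ h] := he E.
  rewrite ltr0_norm // oppr_gt0 E0 /= ltrNl; near: E; apply: nbhs_left_gt.
  by rewrite oppr_lt0.
by rewrite rho_stripE ler_norml; have := h E0; lra.
Unshelve. all: by end_near. Qed.

End Main.

Theorem theorem4p2 (R : realType) (lambda alpha : R)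
    (lambda_gt0 : 0 < lambda) (alpha_irr : irrational alpha) :
  [/\ (forall E : R, 0 < E ->
         IDS lambda alpha E = 1 - rho_strip lambda alpha E),
      (forall E : R, E < 0 ->
         IDS lambda alpha E = 1 / 2 - rho_strip lambda alpha E),
      (exists rp rm : R,
         [/\ rho_strip lambda alpha E @[E --> 0^'+] --> rp,
             rho_strip lambda alpha E @[E --> 0^'-] --> rm &
             rp = 1 / 2 + rm]),
      (forall E : R, 0 < E ->
         rho_strip lambda alpha E = 2 * rho_mosaic lambda alpha E) &
      (forall E : R, E < 0 ->
         rho_strip lambda alpha E = 2 * rho_mosaic lambda alpha E - 1 / 2)].
Proof.
have irr := irrational_double alpha_irr.
split.
- by move=> E E0; rewrite IDS_dos // dos_pos // rho_stripE.
- by move=> E E0; rewrite IDS_dos // dos_neg // rho_stripE.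
- exists (1 / 2), 0; split; [exact: rho_at_right | exact: rho_at_left | by rewrite addr0].
- by move=> E E0; rewrite rho_stripE // rho_mosaic_pos //; lra.
- by move=> E E0; rewrite rho_stripE // rho_mosaic_neg //; lra.
Qed.
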